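(* As $n\to\infty$, $$\left.\frac{\mathrm d}{\mathrm dt}\alpha_{n-1}(t)\right|_{t=0}=\frac{\log n}{\pi^2n^2}+\frac{C_{\mathrm{lin}}}{n^2}+o(n^{-2}),$$ where $C_{\mathrm{lin}}$ is the real constant $$C_{\mathrm{lin}}=\frac{\gamma+\log 16}{\pi^2}+\frac1{4\pi}\int_{-1}^1\frac{J_*(x)}{\sqrt{1-x^2}}\,\mathrm dx .$$
   Context: $\gamma$ is Euler's constant. Let $B_*(x)=\log\frac{\arcsin x}{x}$ on $[-1,1]$, with $B_*(0)=0$. For $t\in\mathbb R$ let $\eta_t$ be the even probability measure on $[-1,1]$ $$\mathrm d\eta_t(x)=\frac{e^{tB_*(x)}}{\int_{-1}^1e^{tB_*(u)}\,\mathrm du}\,\mathrm dx.$$ The circle lift of an even probability measure $\eta$ on $[-1,1]$ is the distribution on the unit circle $\mathbb T$ of $e^{2i\arccos X}$, where $X$ has distribution $\eta$; it is symmetric under complex conjugation. For a conjugation-symmetric probability measure on $\mathbb T$ of infinite support, with monic orthogonal polynomials $\Phi_j$ and $\Phi_j^*(z)=z^j\overline{\Phi_j(1/\bar z)}$, the Verblunsky coefficients $\alpha_j\in(-1,1)$, $j\ge0$, are the real numbers given by $\Phi_{j+1}(z)=z\Phi_j(z)-\alpha_j\Phi_j^*(z)$, $\Phi_0=1$. The $\alpha_j(t)$ are the Verblunsky coefficients of the circle lift of $\eta_t$. The function $J_*$ is the continuous extension to $[-1,1]$ of $$J_*(x)=\frac{x}{\sqrt{1-x^2}\arcsin x}+\frac1{(\arcsin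 x)^2}-\frac1{x^2}-1-\frac2{\pi\sqrt{1-x^2}}\qquad(0<|x|<1),$$ with $J_*(0)=-\frac13-\frac2\pi$ and $J_*(\pm1)=\frac8{\pi^2}-2$. *)

(* Defs.v *)
From HB Require Import structures.
From mathcomp Require Import all_boot all_order all_algebra.
From mathcomp Require Import complex.
From mathcomp Require Import all_classical all_reals all_analysis.
From mathcomp Require Import measurable_realfun.
From mathcomp Require Import ring lra.
Set Implicit Arguments.
Unset Strict Implicit.
Unset Printing Implicit Defensive.
Import Order.TTheory GRing.Theory Num.Theory.
Import numFieldNormedType.Exports.
Local Open Scope classical_set_scope.
Local Open Scope complex_scope.
Local Open Scope ring_scope.

Definition Cborel (R : realType) := g_sigma_algebraType (@open (R[i]^o)).

(* [asin] and [acos] are only meaningful on [-1, 1]; they are constant outside. *)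
Definition Bstar {R : realType} (x : R) : R :=
  if x == 0 then 0 else ln (asin x / x).

Definition eta_pdf {R : realType} (t x : R) : R :=
  if -1 <= x <= 1 then
    expR (t * Bstar x) /
    (\int[lebesgue_measure]_(u in `[-1, 1]) expR (t * Bstar u))
  else 0.

Definition eta {R : realType} (t : R) : set R -> \bar R :=
  fun A => (\int[lebesgue_measure]_(x in A) (eta_pdf t x)%:E)%E.

Definition circle_map {R : realType} (x : R) : Cborel R :=
  cos (2 * acos x) +i* sin (2 * acos x).

Section circle_map.
Variable R : realType.

Lemma continuous_real_complex : continuous (fun x : R => x%:C : R[i]^o).
Proof.
move=> x; apply/cvgrPdist_lt => e; rewrite ltcE => /andP[/eqP e'0 e0].
have {e0 e'0 e}[r r0 ->] : exists2 r : R, 0 < r & e = r%:C.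
  by exists (complex.Re e) => //; apply/eqP; rewrite eq_complex -e'0 !eqxx.
near=> y; rewrite -rmorphB normc_def /= expr0n /= addr0 sqrtr_sqr ltcR.
by near: y; apply: cvgr_dist_lt => //; exact: cvg_id.
Unshelve. all: by end_near. Qed.

Lemma continuous_Complex (a b : R -> R) : continuous a -> continuous b ->
  continuous (fun x => a x +i* b x : R[i]^o).
Proof.
move=> ca cb.
have -> : (fun x => a x +i* b x : R[i]^o) =
          (fun x => ((a x)%:C : R[i]^o) + (('i : R[i]^o) * ((b x)%:C : R[i]^o))).
  by apply/funext => x; congr Complex; rewrite /= !(mul0r, mul1r, subr0, addr0, add0r).
move=> x; apply: cvgD; last (apply: cvgM; first exact: cvg_cst).
  apply: (@cvg_comp _ _ _ a (fun y : R => y%:C : R[i]^o) _ _ _ (ca x)).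
  exact: continuous_real_complex.
by apply: (@cvg_comp _ _ _ b (fun y : R => y%:C : R[i]^o) _ _ _ (cb x)); exact: continuous_real_complex.
Qed.

Lemma acos_out (x : R) : ~~ (-1 <= x <= 1) -> acos x = 0.
Proof.
move=> xI; rewrite acos.unlock getPN// => y /= [_ yx].
by move/negP: xI; apply; rewrite -yx cos_geN1 cos_le1.
Qed.

Lemma asin_out (x : R) : ~~ (-1 <= x <= 1) -> asin x = 0.
Proof.
move=> xI; rewrite asin.unlock getPN// => y /= [_ yx].
by move/negP: xI; apply; rewrite -yx sin_geN1 sin_le1.
Qed.

Lemma measurable_circle_map : measurable_fun setT (@circle_map R).
Proof.
pose g (x : R) : R[i]^o :=
  (x ^+ 2 *+ 2 - 1) +i* (x * Num.sqrt (1 - x ^+ 2) *+ 2).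
have cg : continuous g.
  apply: continuous_Complex => x.
    by apply: cvgB; [apply: cvgMn; exact: exprn_continuous|exact: cvg_cst].
  apply: cvgMn; apply: cvgM; first exact: cvg_id.
  apply: (@continuous_comp _ _ _ (fun x : R => 1 - x ^+ 2) Num.sqrt).
    by apply: cvgB; [exact: cvg_cst|exact: exprn_continuous].
  exact: sqrt_continuous.
have gE (x : R) : -1 <= x <= 1 -> circle_map x = g x.
  move=> xI; rewrite /circle_map /g mulr_natl cos_mulr2n sin_mulr2n.
  by rewrite sin_acos// acosK// in_itv.
have oE (x : R) : ~~ (-1 <= x <= 1) -> circle_map x = 1 +i* 0.
  by move=> xI; rewrite /circle_map (acos_out xI) mulr0 cos0 sin0.
apply: (@measurability _ _ R (Cborel R) setT (@circle_map R) (@open (R[i]^o))) => // _ [U oU <-]; rewrite setTI.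
have -> : circle_map @^-1` U =
    (`[-1, 1] `&` g @^-1` U) `|` (~` `[-1, 1] `&` [set _ | U (1 +i* 0)]).
  apply/seteqP; split => x /=; rewrite in_itv /=.
    move=> Ux; have [xI|xI] := boolP (-1 <= x <= 1).
      by left; split => //; rewrite -gE.
    by right; split => //; rewrite -(oE x).
  by move=> [[xI]|[/negP xI]]; rewrite -?gE// -(oE x).
apply: measurableU; apply: measurableI => //.
- apply: open_measurable; exact: open_comp.
- by apply: measurableC.
- have [u|u] := pselect (U (1 +i* 0)).
    by rewrite (_ : [set _ | _] = setT)//; apply/seteqP; split.
  by rewrite (_ : [set _ | _] = set0)//; apply/seteqP; split.
Qed.

HB.instance Definition _ :=
  isMeasurableFun.Build _ _ _ _ (@circle_map R) measurable_circle_map.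

End circle_map.

Section eta.
Variable R : realType.
Local Notation mu := (@lebesgue_measure R).

Lemma measurable_asin : measurable_fun setT (@asin R).
Proof.
have -> : [set: R] = `]-1, 1[ `|` ([set -1] `|` ([set 1] `|` ~` `[-1, 1])).
  apply/esym/seteqP; split => // x _ /=; rewrite !in_itv /=.
  have [xI|xI] := boolP (-1 <= x <= 1); last by right; right; right.
  have [->|xN1] := eqVneq x (-1); first by right; left.
  have [->|x1] := eqVneq x 1; first by right; right; left.
  by left; rewrite lt_neqAle eq_sym xN1 lt_neqAle x1.
have mC : measurable (~` `[-1, 1] : set R) by exact: measurableC.
apply/measurable_funU => //; first by do 2?apply: measurableU => //.
split.
  apply: open_continuous_measurable_fun; first exact: interval_open.
  move=> x; rewrite inE /= in_itv /=; exact: continuous_asin.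
apply/measurable_funU => //; first by apply: measurableU.
split; first exact: measurable_fun_set1.
apply/measurable_funU => //; split; first exact: measurable_fun_set1.
apply: (eq_measurable_fun (cst (0 : R))) => [x|]; last exact: measurable_cst.
by rewrite inE /= in_itv /= => /negP /asin_out ->.
Qed.

Lemma measurable_invr : measurable_fun setT (fun x : R => x^-1).
Proof.
rewrite -(setvU [set 0]); apply/measurable_funU => //; first exact: measurableC.
split; last exact: measurable_fun_set1.
apply: open_continuous_measurable_fun.
  by apply: closed_openC; apply: accessible_closed_set1; apply: hausdorff_accessible; exact: Rhausdorff.
by move=> x; rewrite inE /= => /eqP x0; exact: inv_continuous.
Qed.

Lemma measurable_Bstar : measurable_fun setT (@Bstar R).
Proof.
apply: measurable_fun_ifT => //; first by apply: measurable_fun_eqr.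
apply: measurableT_comp; first exact: measurable_ln.
by apply: measurable_funM; [exact: measurable_asin|exact: measurable_invr].
Qed.

Lemma asinN (x : R) : -1 <= x <= 1 -> asin (- x) = - asin x.
Proof.
move=> /andP[x1 x2]; have xN : -1 <= - x <= 1 by rewrite lerN2 x2 lerNl x1.
have xI : -1 <= x <= 1 by rewrite x1.
have [H1 H2] := asin_def xN; have [/andP[H3 H4] H5] := asin_def xI.
apply: sin_inj; rewrite ?in_itv //= ?sinN ?H2 ?H5 //.
by rewrite lerN2 H4 lerNl H3.
Qed.

Lemma Bstar_bounds (x : R) : -1 <= x <= 1 -> 0 <= Bstar x <= ln 2.
Proof.
have Bpos (y : R) : 0 < y <= 1 -> 0 <= Bstar y <= ln 2.
  move=> /andP[y0 y1]; rewrite /Bstar gt_eqF//.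
  have yI : -1 <= y <= 1 by rewrite y1 andbT (le_trans _ (ltW y0)).
  have aK : sin (asin y) = y by rewrite asinK// in_itv.
  have pi0 := pi_gt0 R.
  have ap : asin y <= pi / 2 by exact: asin_lepi2.
  have aN : - (pi / 2) <= asin y by exact: asin_geNpi2.
  have a0 : 0 < asin y.
    rewrite ltNge; apply/negP => aneg; suff : y <= 0 by rewrite leNgt y0.
    rewrite -aK -oppr_ge0 -sinN; apply: sin_ge0_pi.
    by rewrite oppr_ge0 aneg /=; lra.
  have sl (u : R) : 0 < u -> exists2 c, 0 < c < u & sin u = cos c * u.
    move=> u0; have [|c] := @MVT R sin cos 0 u u0 (fun z _ => is_derive_sin z).
      by apply: continuous_subspaceT; exact: continuous_sin.
    by rewrite sin0 !subr0 in_itv /= => ci ->; exists c.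
  have [c1 _ s1] := sl _ a0.
  have [|c2 /andP[c20 c2a] s2] := sl (asin y / 2); first by lra.
  have ea : asin y = (asin y / 2) *+ 2 by rewrite -mulr_natr divfK.
  have cle : cos (asin y / 2) <= cos c2.
    by apply: ltW; rewrite ltr_cos // ?in_itv /=; lra.
  have ch : 0 <= cos (asin y / 2) by apply: cos_ge0_pihalf; lra.
  have cc : cos (asin y) = cos (asin y / 2) ^+ 2 *+ 2 - 1.
    by rewrite {1}ea cos_mulr2n.
  have ss : y = (cos (asin y / 2) * sin (asin y / 2)) *+ 2.
    by rewrite -sin_mulr2n -ea.
  have ca : 0 <= cos (asin y) by apply: cos_ge0_pihalf; lra.
  have lo : y <= asin y.
    by rewrite -{1}aK s1 ler_piMl ?cos_le1 ?ltW.
  have hp : 1 / 2 <= cos (asin y / 2) * cos c2.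
    have : cos (asin y / 2) * cos (asin y / 2) <= cos (asin y / 2) * cos c2.
      exact: ler_wpM2l.
    by move: ca; rewrite cc expr2; lra.
  have hi : asin y <= 2 * y.
    have -> : 2 * y = 2 * (asin y * (cos (asin y / 2) * cos c2)).
      by rewrite {1}ss s2; field.
    by have := ler_wpM2l (ltW a0) hp; lra.
  rewrite ln_ge0 ?ler_pdivlMr ?mul1r//= ler_ln ?posrE ?divr_gt0//.
  by rewrite ler_pdivrMr.
move=> /andP[x1 x2]; have [x0|x0|->] := ltgtP x 0; last 2 first.
- by apply: Bpos; rewrite x0.
- by rewrite /Bstar eqxx lexx ln_ge0// ler1n.
suff -> : Bstar x = Bstar (- x) by apply: Bpos; rewrite oppr_gt0 x0 lerNl.
by rewrite /Bstar oppr_eq0 asinN ?x1// invrN mulrNN.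
Qed.

Let f (t x : R) := expR (t * Bstar x).
Let Z (t : R) := \int[mu]_(u in `[-1, 1]) f t u.

Let mf t : measurable_fun setT (f t).
Proof.
apply: measurableT_comp; first exact: measurable_expR.
by apply: measurable_funM => //; exact: measurable_Bstar.
Qed.

Let mI : mu `[-1, 1] = 2%:E.
Proof.
by rewrite lebesgue_measure_itv /= lte_fin ifT ?EFinN -?EFinB; [congr EFin|]; lra.
Qed.

Let f_bounds t x : -1 <= x <= 1 ->
  expR (- (`|t| * ln 2)) <= f t x <= expR (`|t| * ln 2).
Proof.
move=> /Bstar_bounds/andP[B0 B2]; rewrite !ler_expR -ler_norml normrM.
by rewrite ler_wpM2l// ger0_norm.
Qed.

Let ZE t : (\int[mu]_(u in `[(-1)%R, 1%R]) (f t u)%:E)%E = (Z t)%:E.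
Proof.
rewrite /Z /Rintegral fineK// ge0_fin_numE; last first.
  by apply: integral_ge0 => x _; rewrite lee_fin expR_ge0.
apply: (@le_lt_trans _ _ (\int[mu]_(u in `[(-1)%R, 1%R]) (expR (`|t| * ln 2))%:E)%E).
  apply: ge0_le_integral => //.
  - by move=> x _; rewrite lee_fin; exact: expR_ge0.
  - by apply/measurable_EFinP; apply: measurable_funTS; exact: mf.
  - by move=> x; rewrite /= in_itv /= lee_fin => /(@f_bounds t)/andP[].
by rewrite integral_cst// [X in (_ * X)%E]mI -EFinM ltry.
Qed.

Let Z_gt0 t : 0 < Z t.
Proof.
rewrite -lte_fin -ZE.
apply: (@lt_le_trans _ _ (\int[mu]_(u in `[(-1)%R, 1%R]) (expR (- (`|t| * ln 2)))%:E)%E).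
  by rewrite integral_cst// [X in (_ * X)%E]mI -EFinM lte_fin mulr_gt0 ?expR_gt0.
apply: ge0_le_integral => //; last first.
- by move=> x; rewrite /= in_itv /= lee_fin => /(@f_bounds t)/andP[].
- by apply/measurable_EFinP; apply: measurable_funTS; exact: mf.
Qed.

Lemma eta_pdf_ge0 t x : 0 <= @eta_pdf R t x.
Proof.
rewrite /eta_pdf; case: ifP => // _.
by rewrite divr_ge0 ?expR_ge0//; exact: ltW (Z_gt0 t).
Qed.

Lemma measurable_eta_pdf t : measurable_fun setT (@eta_pdf R t).
Proof.
apply: measurable_fun_ifT => //.
  by apply: measurable_and => //; exact: measurable_fun_ler.
by apply: measurable_funM => //; exact: mf.
Qed.

Let eta0 t : @eta R t set0 = 0%E.
Proof. by rewrite /eta integral_set0. Qed.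

Let eta_ge0 t A : (0 <= @eta R t A)%E.
Proof. by apply: integral_ge0 => /= x _; rewrite lee_fin eta_pdf_ge0. Qed.

Let eta_sigma_additive t : semi_sigma_additive (@eta R t).
Proof.
move=> /= F mF tF mUF; rewrite /eta; apply: cvg_toP.
  apply: ereal_nondecreasing_is_cvgn => m n mn.
  apply: lee_sum_nneg_natr => // k _ _.
  by apply: integral_ge0 => /= x Fkx; rewrite lee_fin eta_pdf_ge0.
rewrite ge0_integral_bigcup//=.
- apply: measurable_funTS; apply: measurableT_comp => //.
  exact: measurable_eta_pdf.
- by move=> x _; rewrite lee_fin eta_pdf_ge0.
Qed.

HB.instance Definition _ t := isMeasure.Build _ _ _ (@eta R t)
  (eta0 t) (eta_ge0 t) (@eta_sigma_additive t).

Let eta_setT t : @eta R t [set: _] = 1%:E.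
Proof.
rewrite /eta; transitivity (\int[mu]_(x in `[(-1)%R, 1%R]) ((Z t)^-1%:E * (f t x)%:E))%E.
  rewrite [RHS]integral_mkcond; apply: eq_integral => x _.
  rewrite patchE /eta_pdf; case: ifPn => xI; case: ifPn => //.
  - by rewrite mulrC EFinM.
  - by rewrite notin_setE /= in_itv /= xI.
  - by rewrite inE /= in_itv /= (negbTE xI).
rewrite ge0_integralZl//.
- by rewrite ZE -EFinM mulVf// gt_eqF.
- by apply/measurable_EFinP; apply: measurable_funTS; exact: mf.
- by move=> x _; rewrite lee_fin; exact: expR_ge0.
- by rewrite lee_fin invr_ge0 ltW.
Qed.

HB.instance Definition _ t :=
  @Measure_isProbability.Build _ _ R (@eta R t) (eta_setT t).

End eta.

Definition circle_lift {R : realType} (P : probability R R) :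
  probability (Cborel R) R := distribution P (@circle_map R).

Section opuc.
Context {R : realType}.
Implicit Types mu : probability (Cborel R) R.

Definition Cintegral mu (f : R[i] -> R[i]) : R[i] :=
  (\int[mu]_z complex.Re (f z)) +i* (\int[mu]_z complex.Im (f z)).

Definition monic_orthogonal mu (Phi : nat -> {poly R[i]}) : Prop :=
  [/\ forall j, size (Phi j) = j.+1,
      forall j, Phi j \is monic &
      forall j k, j != k -> Cintegral mu (fun z => (Phi j).[z] * ((Phi k).[z])^* ) = 0].

Definition reversed (j : nat) (p : {poly R[i]}) (z : R[i]) : R[i] :=
  z ^+ j * (p.[((z^* )^-1)])^*.

(* [z = 0] is excluded because [reversed] involves [1 / z^*]. *)
Definition is_verblunsky mu (alpha : nat -> R) : Prop :=
  exists2 Phi, monic_orthogonal mu Phi &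
    forall j z, z != 0 ->
      (Phi j.+1).[z] = z * (Phi j).[z] - (alpha j)%:C * reversed j (Phi j) z.

(* The default value of [get] is never used for measures of infinite support
   that are symmetric under conjugation. *)
Definition verblunsky mu : nat -> R := get [set alpha | is_verblunsky mu alpha].

End opuc.

Definition alpha {R : realType} (j : nat) (t : R) : R :=
  verblunsky (circle_lift (eta t)) j.

Definition euler_gamma {R : realType} : R :=
  lim ((fun n => \sum_(1 <= k < n.+1) k%:R^-1 - ln n%:R : R) @ \oo).

Definition Jstar {R : realType} (x : R) : R :=
  if x == 0 then - (1 / 3) - 2 / pi
  else if `|x| == 1 then 8 / pi ^+ 2 - 2
  else x / (Num.sqrt (1 - x ^+ 2) * asin x) + 1 / asin x ^+ 2 - 1 / x ^+ 2 - 1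
       - 2 / (pi * Num.sqrt (1 - x ^+ 2)).

Definition Clin {R : realType} : R :=
  (euler_gamma + ln 16) / pi ^+ 2 +
  1 / (4 * pi) *
  \int[lebesgue_measure]_(x in `[-1, 1]) (Jstar x / Num.sqrt (1 - x ^+ 2)).

(* Main.v *)
(* Idea.  Let P_n be the Legendre polynomials, g_k = binomial(2k, k) / 4^k and
   s(x) = sqrt (1 - x^2).
   - Verblunsky coefficients are rational functions of the trigonometric moments,
     so alpha_(n-1)'(0) is a double sum over the coefficients of the orthogonal
     polynomials at t = 0.  These are known in closed form (alpha_j(0) =
     -1/(2j+3)) and, on the circle, are combinations of P_n and P_n'.  This gives
       alpha_(n-1)'(0) = 1/(2n+1) int B ( n(n+1) P_n^2 - (1-x^2) P_n'^2 ),
     where the bracket is - ((1-x^2) P_n P_n')'.  Two integrations by parts yield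
       alpha_(n-1)'(0) = 1/(2(2n+1)) int ( J + 2/(pi s) ) P_n^2.
   - n P_n^2 dx converges weakly to dx/(pi s): the moments of P_n P_(n+m) and of
     cos (m arccos x) obey the same three-term recurrence in the limit.  This
     gives the integral of J in the constant.
   - The Fourier expansion P_n(cos th) = sum g_k g_(n-k) cos ((n-2k) th) turns
     int P_n^2 / s into pi sum (g_k g_(n-k))^2, which is asymptotically
     2/(pi n) times pi sum_(k <= n) g_k^2, Landau's constants, whose expansion
     provides log n + gamma + log 16. *)

(* The logarithm has its origin at the endpoints. [n P_n^2] approaches [1/(pi s)], and [1/s]
   integrated against that density diverges, so weak convergence cannot treat a [1/s] singularity.
   Since [x/(s asin x)] behaves like [2/(pi s)] at 1 and at -1, subtracting [2/(pi s)] is what makes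
   [Jstar] continuous on the closed interval. The integrand thus splits into a continuous part,
   where weak convergence is enough, and an explicit singular part, which must be evaluated to
   higher precision. Differentiating the recursion for the Verblunsky coefficients directly would
   bring in the derivatives of all earlier coefficients. Pairing the perturbed [Phi_n] with the
   reversed unperturbed [Phi_(n-1)] instead gives an exact formula for
   [alpha_(n-1)(t) - alpha_(n-1)(0)] in which only moments are differenced. No boundary terms
   survive the integrations by parts: [1 - x^2] and [(1 - x^2) B' = s/asin x - (1 - x^2)/x] both
   vanish at the endpoints. The integrands containing [1/s] are unbounded there, which calls for a
   fundamental theorem of calculus that asks only for integrability up to the ends. *)
Require Import Defs.
From HB Require Import structures.
From mathcomp Require Import all_boot all_order all_algebra.
From mathcomp Require Import complex.
From mathcomp Require Import all_classical all_reals all_analysis.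
From mathcomp Require Import measurable_realfun.
From mathcomp Require Import zify ring lra.
Import Order.TTheory GRing.Theory Num.Theory.
Import numFieldNormedType.Exports.
Set Implicit Arguments.
Unset Strict Implicit.
Unset Printing Implicit Defensive.
Local Open Scope classical_set_scope.
Local Open Scope ring_scope.

(** * Calculus on intervals *)

(* A non-class alias of [is_derive _ 1], which keeps typeclass resolution from
   unfolding pointwise expressions. *)
Definition hasder (R : realType) (f : R -> R) (x a : R) := is_derive x 1 f a.

Section derivation.
Variable R : realType.
Implicit Types (f g : R -> R) (x a b : R).

Lemma der_eq f x a b : hasder f x a -> a = b -> hasder f x b.
Proof. by move=> h <-. Qed.

Lemma derC c x : hasder (fun=> c : R) x 0.
Proof. exact: is_derive_cst. Qed.

Lemma derI x : hasder (fun y : R => y) x 1.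
Proof. exact: is_derive_id. Qed.

Lemma derD f g x a b : hasder f x a -> hasder g x b ->
  hasder (fun y => f y + g y) x (a + b).
Proof. exact: is_deriveD. Qed.

Lemma derN f x a : hasder f x a -> hasder (fun y => - f y) x (- a).
Proof. exact: is_deriveN. Qed.

Lemma derM f g x a b : hasder f x a -> hasder g x b ->
  hasder (fun y => f y * g y) x (f x * b + g x * a).
Proof. exact: is_deriveM. Qed.

Lemma derX f x a n : hasder f x a ->
  hasder (fun y => f y ^+ n) x (n%:R * f x ^+ n.-1 * a).
Proof.
move=> h; have := @is_deriveX _ _ f n x 1 a h; rewrite /hasder.
by congr (is_derive _ _ _ _); apply/funext => y; rewrite fctE.
Qed.

Lemma derV f x a : f x != 0 -> hasder f x a ->
  hasder (fun y => (f y)^-1) x (- (f x ^- 2) * a).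
Proof. exact: is_deriveV. Qed.

Lemma der_comp f g x a b : hasder f (g x) a -> hasder g x b ->
  hasder (fun y => f (g y)) x (a * b).
Proof. exact: is_derive1_comp. Qed.

Lemma der_sin g x b : hasder g x b ->
  hasder (fun y => sin (g y)) x (cos (g x) * b).
Proof. by apply: der_comp; exact: is_derive_sin. Qed.

Lemma der_cos g x b : hasder g x b ->
  hasder (fun y => cos (g y)) x (- sin (g x) * b).
Proof. by apply: der_comp; exact: is_derive_cos. Qed.

Lemma der_ln g x b : 0 < g x -> hasder g x b ->
  hasder (fun y => ln (g y)) x ((g x)^-1 * b).
Proof. by move=> g0; apply: der_comp; exact: is_derive1_ln. Qed.

Lemma der_horner (p : {poly R}) g x b : hasder g x b ->
  hasder (fun y => p.[g y]) x ((deriv p).[g x] * b).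
Proof. by apply: der_comp; exact: is_derive_poly. Qed.

Let nbhs_ge0 x : 0 < x -> \forall z \near x, 0 <= z.
Proof. by move=> x0; near do apply: ltW; exact: lt_nbhsr.
Unshelve. all: by end_near. Qed.

Lemma is_derive1_sqrt x : 0 < x -> is_derive x 1 (@Num.sqrt R) (2 * Num.sqrt x)^-1.
Proof.
move=> x0; have s0 : 0 < Num.sqrt x by rewrite sqrtr_gt0.
rewrite -{1}[x](@sqr_sqrtr R) ?ltW//.
have d2 : hasder (fun y : R => y ^+ 2) (Num.sqrt x) (2 * Num.sqrt x).
  by apply: der_eq; [apply: derX; exact: derI|rewrite /= expr1 mulr1].
apply: (@is_derive_inverse R (fun y => y ^+ 2) _ _ _ _ _ d2).
- near=> z; rewrite sqrtr_sqr ger0_norm//.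
  by near: z; exact: (nbhs_ge0 s0).
- by apply: filterE => z; exact: exprn_continuous.
- by rewrite mulf_neq0// gt_eqF.
Unshelve. all: by end_near. Qed.

Lemma der_sqrt g x b : 0 < g x -> hasder g x b ->
  hasder (fun y => Num.sqrt (g y)) x ((2 * Num.sqrt (g x))^-1 * b).
Proof. by move=> g0; apply: der_comp; exact: is_derive1_sqrt. Qed.

Lemma der_asin g x b : -1 < g x < 1 -> hasder g x b ->
  hasder (fun y => asin (g y)) x ((Num.sqrt (1 - g x ^+ 2))^-1 * b).
Proof. by move=> g0; apply: der_comp; exact: is_derive1_asin. Qed.

Lemma der_acos g x b : -1 < g x < 1 -> hasder g x b ->
  hasder (fun y => acos (g y)) x (- (Num.sqrt (1 - g x ^+ 2))^-1 * b).
Proof. by move=> g0; apply: der_comp; exact: is_derive1_acos. Qed.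

Lemma der_continuous f x a : hasder f x a -> {for x, continuous f}.
Proof. by case=> d _; exact/differentiable_continuous/derivable1_diffP. Qed.

End derivation.

Ltac der_step := first
  [ exact: derI | exact: derC | apply: derD | apply: derN | apply: derM
  | apply: derX | apply: der_sin | apply: der_cos | apply: der_horner ].
Ltac der := repeat der_step.

(** * The fundamental theorem of calculus for integrands singular at the endpoints *)

Section ftc.
Variable R : realType.
Local Notation mu := (@lebesgue_measure R).
Implicit Types (f F : R -> R) (a b : R).

(** The indefinite integral of [f] minus [F] is continuous on the closed interval and has zero
    derivative inside, so the mean value theorem makes it constant. This form allows [f] to be
    unbounded at [a] and [b]. *)
Lemma FTC2_integrable f F a b : a < b ->
  mu.-integrable `[a, b] (EFin \o f) ->
  {within `[a, b], continuous F} ->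
  (forall x, x \in `]a, b[ -> {for x, continuous f}) ->
  (forall x, x \in `]a, b[ -> hasder F x (f x)) ->
  \int[mu]_(x in `[a, b]) f x = F b - F a.
Proof.
move=> ab intf cF cf dF.
pose G x := parameterized_integral mu a x f - F x.
have dG x : x \in `]a, b[ -> hasder G x 0.
  move=> xab; have [ax xb] : a < x /\ x < b by apply/andP; rewrite in_itv in xab.
  have [d1 d2] := @continuous_FTC1_closed R f a x b xb intf ax (cf _ xab).
  rewrite derive1E in d2.
  have d3 : hasder (fun x => parameterized_integral mu a x f) x (f x).
    by split => //; rewrite -d2.
  by have := is_deriveB d3 (dF x xab); rewrite subrr.
have cG : {within `[a, b], continuous G}.
  move=> x; apply: cvgB; last exact: cF.
  by apply: parameterized_integral_continuous => //; exact: ltW.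
have [c _ ] := @MVT R G (fun=> 0) a b ab dG cG.
rewrite mul0r /G {2}/parameterized_integral set_itv1 Rintegral_set1 sub0r opprK.
rewrite /parameterized_integral.
move: (\int[mu]_(x in `[a, b]) f x) => I; lra.
Qed.

Lemma ge0_derive_le f F a b : a <= b ->
  {within `[a, b], continuous F} ->
  (forall x, x \in `]a, b[ -> 0 <= f x) ->
  (forall x, x \in `]a, b[ -> hasder F x (f x)) ->
  F a <= F b.
Proof.
rewrite le_eqVlt => /predU1P[->//|ab] cF f0 dF.
have [c cab Fab] := @MVT R F f a b ab dF cF.
by rewrite -subr_ge0 Fab mulr_ge0 ?subr_ge0 ?f0// ltW.
Qed.

(** On compact subintervals the integral is an increment of [F], hence at most [F b - F a] because
    [F] is monotone. Monotone convergence carries the bound to the open interval, and the endpoints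
    form a null set. *)
Lemma FTC2_ge0_integrable f F a b : a < b ->
  {within `[a, b], continuous F} ->
  (forall x, x \in `]a, b[ -> 0 <= f x) ->
  (forall x, x \in `]a, b[ -> {for x, continuous f}) ->
  (forall x, x \in `]a, b[ -> hasder F x (f x)) ->
  mu.-integrable `[a, b] (EFin \o f).
Proof.
move=> ab cF f0 cf dF.
have mf : measurable_fun `]a, b[ f.
  apply: open_continuous_measurable_fun; first exact: interval_open.
  by move=> x; rewrite inE; exact: cf.
have ba : 0 < b - a by rewrite subr_gt0.
(* Starting the denominators at 3 keeps [e n] below half the length, so that every [D n] is a
   nondegenerate interval. *)
pose e n : R := (b - a) / n.+3%:R.
have e0 n : 0 < e n by rewrite divr_gt0.
have e2 n : e n < (b - a) / 2 by rewrite ltr_pM2l// ltf_pV2 ?posrE// ltr_nat.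
have eab n : a + e n < b - e n by have := e2 n; lra.
pose D n : set R := `[a + e n, b - e n]%classic.
have Dsub n : D n `<=` `]a, b[.
  move=> x; rewrite /D /= !in_itv /= => /andP[h1 h2].
  by have := e0 n; have := e2 n; move=> *; apply/andP; split; lra.
have UD : \bigcup_n D n = `]a, b[%classic.
  apply/seteqP; split => [x [n _]|x]; first exact: Dsub.
  rewrite /= in_itv /= => /andP[ax xb].
  pose m := Num.min (x - a) (b - x).
  have m0 : 0 < m by rewrite lt_min !subr_gt0 ax.
  have [n nm] : exists n, e n < m.
    exists (Num.truncn ((b - a) / m)).
    rewrite /e ltr_pdivrMr// -ltr_pdivrMl// mulrC.
    apply: lt_trans (truncnS_gt _) _.
    by rewrite ltr_nat ltnW.
  exists n => //; move: nm; rewrite lt_min /D /= in_itv /= => /andP[h1 h2].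
  by apply/andP; split; lra.
have ndD : nondecreasing_seq D.
  move=> m n mn; apply/subsetPset => x; rewrite /D /= !in_itv /= => /andP[h1 h2].
  suff : e n <= e m by move=> ?; apply/andP; split; lra.
  by rewrite ler_pM2l// lef_pV2 ?posrE// ler_nat.
have mfD n : measurable_fun (D n) (EFin \o f).
  by apply/measurable_EFinP; exact: measurable_funS mf.
have iD n : (\int[mu]_(x in D n) (f x)%:E <= (F b - F a)%:E)%E.
  have cF1 : {within `[a + e n, b - e n], continuous F}.
    apply: continuous_subspaceW cF => x /(Dsub n); exact: subset_itv_oo_cc.
  have cf1 : {within `[a + e n, b - e n], continuous f}.
    apply: continuous_in_subspaceT => x; rewrite inE => /(Dsub n); exact: cf.
  have iDn : mu.-integrable `[a + e n, b - e n] (EFin \o f).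
    by apply: continuous_compact_integrable => //; exact: segment_compact.
  have D1 x : x \in `]a + e n, b - e n[ -> x \in `]a, b[.
    by move=> xD; apply: (Dsub n); exact: subset_itv_oo_cc.
  have I := @FTC2_integrable f F _ _ (eab n) iDn cF1.
  have {}I := I (fun x xD => cf x (D1 x xD)) (fun x xD => dF x (D1 x xD)).
  have fin : (\int[mu]_(x in `[(a + e n)%R, (b - e n)%R]) (f x)%:E)%E \is a fin_num.
    exact: (integrable_fin_num _ iDn).
  rewrite /D -(fineK fin) lee_fin -/(Rintegral _ _ _) I.
  have := e0 n; have := eab n => ea en.
  have mono u v : a <= u -> u <= v -> v <= b -> F u <= F v.
    move=> au uv vb.
    have D2 x : x \in `]u, v[ -> x \in `]a, b[.
      rewrite !in_itv /= => /andP[ux xv].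
      by rewrite (le_lt_trans au ux) (lt_le_trans xv vb).
    have cF2 : {within `[u, v], continuous F}.
      apply: continuous_subspaceW cF => x; rewrite /= !in_itv /= => /andP[ux xv].
      by rewrite (le_trans au ux) (le_trans xv vb).
    exact: (ge0_derive_le uv cF2 (fun x xD => f0 x (D2 x xD))
      (fun x xD => dF x (D2 x xD))).
  by apply: lerB; apply: mono; lra.
have ioo : mu.-integrable `]a, b[ (EFin \o f).
  apply/integrableP; split; first exact/measurable_EFinP.
  apply: (@le_lt_trans _ _ (F b - F a)%:E); last exact: ltry.
  under eq_integral.
    by move=> x; rewrite inE => xab; rewrite /= ger0_norm; [over|exact: f0].
  rewrite -UD.
  have cv : (\int[mu]_(x in D i) (f x)%:E @[i --> \oo] -->
      \int[mu]_(x in \bigcup_i D i) (f x)%:E)%E.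
    apply: ge0_nondecreasing_set_cvg_integral => //.
    - by move=> n; exact: measurable_itv.
    - by move=> n x /(Dsub n)/f0; rewrite lee_fin.
  rewrite -(cvg_lim _ cv)//.
  apply: lime_le; first by apply/cvg_ex; eexists; exact: cv.
  by apply: nearW => n; exact: iD.
have abE : `[a, b] `\` [set a; b] = `]a, b[%classic.
  apply/seteqP; split => x /=; rewrite !in_itv/=.
    by move=> [/andP[h1 h2] /not_orP[/eqP n1 /eqP n2]]; rewrite !lt_neqAle h1 h2 eq_sym n1 n2.
  move=> /andP[h1 h2]; split; first by rewrite !ltW.
  by move=> [] xE; move: h1 h2; rewrite xE ltxx.
have m2 : measurable [set a; b] by exact: measurableU.
have m0 : mu [set a; b] = 0%E.
  apply: countable_lebesgue_measure0; apply: finite_set_countable.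
  exact: finite_set2.
have mfc : measurable_fun `[a, b] (EFin \o f).
  rewrite -(setDKU (_ : [set a; b] `<=` `[a, b])); last first.
    by move=> x [] -> /=; rewrite in_itv /= lexx ltW.
  have mo : measurable (`[a, b] `\` [set a; b]) by rewrite abE.
  apply/(measurable_funU _ mo m2); split.
    by rewrite abE; exact/measurable_EFinP.
  apply/measurable_funU => //; split; exact: measurable_fun_set1.
refine (proj2 (@negligible_integrable _ _ _ mu _ _ _ m2 _ mfc m0) _) => //.
by rewrite abE.
Qed.

End ftc.

(** * Inverse trigonometric functions and the arcsine weight *)

Section arcs.
Variable R : realType.
Implicit Types x : R.
Local Notation mu := (@lebesgue_measure R).

Lemma asin1 : asin 1 = pi / 2 :> R.
Proof.
have := @sinK R (pi / 2); rewrite sin_pihalf; apply.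
by rewrite in_itv /= lexx andbT; have := @pi_gt0 R; lra.
Qed.

(** Continuity up to the endpoints, where [asin] has no derivative, comes from its being the inverse
    of a continuous injection of a segment. *)
Lemma within_continuous_asin : {within `[-1, 1], continuous (@asin R)}.
Proof.
have := @segment_can_le_continuous R (- (pi / 2)) (pi / 2) sin asin.
rewrite sinN sin_pihalf; apply.
- by have := @pi_gt0 R; lra.
- by apply: continuous_subspaceT; exact: continuous_sin.
- exact: sinK.
Qed.

Lemma within_continuous_acos : {within `[-1, 1], continuous (@acos R)}.
Proof.
have := @segment_can_ge_continuous R 0 pi cos acos.
rewrite cos0 cospi; apply; first exact: pi_ge0.
- by apply: continuous_subspaceT; exact: continuous_cos.
- exact: cosK.
Qed.

Definition sx x : R := Num.sqrt (1 - x ^+ 2).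

Lemma one_sub_sqr_gt0 x : -1 < x < 1 -> 0 < 1 - x ^+ 2.
Proof. by move=> /andP[h1 h2]; nra. Qed.

Lemma one_sub_sqr_ge0 x : -1 <= x <= 1 -> 0 <= 1 - x ^+ 2.
Proof. by move=> /andP[h1 h2]; nra. Qed.

Lemma sx_gt0 x : -1 < x < 1 -> 0 < sx x.
Proof. by move=> x1; rewrite sqrtr_gt0 one_sub_sqr_gt0. Qed.

Lemma sx_ge0 x : 0 <= sx x. Proof. exact: sqrtr_ge0. Qed.

Lemma sxE2 x : -1 <= x <= 1 -> sx x ^+ 2 = 1 - x ^+ 2.
Proof. by move=> x1; rewrite sqr_sqrtr// one_sub_sqr_ge0. Qed.

Lemma der_sx x : -1 < x < 1 -> hasder sx x (- (x / sx x)).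
Proof.
move=> x1; have s0 := sx_gt0 x1.
apply: der_eq; first by apply: der_sqrt; [exact: one_sub_sqr_gt0|der].
by rewrite /= -/(sx x); field; rewrite gt_eqF.
Qed.

Lemma continuous_sx : continuous sx.
Proof.
move=> x; apply: (@continuous_comp _ _ _ (fun x => 1 - x ^+ 2) Num.sqrt).
  by apply: der_continuous; der.
exact: sqrt_continuous.
Qed.

Lemma integrable_inv_sx : mu.-integrable `[-1, 1] (EFin \o (fun x => (sx x)^-1)).
Proof.
apply: (FTC2_ge0_integrable _ within_continuous_asin).
- by lra.
- by move=> x _; rewrite invr_ge0 sx_ge0.
- move=> x; rewrite in_itv /= => x1; apply: der_continuous.
  by apply: derV; [rewrite gt_eqF ?sx_gt0|exact: der_sx].
- by move=> x; rewrite in_itv /=; exact: is_derive1_asin.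
Qed.

Lemma integral_inv_sx : \int[mu]_(x in `[-1, 1]) (sx x)^-1 = pi.
Proof.
rewrite (@FTC2_integrable _ _ asin)//.
- rewrite asinN ?lexx ?andbT; last lra.
  by rewrite asin1; field.
- exact: integrable_inv_sx.
- exact: within_continuous_asin.
- move=> x; rewrite in_itv /= => x1; apply: der_continuous.
  by apply: derV; [rewrite gt_eqF ?sx_gt0|exact: der_sx].
- by move=> x; rewrite in_itv /=; exact: is_derive1_asin.
Qed.

End arcs.


Lemma cvg_bigsum (R : realType) (T I : Type) (F : set_system T) (r : seq I)
    (P : pred I) (f : I -> T -> R) (a : I -> R) : Filter F ->
  (forall i, P i -> f i x @[x --> F] --> a i) ->
  \sum_(i <- r | P i) f i x @[x --> F] --> \sum_(i <- r | P i) a i.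
Proof. by move=> FF; apply: cvg_big => //; exact: add_continuous. Qed.
(** * The Szego recurrence and its first-order perturbation *)

Section szego.
Variable F : fieldType.
Implicit Types (d : int -> F) (a p : nat -> F) (j k : nat) (l : int).

(** With real coefficients the reversed polynomial of degree [j] has coefficients [p (j - k)]. The
    guard [k <= j] is essential: beyond it truncated subtraction would return [p 0]. *)
Definition szego_step (c : F) j p k : F :=
  (if k is k'.+1 then p k' else 0) - (if (k <= j)%N then c * p (j - k)%N else 0).

(* [phi a j k] is the coefficient of [z ^ k] in the polynomial [Phi_j] attached
   to the Verblunsky coefficients [a]. *)
Fixpoint phi a j : nat -> F :=
  if j is j'.+1 then szego_step (a j') j' (phi a j') else fun k => (k == 0%N)%:R.

(* [pairing d p j l] is the scalar product with [z ^ l] of the polynomial of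
   degree [j] and coefficients [p], for the measure of moments [d]. *)
Definition pairing d p j l : F := \sum_(k < j.+1) p k * d (k%:Z - l).

Fixpoint szego d j : nat -> F :=
  if j is j'.+1 then
    let p := szego d j' in
    szego_step (pairing d p j' (-1) / pairing d p j' j') j' p
  else fun k => (k == 0%N)%:R.

(* The Verblunsky coefficients of moments [d]: orthogonality of [Phi_(j+1)] to 1
   determines the quotient. *)
Definition schur d j : F :=
  pairing d (szego d j) j (-1) / pairing d (szego d j) j j.

Lemma szegoE d j : szego d j = phi (schur d) j.
Proof. by elim: j => [//|j IH] /=; rewrite /schur IH. Qed.

Lemma phi_lead a j : phi a j j = 1.
Proof.
elim: j => [//|j IH] /=.
by rewrite /szego_step ltnn subr0.
Qed.

Lemma phi_const a j : phi a j.+1 0 = - a j.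
Proof. by rewrite /= /szego_step leq0n subn0 phi_lead mulr1 sub0r. Qed.

Lemma eq_phi a b j : (forall i, (i < j)%N -> a i = b i) -> phi a j = phi b j.
Proof.
elim: j => [//|j IH] ab /=; rewrite IH ?ab// => i ij; exact/ab/ltnW.
Qed.

(** Reading the reversed coefficients backwards and using that [d] is even turns the pairing of the
    reversed polynomial with [z ^ l] into that of the polynomial itself with [z ^ (j - l)]. *)
Lemma pairing_step d a j l : (forall l, d (- l) = d l) ->
  pairing d (phi a j.+1) j.+1 l =
  pairing d (phi a j) j (l - 1) - a j * pairing d (phi a j) j (j%:Z - l).
Proof.
move=> dE; rewrite /pairing /= /szego_step.
under eq_bigr do rewrite mulrBl.
rewrite sumrB big_ord_recl mul0r add0r; congr (_ - _).
  by apply: eq_bigr => k _; congr (_ * d _); rewrite /= /bump /=; lia.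
rewrite big_ord_recr /= ltnn mul0r addr0 mulr_sumr.
rewrite (reindex_inj rev_ord_inj) /=; apply: eq_bigr => k _.
rewrite subSS leq_subr mulrA; congr (_ * _); first by rewrite subKn// -ltnS.
by rewrite -dE; congr d; have := ltn_ord k; lia.
Qed.

Lemma pairing0 d a l : (forall l, d (- l) = d l) -> pairing d (phi a 0) 0 l = d l.
Proof.
by move=> dE; rewrite /pairing big_ord_recl big_ord0 /= mul1r addr0 sub0r dE.
Qed.

Section orthogonality.
Variable d : int -> F.
Hypothesis dE : forall l, d (- l) = d l.
Notation a := (schur d).
Notation N j := (pairing d (phi a j) j j).

Lemma schur_pairing j : N j != 0 -> pairing d (phi a j) j (-1) = a j * N j.
Proof. by move=> N0; rewrite {2}/schur szegoE divfK. Qed.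

(** For [l = 0] the two terms of [pairing_step] cancel by the choice of [schur]. For [l > 0] both
    vanish by induction, the exponents [l - 1] and [j - l] being again in range for the preceding
    polynomial. *)
Let orthogonal_lt j (l : nat) : (forall i, (i < j)%N -> N i != 0) ->
  (l < j)%N -> pairing d (phi a j) j l = 0.
Proof.
elim: j l => [//|j IH] [|l] N0 lj; rewrite pairing_step//.
  by rewrite sub0r subr0 schur_pairing ?N0// subrr.
rewrite (_ : l.+1%:Z - 1 = l%:Z); last lia.
rewrite (_ : j%:Z - l.+1%:Z = (j - l.+1)%N%:Z); last lia.
have N1 i : (i < j)%N -> N i != 0 by move=> ij; exact/N0/ltnW.
by rewrite !IH ?mulr0 ?subr0//; lia.
Qed.

(** The purely algebraic trace of a positive measure of infinite support: the squared norm of a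
    monic polynomial does not vanish. *)
Hypothesis nondegenerate : forall j (p : nat -> F), p j = 1 ->
  \sum_(l < j.+1) p l * pairing d p j l != 0.

(** Orthogonality to lower powers collapses the quadratic form at [Phi_j] to [N j]. Strong induction
    is needed because that orthogonality itself divides by the earlier [N i]. *)
Lemma pairing_lead_neq0 j : N j != 0.
Proof.
elim/ltn_ind: j => j IH.
have := nondegenerate (phi_lead a j).
rewrite big_ord_recr /= big1 ?add0r ?phi_lead ?mul1r// => l _.
by rewrite orthogonal_lt ?mulr0.
Qed.

Lemma szego_orthogonal j (l : nat) : (l < j)%N -> pairing d (phi a j) j l = 0.
Proof. by apply: orthogonal_lt => i _; exact: pairing_lead_neq0. Qed.

(* Pairing with the reversed [Phi_m] isolates the two extreme coefficients of
   [p]; for [p = Phi_(m+1)] of perturbed moments it isolates the difference of the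
   two coefficients [a m]. *)
Lemma schur_perturbation (p : nat -> F) m :
  \sum_(l < m.+1) phi a m (m - l)%N * pairing d p m.+1 l =
  (p m.+1 * a m + p 0%N) * pairing d (phi a m) m m.
Proof.
rewrite /pairing; under eq_bigr do rewrite mulr_sumr.
rewrite exchange_big /=.
have E (k : 'I_m.+2) : \sum_(l < m.+1) phi a m (m - l)%N * (p k * d (k%:Z - l%:Z)) =
    p k * pairing d (phi a m) m (m%:Z - k%:Z).
  rewrite /pairing mulr_sumr (reindex_inj rev_ord_inj) /=.
  apply: eq_bigr => l _; rewrite subSS subKn -1?ltnS// mulrCA.
  by congr (_ * (_ * d _)); have := ltn_ord l; lia.
under eq_bigr do rewrite E.
rewrite big_ord_recl big_ord_recr /= big1 ?add0r.
  rewrite subr0 (_ : m%:Z - _ = -1); last by rewrite /bump /=; lia.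
  by rewrite schur_pairing ?pairing_lead_neq0// /bump /= add1n -/(pairing d (phi a m) m m); ring.
move=> k _; rewrite (_ : m%:Z - _ = (m - k.+1)%N%:Z); last first.
  by rewrite /bump /=; have := ltn_ord k; lia.
by rewrite szego_orthogonal ?mulr0//; have := ltn_ord k; lia.
Qed.

End orthogonality.
End szego.

(** * Differentiating Verblunsky coefficients with respect to a parameter *)

Section schur_derivative.
Variables (R : realType) (d : R -> int -> R) (d1 : int -> R).
Hypothesis dE : forall t l, d t (- l) = d t l.
Hypothesis nondegenerate : forall t j (p : nat -> R), p j = 1 ->
  \sum_(l < j.+1) p l * pairing (d t) p j l != 0.
Hypothesis d_cvg : forall l, d t l @[t --> 0^'] --> d 0 l.
Hypothesis d_der : forall l, t^-1 * (d t l - d 0 l) @[t --> 0^'] --> d1 l.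
Notation a t := (schur (d t)).

(** Each step of the recursion is a rational operation on moments whose denominator is nonzero at
    [t = 0]. *)
Lemma cvg_szego j k : phi (a t) j k @[t --> 0^'] --> phi (a 0) j k.
Proof.
elim: j k => [|j IH] k; first exact: cvg_cst.
have cp l : pairing (d t) (phi (a t) j) j l @[t --> 0^'] -->
    pairing (d 0) (phi (a 0) j) j l.
  by apply: cvg_bigsum => i _; apply: cvgM; [exact: IH|exact: d_cvg].
have ca : a t j @[t --> 0^'] --> a 0 j.
  rewrite /schur; under eq_fun do rewrite szegoE.
  rewrite szegoE; apply: cvgM; first exact: cp.
  apply: cvgV; last exact: cp.
  exact: (pairing_lead_neq0 (@dE 0) (@nondegenerate 0)).
rewrite /= /szego_step; apply: cvgB.
  by case: k => [|k]; [exact: cvg_cst|exact: IH].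
by case: ifP => _; [apply: cvgM|exact: cvg_cst].
Qed.

Definition schur_der m :=
  (\sum_(l < m.+1) \sum_(k < m.+2)
    phi (a 0) m (m - l)%N * (phi (a 0) m.+1 k * d1 (k%:Z - l%:Z))) /
  pairing (d 0) (phi (a 0) m) m m.

(** [Phi_(m+1)] for the moments [d t] is paired with the reversed [Phi_m] for [d 0]. Under [d t] the
    result is zero by orthogonality; under [d 0] it is [a 0 m - a t m] times the norm, by
    [schur_perturbation]. Subtracting leaves difference quotients of moments only, so the
    coefficients of [Phi_(m+1)] merely have to converge. *)
Lemma cvg_schur_der m :
  t^-1 * (a t m - a 0 m) @[t --> 0^'] --> schur_der m.
Proof.
have E t : t^-1 * (a t m - a 0 m) =
    (\sum_(l < m.+1) \sum_(k < m.+2) phi (a 0) m (m - l)%N *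
      (phi (a t) m.+1 k * (t^-1 * (d t (k%:Z - l%:Z) - d 0 (k%:Z - l%:Z))))) /
    pairing (d 0) (phi (a 0) m) m m.
  apply/esym/(canLR (mulfK (pairing_lead_neq0 (@dE 0) (@nondegenerate 0) m))).
  have := schur_perturbation (@dE 0) (@nondegenerate 0) (phi (a t) m.+1) m.
  rewrite phi_lead phi_const => S0.
  have S1 : \sum_(l < m.+1) phi (a 0) m (m - l)%N *
      pairing (d t) (phi (a t) m.+1) m.+1 l = 0.
    rewrite big1// => l _.
    by rewrite (szego_orthogonal (@dE t) (@nondegenerate t)) ?mulr0.
  transitivity (t^-1 * (\sum_(l < m.+1) phi (a 0) m (m - l)%N *
      pairing (d t) (phi (a t) m.+1) m.+1 l -
    \sum_(l < m.+1) phi (a 0) m (m - l)%N *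
      pairing (d 0) (phi (a t) m.+1) m.+1 l)); last by rewrite S1 S0; ring.
  rewrite -sumrB mulr_sumr; apply: eq_bigr => l _.
  rewrite /pairing -mulrBr -sumrB mulr_sumr mulr_sumr.
  by apply: eq_bigr => k _; ring.
under eq_fun do rewrite E.
apply: cvgM; last exact: cvg_cst.
apply: cvg_bigsum => l _; apply: cvg_bigsum => k _.
apply: cvgM; first exact: cvg_cst.
by apply: cvgM; [exact: cvg_szego|exact: d_der].
Qed.

End schur_derivative.

(** * Trigonometric moments of the measures *)

Section bounded_measurable.
Variable R : realType.
Local Notation mu := (@lebesgue_measure R).
Implicit Types f g : R -> R.

(* Bounded and measurable on [-1, 1], hence integrable there, also against 1 / [sx]. *)
Definition bm f := measurable_fun (`[-1, 1] : set R) f /\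
  exists M : R, forall x : R, -1 <= x <= 1 -> `|f x| <= M.

Lemma bm_cst c : bm (fun=> c).
Proof. by split; [exact: measurable_cst|exists `|c|]. Qed.

Lemma bmD f g : bm f -> bm g -> bm (fun x => f x + g x).
Proof.
move=> [mf [M fM]] [mg [N gN]]; split; first exact: measurable_funD.
exists (M + N) => x x1; apply: le_trans (ler_normD _ _) _.
by rewrite lerD ?fM ?gN.
Qed.

Lemma bmM f g : bm f -> bm g -> bm (fun x => f x * g x).
Proof.
move=> [mf [M fM]] [mg [N gN]]; split; first exact: measurable_funM.
exists (M * N) => x x1; rewrite normrM.
by rewrite ler_pM ?fM ?gN.
Qed.

Lemma bmN f : bm f -> bm (fun x => - f x).
Proof.
move=> [mf [M fM]]; split; first exact: measurableT_comp.
by exists M => x x1; rewrite normrN fM.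
Qed.

Lemma bmB f g : bm f -> bm g -> bm (fun x => f x - g x).
Proof. by move=> bf bg; apply: bmD => //; exact: bmN. Qed.

Lemma bmX f n : bm f -> bm (fun x => f x ^+ n).
Proof.
move=> bf; elim: n => [|n IH]; first exact: bm_cst.
by under eq_fun do rewrite exprS; exact: bmM.
Qed.

Lemma bm_sum I (r : seq I) (P : pred I) (f : I -> R -> R) :
  (forall i, bm (f i)) -> bm (fun x => \sum_(i <- r | P i) f i x).
Proof.
move=> bf; elim: r => [|i r IH].
  by under eq_fun do rewrite big_nil; exact: bm_cst.
under eq_fun do rewrite big_cons; case: (P i) => //; exact: bmD.
Qed.

Lemma bm_continuous f : {within `[-1, 1], continuous f} -> bm f.
Proof.
move=> cf; split; first exact: subspace_continuous_measurable_fun.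
have N11 : (-1 : R) <= 1 by lra.
have [c _ cM] := EVT_max N11 cf; have [c' _ c'm] := EVT_min N11 cf.
exists (`|f c| + `|f c'|) => x x1.
have x1' : x \in `[-1, 1] by rewrite in_itv.
have := cM x x1'; have := c'm x x1' => h1 h2.
have := ler_norm (f c); have := ler_norm (- f c'); rewrite normrN => h3 h4.
have := normr_ge0 (f c); have := normr_ge0 (f c') => h5 h6.
by rewrite ler_norml; apply/andP; split; lra.
Qed.

Lemma bm_integrable f : bm f -> mu.-integrable `[-1, 1] (EFin \o f).
Proof.
move=> [mf [M fM]]; apply: measurable_bounded_integrable => //.
  by rewrite /= lebesgue_measure_itv /=; case: ifP => _; rewrite -?EFinB ltry.
exists M; split; first exact: num_real.
by move=> N MN x /=; rewrite in_itv /= => x1; exact: le_trans (fM _ x1) (ltW MN).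
Qed.

Lemma bm_inv_sx_integrable f : bm f ->
  mu.-integrable `[-1, 1] (EFin \o (fun x => f x / sx x)).
Proof.
move=> [mf [M fM]].
have : mu.-integrable `[-1, 1] (fun x : R => M%:E * ((sx x)^-1)%:E)%E.
  by apply: integrableZl => //; exact: integrable_inv_sx.
apply: le_integrable => //.
  apply/measurable_EFinP; apply: measurable_funM => //.
  by have /integrableP[/measurable_EFinP] := @integrable_inv_sx R.
move=> x /=; rewrite in_itv /= => x1; rewrite lee_fin !normrM.
apply: ler_wpM2r => //; apply: le_trans (fM x x1) (ler_norm _).
Qed.

Notation II f := (\int[mu]_(x in `[-1, 1]) f x).

Lemma bm_intD f g : bm f -> bm g ->
  \int[mu]_(x in `[-1, 1]) (f x + g x) = II f + II g.
Proof. by move=> bf bg; rewrite RintegralD//; exact: bm_integrable. Qed.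

Lemma bm_intB f g : bm f -> bm g ->
  \int[mu]_(x in `[-1, 1]) (f x - g x) = II f - II g.
Proof. by move=> bf bg; rewrite RintegralB//; exact: bm_integrable. Qed.

Lemma bm_intZ c f : bm f -> \int[mu]_(x in `[-1, 1]) (c * f x) = c * II f.
Proof. by move=> bf; rewrite RintegralZl//; exact: bm_integrable. Qed.

Lemma bm_int_sum I (r : seq I) (P : pred I) (f : I -> R -> R) :
  (forall i, bm (f i)) ->
  \int[mu]_(x in `[-1, 1]) (\sum_(i <- r | P i) f i x) =
  \sum_(i <- r | P i) II (f i).
Proof.
move=> bf; elim: r => [|i r IH].
  rewrite big_nil; under eq_Rintegral do rewrite big_nil.
  by rewrite Rintegral_cst// mul0r.
rewrite big_cons; under eq_Rintegral do rewrite big_cons.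
case: (P i) => //; rewrite bm_intD ?IH//; exact: bm_sum.
Qed.

Lemma II_cst c : \int[mu]_(x in `[-1, 1]) c = c * 2.
Proof.
rewrite Rintegral_cst//; congr (_ * _).
rewrite /= lebesgue_measure_itv /= ifT; last by rewrite lte_fin; lra.
rewrite -EFinB /=; lra.
Qed.

Lemma bm_horner (p : {poly R}) : bm (fun x => p.[x]).
Proof. by apply: bm_continuous; apply: continuous_subspaceT => x; exact: continuous_horner. Qed.

Lemma bm_id : bm (fun x : R => x).
Proof. by apply: bm_continuous; apply: continuous_subspaceT => x; exact: cvg_id. Qed.

Lemma bm_int_norm_le f c : bm f -> (forall x, -1 <= x <= 1 -> `|f x| <= c) ->
  `|II f| <= 2 * c.
Proof.
move=> bf fc; apply: le_trans (le_normr_Rintegral _ (bm_integrable bf)) _ => //.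
rewrite mulrC -II_cst; apply: le_Rintegral => //.
- by apply: integrable_norm => //; exact: bm_integrable.
- exact: (bm_integrable (bm_cst c)).
Qed.

End bounded_measurable.
Notation II f := (\int[lebesgue_measure]_(x in `[-1, 1]) f x).

(** * The moments as functions of t and their derivative at 0 *)

Section moments.
Variable R : realType.
Local Notation mu := (@lebesgue_measure R).
Implicit Types (t x : R) (l : int).

Lemma ln2_le1 : ln 2 <= 1 :> R.
Proof. by have := @le_ln1Dx R 1; apply; lra. Qed.

Lemma Bstar_norm_le x : -1 <= x <= 1 -> `|Bstar x| <= 1.
Proof.
move=> /Bstar_bounds/andP[h1 h2]; rewrite ger0_norm//.
exact: le_trans h2 ln2_le1.
Qed.

Lemma bm_Bstar : bm (@Bstar R).
Proof.
split; last by exists 1; exact: Bstar_norm_le.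
by apply: measurable_funTS; exact: measurable_Bstar.
Qed.

Lemma bm_weight t : bm (fun x => expR (t * Bstar x)).
Proof.
split.
  apply: measurable_funTS; apply: measurableT_comp; first exact: measurable_expR.
  by apply: measurable_funM => //; exact: measurable_Bstar.
exists (expR `|t|) => x x1; rewrite ger0_norm ?expR_ge0// ler_expR.
apply: le_trans (ler_norm _) _; rewrite normrM ler_piMr//.
exact: Bstar_norm_le.
Qed.

Lemma bm_cos (a b : R) : bm (fun x => cos (a * acos x + b)).
Proof.
apply: bm_continuous => x; apply: continuous_comp; last exact: continuous_cos.
apply: cvgD; last exact: cvg_cst.
by apply: cvgM; [exact: cvg_cst|exact: within_continuous_acos].
Qed.

Lemma bm_sin (a b : R) : bm (fun x => sin (a * acos x + b)).
Proof.
apply: bm_continuous => x; apply: continuous_comp; last exact: continuous_sin.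
apply: cvgD; last exact: cvg_cst.
by apply: cvgM; [exact: cvg_cst|exact: within_continuous_acos].
Qed.

(** The argument of [z ^ l] at the point [z = circle_map x]. *)
Definition angle l x : R := 2 * l%:~R * acos x.

Lemma bm_cos_angle l : bm (fun x => cos (angle l x)).
Proof. by have := bm_cos (2 * l%:~R) 0; under eq_fun do rewrite addr0. Qed.

Lemma bm_sin_angle l : bm (fun x => sin (angle l x)).
Proof. by have := bm_sin (2 * l%:~R) 0; under eq_fun do rewrite addr0. Qed.

(* The unnormalised moments of the circle lift of [eta t]. *)
Definition moment t l : R := II (fun x => cos (angle l x) * expR (t * Bstar x)).

Lemma momentN t l : moment t (- l) = moment t l.
Proof.
apply: eq_Rintegral => x _; congr (_ * _).
by rewrite /angle mulrNz mulrN mulNr cosN.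
Qed.

(** From [1 - u <= expR (- u)] one gets [expR u * (1 - u) <= 1], so the remainder is at most
    [u^2 / (1 - u)]. *)
Lemma expR_sub_le (u : R) : `|u| <= 1 / 2 -> `|expR u - 1 - u| <= 2 * u ^+ 2.
Proof.
rewrite ler_norml => /andP[u1 u2].
have h1 := expR_ge1Dx u; have h2 := expR_ge1Dx (- u).
rewrite ger0_norm; last lra.
have e0 := expR_gt0 u.
have : expR u * (1 - u) <= 1.
  by apply: le_trans (_ : expR u * expR (- u) <= 1); [rewrite ler_pM2l|rewrite expRxMexpNx_1].
by nra.
Qed.

(** Differentiation under the integral sign: as [Bstar] is bounded by 1, the quadratic remainder of
    the exponential is uniform in [x]. *)
Lemma moment_der l :
  t^-1 * (moment t l - moment 0 l) @[t --> 0^'] -->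
  II (fun x => cos (angle l x) * Bstar x).
Proof.
apply/cvgrPdist_le => e e0.
(* [1 / 2] is the range of [expR_sub_le]; an integrand bounded by [2 |t|] on an interval of length 2
   accounts for [e / 4]. *)
have small : \forall t \near (0 : R)^', t != 0 /\ `|t| <= Num.min (1 / 2) (e / 4).
  near=> t; split; first by near: t; exact: nbhs_dnbhs_neq.
  near: t; apply: dnbhs0_le; rewrite lt_min; apply/andP; split; lra.
near=> t; have [t0] : t != 0 /\ `|t| <= Num.min (1 / 2) (e / 4) by near: t.
rewrite le_min => /andP[t2 te].
pose g x := cos (angle l x) * (t^-1 * (t * Bstar x - (expR (t * Bstar x) - 1))).
have bw := bm_weight t; have bc := bm_cos_angle l; have bB := bm_Bstar.
have -> : II (fun x => cos (angle l x) * Bstar x) -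
    t^-1 * (moment t l - moment 0 l) = II g.
  rewrite /moment -bm_intB; [|exact: bmM|apply: bmM => //; exact: bm_weight].
  rewrite -bm_intZ; last by apply: bmB; apply: bmM => //; exact: bm_weight.
  rewrite -bm_intB; first last.
  - apply: bmM; first exact: bm_cst.
    by apply: bmB; apply: bmM => //; exact: bm_weight.
  - exact: bmM.
  by apply: eq_Rintegral => x _; rewrite /g mul0r expR0; field.
have bg : bm g.
  apply: bmM => //; apply: bmM; first exact: bm_cst.
  apply: bmB; first by apply: bmM => //; exact: bm_cst.
  by apply: bmB => //; exact: bm_cst.
apply: le_trans (_ : 2 * (2 * `|t|) <= e); last lra.
apply: bm_int_norm_le => // x x1.
have B1 := Bstar_norm_le x1.
have tB : `|t * Bstar x| <= `|t| by rewrite normrM ler_piMr.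
have := @expR_sub_le (t * Bstar x) (le_trans tB t2).
rewrite /g normrM => h.
apply: (@le_trans _ _ (1 * `|t^-1 * (t * Bstar x - (expR (t * Bstar x) - 1))|)).
  by apply: ler_wpM2r => //; exact: cos_max.
rewrite mul1r normrM normfV ler_pdivrMl ?normr_gt0// distrC opprB addrA in h *.
apply: le_trans h _.
rewrite -[X in 2 * X]ger0_norm ?sqr_ge0// normrX.
have := ler_pM (normr_ge0 _) (normr_ge0 _) tB tB.
by rewrite expr2; lra.
Unshelve. all: by end_near. Qed.

Lemma moment_cvg l : moment t l @[t --> 0^'] --> moment 0 l.
Proof.
have -> : moment ^~ l = fun t => moment 0 l + t * (t^-1 * (moment t l - moment 0 l)).
  apply/funext => t; have [->|t0] := eqVneq t 0; first by rewrite mul0r addr0.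
  by rewrite mulrA divff// mul1r addrC subrK.
rewrite -[X in _ --> X]addr0; apply: cvgD; first exact: cvg_cst.
rewrite -[X in _ --> X](mul0r (II (fun x => cos (angle l x) * Bstar x))).
by apply: cvgM; [exact: (cvg_within_filter _ cvg_id)|exact: moment_der].
Qed.

End moments.

(** * Real polynomials on the circle and nondegeneracy of the moments *)

Section circle_polynomials.
Variable R : realType.
Local Notation mu := (@lebesgue_measure R).
Implicit Types (x t : R) (p q : nat -> R) (j k l : nat).

Definition cos_sum p j x : R := \sum_(k < j.+1) p k * cos (angle k x).
Definition sin_sum p j x : R := \sum_(k < j.+1) p k * sin (angle k x).

Definition cpoly p j : {poly R[i]} := \poly_(k < j.+1) (p k)%:C%C.

Lemma circle_mapX x k :
  (circle_map x : R[i]) ^+ k = (cos (angle k x) +i* sin (angle k x))%C.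
Proof.
elim: k => [|k IH].
  by rewrite expr0 /angle mulr0 mul0r cos0 sin0.
rewrite exprS IH /circle_map /angle; apply/eqP; rewrite eq_complex /=.
have -> : 2 * k.+1%:~R * acos x = 2 * acos x + 2 * k%:~R * acos x.
  by rewrite intS intrD; ring.
by rewrite cosD sinD; apply/andP; split; apply/eqP; ring.
Qed.

Lemma horner_cpoly p j (z : R[i]) :
  (cpoly p j).[z] = \sum_(k < j.+1) (p k)%:C%C * z ^+ k.
Proof. by rewrite horner_poly. Qed.

Lemma Complex_sum (I : Type) (r : seq I) (P : pred I) (f g : I -> R) :
  (\sum_(i <- r | P i) (f i +i* g i)%C) =
  ((\sum_(i <- r | P i) f i) +i* (\sum_(i <- r | P i) g i))%C :> R[i].
Proof.
elim: r => [|i r IH]; first by rewrite !big_nil.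
by rewrite !big_cons; case: (P i); rewrite IH.
Qed.

Lemma horner_cpoly_circle p j x :
  (cpoly p j).[circle_map x] = (cos_sum p j x +i* sin_sum p j x)%C.
Proof.
rewrite horner_cpoly -Complex_sum; apply: eq_bigr => k _.
rewrite circle_mapX; apply/eqP; rewrite eq_complex /=.
by rewrite !mul0r subr0 addr0 !eqxx.
Qed.

Lemma bm_cos_sum p j : bm (cos_sum p j).
Proof. by apply: bm_sum => k; apply: bmM; [exact: bm_cst|exact: bm_cos_angle]. Qed.

Lemma bm_sin_sum p j : bm (sin_sum p j).
Proof. by apply: bm_sum => k; apply: bmM; [exact: bm_cst|exact: bm_sin_angle]. Qed.

(** The real part of [p(z)] times the conjugate of [q(z)] at [z = circle_map x]; [sin_sum_cos_sum]
    is the imaginary part. *)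
Lemma cos_sum_sin_sum p j q m x :
  cos_sum p j x * cos_sum q m x + sin_sum p j x * sin_sum q m x =
  \sum_(l < m.+1) q l * \sum_(k < j.+1) p k * cos (angle (k%:Z - l%:Z) x).
Proof.
rewrite /cos_sum /sin_sum !(mulrC (\sum_(k < j.+1) _)) !mulr_suml -big_split /=.
apply: eq_bigr => l _; rewrite !mulr_sumr -big_split /=; apply: eq_bigr => k _.
rewrite (_ : angle (_ - _) x = angle k x - angle l x).
  by rewrite cosB; ring.
by rewrite /angle intrD mulrNz; ring.
Qed.

Lemma sin_sum_cos_sum p j q m x :
  sin_sum p j x * cos_sum q m x - cos_sum p j x * sin_sum q m x =
  \sum_(l < m.+1) q l * \sum_(k < j.+1) p k * sin (angle (k%:Z - l%:Z) x).
Proof.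
rewrite /cos_sum /sin_sum !(mulrC (\sum_(k < j.+1) _)) !mulr_suml -sumrB.
apply: eq_bigr => l _; rewrite !mulr_sumr -sumrB; apply: eq_bigr => k _.
rewrite (_ : angle (_ - _) x = angle k x - angle l x).
  by rewrite sinB; ring.
by rewrite /angle intrD mulrNz; ring.
Qed.

Lemma pairing_moment t p j q m :
  \sum_(l < m.+1) q l * pairing (moment t) p j l =
  II (fun x => (cos_sum p j x * cos_sum q m x + sin_sum p j x * sin_sum q m x) *
               expR (t * Bstar x)).
Proof.
under eq_Rintegral do rewrite cos_sum_sin_sum mulr_suml.
rewrite bm_int_sum; last first.
  move=> l; apply: bmM; last exact: bm_weight.
  apply: bmM; first exact: bm_cst.
  by apply: bm_sum => k; apply: bmM; [exact: bm_cst|exact: bm_cos_angle].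
apply: eq_bigr => l _; under eq_Rintegral do rewrite -mulrA mulr_suml.
rewrite bm_intZ; last first.
  apply: bm_sum => k; apply: bmM; last exact: bm_weight.
  by apply: bmM; [exact: bm_cst|exact: bm_cos_angle].
rewrite bm_int_sum; last first.
  move=> k; apply: bmM; last exact: bm_weight.
  by apply: bmM; [exact: bm_cst|exact: bm_cos_angle].
congr (_ * _); apply: eq_bigr => k _.
under eq_Rintegral do rewrite -mulrA.
rewrite bm_intZ//; apply: bmM; [exact: bm_cos_angle|exact: bm_weight].
Qed.

Lemma Re_circle_map x : -1 <= x <= 1 ->
  complex.Re (circle_map x : R[i]) = 2 * x ^+ 2 - 1.
Proof.
move=> x1; rewrite /= mulrC mulr_natr cos_mulr2n acosK ?in_itv//.
by rewrite -mulr_natl.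
Qed.

(** A zero [x] gives the root [circle_map x] of [cpoly p j], whose real part is [2 x^2 - 1].
    Restricting to [x >= 0] makes [x] recoverable from the root, by the map [g]. *)
Lemma finite_zeros p j : p j = 1 ->
  finite_set [set x : R | 0 <= x <= 1 /\ cos_sum p j x ^+ 2 + sin_sum p j x ^+ 2 = 0].
Proof.
move=> pj; set P := cpoly p j.
have P0 : P != 0.
  apply/eqP => /(congr1 (fun q : {poly R[i]} => q`_j)).
  by rewrite coef_poly ltnSn coef0 pj => /eqP; rewrite oner_eq0.
(* If no list contained all the roots, roots could be added one by one up to [size P] distinct ones,
   too many for a nonzero polynomial. *)
have [rs rsP] : exists rs : seq R[i], forall z, root P z -> z \in rs.
  apply: contrapT => /forallNP nrs.
  have : exists s : seq R[i], [/\ uniq s, all (root P) s & size s = size P].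
    elim: (size P) => [|n [s [us rs ss]]]; first by exists [::].
    have /existsNP[z /not_implyP[rz /negP zs]] := nrs s.
    by exists (z :: s); rewrite /= us rz rs zs ss.
  by move=> [s [us rs ss]]; have := max_poly_roots P0 rs us; rewrite ss ltnn.
pose A := [set z : R[i] | z \in rs].
pose g (z : R[i]) := Num.sqrt ((complex.Re z + 1) / 2).
apply: (@sub_finite_set _ _ (g @` A)); last exact/finite_image/finite_seq.
move=> x [/andP[x0 x1] z0]; exists (circle_map x : R[i]).
  apply: rsP; apply/rootP; rewrite horner_cpoly_circle.
  move/eqP: z0; rewrite paddr_eq0 ?sqr_ge0// !sqrf_eq0.
  by move=> /andP[/eqP-> /eqP->].
rewrite /g Re_circle_map ?x1 ?andbT; last lra.
have -> : (2 * x ^+ 2 - 1 + 1) / 2 = x ^+ 2 by field.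
by rewrite sqrtr_sqr ger0_norm.
Qed.

(* The quadratic form is the integral of [|Phi|^2] against a positive weight, and
   [Phi] has finitely many zeros. *)
Lemma moment_nondegenerate t j p : p j = 1 ->
  \sum_(l < j.+1) p l * pairing (moment t) p j l != 0.
Proof.
move=> pj; rewrite pairing_moment.
set f := fun x => (cos_sum p j x * cos_sum p j x + sin_sum p j x * sin_sum p j x) *
  expR (t * Bstar x).
have bf : bm f.
  apply: bmM; last exact: bm_weight.
  by apply: bmD; apply: bmM; (exact: bm_cos_sum || exact: bm_sin_sum).
have f0 x : 0 <= f x by rewrite mulr_ge0 ?expR_ge0// -!expr2 addr_ge0 ?sqr_ge0.
apply/eqP => If0.
have ae0 : ae_eq mu (`[-1, 1]%classic : set R) (EFin \o f) (cst 0%E).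
  apply/ae_eq_integral_abs => //; first by apply/measurable_EFinP; case: bf.
  under eq_integral do rewrite /= ger0_norm//.
  rewrite -(fineK (integrable_fin_num _ (bm_integrable bf)))//.
  by rewrite -/(Rintegral _ _ _) If0.
have [N [mN N0 fN]] := ae0.
pose D : set (measurableTypeR R) := `[0, 1]%classic.
have : (mu D <= 0)%E.
  have sub : D `<=` N `|` [set x : R | 0 <= x <= 1 /\
      cos_sum p j x ^+ 2 + sin_sum p j x ^+ 2 = 0].
    move=> x; rewrite /D /= in_itv /= => x1; have [fx|fx] := pselect (f x = 0).
      right; split => //; move/eqP: fx; rewrite /f mulf_eq0 (gt_eqF (expR_gt0 _)) orbF.
      by rewrite -!expr2 => /eqP.
    left; apply: fN => /= h; apply: fx; have := h _.
    rewrite in_itv /=; case/andP: x1 => x0 x1.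
    have -> : -1 <= x <= 1 by rewrite x1 andbT; lra.
    by move=> /(_ erefl)[].
  have Z := finite_set_countable (finite_zeros pj).
  have mD : measurable D by exact: measurable_itv.
  suff nD : mu.-negligible D by have /= -> := measure_negligible mD nD.
  apply: negligibleS sub _; apply: negligibleU.
    by apply/negligibleP.
  apply/negligibleP; last exact: countable_lebesgue_measure0.
  exact: countable_measurable.
by rewrite /D lebesgue_measure_itv /= lte_fin ltr01 -EFinB subr0 lee_fin ler10.
Qed.

End circle_polynomials.

(** * Verblunsky coefficients of the circle lifts *)

Section bstar_continuity.
Variable R : realType.
Implicit Types (f g : R -> R) (x y a : R).

Lemma hasder_cvg f x a : hasder f x a ->
  h^-1 * (f (h + x) - f x) @[h --> 0^'] --> a.
Proof.
move=> [d <-]; rewrite /derive; move: d; rewrite /derivable /=.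
by under eq_fun do rewrite [_ *: 1]mulr1.
Qed.

Lemma near_hasder f g x a : (\forall y \near x, g y = f y) -> hasder f x a ->
  hasder g x a.
Proof. by move=> fg; apply: near_eq_is_derive; near do apply/esym.
Unshelve. all: by end_near. Qed.

Lemma near_neq0 x : x != 0 -> \forall y \near x, y != 0.
Proof.
move=> x0; have [xn|xp|x0'] := ltgtP x 0; last by rewrite x0' eqxx in x0.
  by near do rewrite lt_eqF//; exact: lt_nbhsl.
by near do rewrite gt_eqF//; exact: lt_nbhsr.
Unshelve. all: by end_near. Qed.

Lemma asin_gt0 x : 0 < x <= 1 -> 0 < asin x.
Proof.
move=> /andP[x0 x1]; have p0 := @pi_gt0 R.
have x1' : -1 <= x <= 1 by rewrite x1 andbT; lra.
rewrite -ltr_sin ?asinK ?in_itv ?sin0//=; first by apply/andP; split; lra.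
by rewrite asin_geNpi2 ?asin_lepi2.
Qed.

Lemma asin_neq0 x : -1 <= x <= 1 -> x != 0 -> asin x != 0.
Proof.
move=> /andP[xN1 x1] x0; have [xn|xp] := ltP x 0.
  rewrite -oppr_eq0 -asinN; last by rewrite xN1.
  by rewrite gt_eqF// asin_gt0// oppr_gt0 xn; lra.
by rewrite gt_eqF// asin_gt0// x1 lt_neqAle eq_sym x0 xp.
Qed.

Lemma asin_div_gt0 x : -1 <= x <= 1 -> x != 0 -> 0 < asin x / x.
Proof.
move=> /andP[xN1 x1] x0; have [xn|xp] := ltP x 0.
  rewrite -mulrNN -invrN -asinN; last by rewrite xN1.
  by rewrite divr_gt0 ?oppr_gt0// asin_gt0// oppr_gt0 xn; lra.
have {}xp : 0 < x by rewrite lt_neqAle eq_sym x0.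
by rewrite divr_gt0// asin_gt0// x1 xp.
Qed.

Lemma der_Bstar x : -1 < x < 1 -> x != 0 ->
  hasder Bstar x ((sx x * asin x)^-1 - x^-1).
Proof.
move=> x1 x0; have x1' : -1 <= x <= 1 by case/andP: x1 => *; rewrite !ltW.
apply: (@near_hasder (fun y => ln (asin y / y))).
  by near=> y; rewrite /Bstar ifF//; apply/negbTE; near: y; exact: near_neq0.
apply: der_eq.
  apply: der_ln; first exact: asin_div_gt0.
  by apply: derM; [apply: (der_asin x1); exact: derI|apply: (derV x0); exact: derI].
have a0 := asin_neq0 x1' x0; have s0 : sx x != 0 by rewrite gt_eqF ?sx_gt0.
rewrite /= -/(sx x).
by field; rewrite a0 x0 s0.
Unshelve. all: by end_near. Qed.

Lemma cvg_asin_div0 : asin x / x @[x --> 0^'] --> (1 : R).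
Proof.
have d0 : hasder asin (0 : R) 1.
  apply: der_eq; first by apply: is_derive1_asin; rewrite ltrN10 ltr01.
  by rewrite expr0n subr0 sqrtr1 invr1.
have a0 : asin 0 = 0 :> R.
  have := @sinK R 0; rewrite sin0; apply; rewrite in_itv /=.
  by have := @pi_gt0 R; move=> ?; apply/andP; split; lra.
have := hasder_cvg d0; rewrite a0.
by under eq_fun do rewrite addr0 subr0 mulrC.
Qed.

Lemma Bstar0 : Bstar 0 = 0 :> R. Proof. by rewrite /Bstar eqxx. Qed.

Lemma continuous_Bstar0 : {for (0 : R), continuous Bstar}.
Proof.
apply/continuous_withinNx; rewrite Bstar0.
have := cvg_comp _ _ cvg_asin_div0 (@continuous_ln R 1 ltr01).
rewrite ln1; apply: cvg_trans; apply: near_eq_cvg; near=> y.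
by rewrite /Bstar /= ifF//; apply/negbTE; near: y; exact: nbhs_dnbhs_neq.
Unshelve. all: by end_near. Qed.

Lemma within_itvN11 f : (forall x, -1 < x < 1 -> {for x, continuous f}) ->
  f x @[x --> (-1)^'+] --> f (-1) -> f x @[x --> 1^'-] --> f 1 ->
  {within `[-1, 1], continuous f}.
Proof.
move=> cf c0 c1; apply/continuous_within_itvP; first by lra.
by split => // x; rewrite in_itv; exact: cf.
Qed.

Lemma within_continuous_Bstar : {within `[-1, 1], continuous (@Bstar R)}.
Proof.
have N11 : (-1 : R) < 1 by lra.
have [_ aN1 a1] := (continuous_within_itvP _ N11).1 (@within_continuous_asin R).
apply: within_itvN11.
- move=> x x1; have [->|x0] := eqVneq x 0; first exact: continuous_Bstar0.
  exact: der_continuous (der_Bstar x1 x0).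
- have BN1 : Bstar (-1) = ln (asin (-1) / -1) :> R by rewrite /Bstar ifF//; lra.
  have h : asin y / y @[y --> (-1)^'+] --> (asin (-1) / -1 : R).
    apply: cvgM => //; apply: cvgV; first by lra.
    exact: cvg_at_right_filter cvg_id.
  have p1 : 0 < asin (-1) / -1 :> R by apply: asin_div_gt0; lra.
  have := cvg_comp _ _ h (continuous_ln p1).
  rewrite -BN1; apply: cvg_trans; apply: near_eq_cvg; near=> y.
  rewrite /Bstar /= ifF// lt_eqF//; near: y; apply: nbhs_right_lt; lra.
- have B1 : Bstar 1 = ln (asin 1 / 1) :> R by rewrite /Bstar ifF//; lra.
  have h : asin y / y @[y --> 1^'-] --> (asin 1 / 1 : R).
    apply: cvgM => //; apply: cvgV; first by lra.
    exact: cvg_at_left_filter cvg_id.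
  have p1 : 0 < asin 1 / 1 :> R by apply: asin_div_gt0; lra.
  have := cvg_comp _ _ h (continuous_ln p1).
  rewrite -B1; apply: cvg_trans; apply: near_eq_cvg; near=> y.
  rewrite /Bstar /= ifF// gt_eqF//; near: y; apply: nbhs_left_gt; lra.
Unshelve. all: by end_near. Qed.

Lemma BstarN x : -1 <= x <= 1 -> Bstar (- x) = Bstar x.
Proof. by move=> x1; rewrite /Bstar oppr_eq0 asinN// invrN mulrNN. Qed.

Lemma II_odd f : {within `[-1, 1], continuous f} ->
  (forall x, -1 <= x <= 1 -> f (- x) = - f x) -> II f = 0.
Proof.
move=> cf fN; have bf := bm_continuous cf.
have cf' : {within `[- 1, - (-1)], continuous f} by rewrite opprK.
have N11 : (-1 : R) <= 1 by lra.
have := @integration_by_substitution_oppr R f (-1) 1 N11 cf'.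
rewrite opprK => /(congr1 fine); rewrite -![fine _]/(Rintegral _ _ _) => E.
have : II f = - II f.
  transitivity (II (fun x => -1 * f x)); last by rewrite bm_intZ// mulN1r.
  rewrite E; apply: eq_Rintegral => x.
  by rewrite inE /= in_itv /= mulN1r => /fN.
by lra.
Qed.

Lemma within_continuous_weight t :
  {within `[-1, 1], continuous (fun x : R => expR (t * Bstar x))}.
Proof.
move=> x; apply: continuous_comp; last exact: continuous_expR.
by apply: cvgM; [exact: cvg_cst|exact: within_continuous_Bstar].
Qed.

Lemma within_continuous_sin_angle l :
  {within `[-1, 1], continuous (fun x : R => sin (angle l x))}.
Proof.
move=> x; apply: continuous_comp; last exact: continuous_sin.
by apply: cvgM; [exact: cvg_cst|exact: within_continuous_acos].
Qed.

Lemma sin_angleN l x : -1 <= x <= 1 -> sin (angle l (- x)) = - sin (angle l x).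
Proof.
move=> x1; rewrite /angle acosN// mulrBr sinB.
have sc (n : nat) (a : R) : a = 2 * n%:R * pi -> sin a = 0 /\ cos a = 1.
  elim: n a => [|n IH] a ->; first by rewrite mulr0 mul0r sin0 cos0.
  have -> : 2 * n.+1%:R * pi = 2 * n%:R * pi + pi *+ 2 :> R.
    by rewrite -addn1 natrD mulr2n; ring.
  by rewrite sinD2pi cosD2pi; exact: IH.
have [-> ->] : sin (2 * l%:~R * pi : R) = 0 /\ cos (2 * l%:~R * pi : R) = 1.
  case: l => n; first exact: sc.
  rewrite NegzE mulrNz mulrN mulNr sinN cosN.
  by have [-> ->] := @sc n.+1 _ erefl; rewrite oppr0.
by rewrite mul0r mul1r sub0r.
Qed.

(** The reflection of [x] acts on the circle as complex conjugation and preserves the weight, so all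
    moments are real. *)
Lemma II_sin_angle t l : II (fun x : R => sin (angle l x) * expR (t * Bstar x)) = 0.
Proof.
apply: II_odd => [x|x x1]; last by rewrite sin_angleN// BstarN// mulNr.
by apply: cvgM; [exact: within_continuous_sin_angle|exact: within_continuous_weight].
Qed.

End bstar_continuity.

(** * Integration against [eta t] *)

Section eta_integral.
Variable R : realType.
Local Notation mu := (@lebesgue_measure R).
Implicit Types (t x : R) (g : R -> R).

(* [lebesgue_measure] lives on [measurableTypeR R] and [eta t] on [R]; the two
   measurable structures agree but their displays differ. *)
Definition toR (x : R) : measurableTypeR R := x.

Lemma measurable_toR : measurable_fun setT toR.
Proof. by move=> _ A mA; rewrite setTI. Qed.

HB.instance Definition _ := isMeasurableFun.Build _ _ _ _ toR measurable_toR.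

Definition etaT t : probability (measurableTypeR R) R :=
  distribution (@Defs.eta R t : probability R R) toR.

Lemma etaT_dominated t : etaT t `<< mu.
Proof.
apply/null_content_dominatesP => A mA muA0.
apply: null_set_integral => //.
by apply/measurable_EFinP/measurable_funTS; exact: measurable_eta_pdf.
Qed.

(** The change of density goes through the Radon-Nikodym derivative, which agrees almost everywhere
    with [eta_pdf t] because both have the same integral over every measurable set. *)
Lemma integral_etaT t (f : R -> \bar R) : (etaT t).-integrable setT f ->
  (\int[etaT t]_x f x = \int[mu]_x (f x * (eta_pdf t x)%:E))%E.
Proof.
move=> intf; have /integrableP[mf _] := intf.
rewrite -(Radon_Nikodym_change_of_variables (etaT_dominated t))//=.
apply: ae_eq_integral => //.
- apply: emeasurable_funM => //; apply: (measurable_int mu).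
  by apply: Radon_Nikodym_integrable; exact: etaT_dominated.
- apply: emeasurable_funM => //=; apply/measurableT_comp => //=.
  exact: measurable_eta_pdf.
- apply: ae_eqe_mul2l => /=.
  rewrite Radon_NikodymE//=; first exact: etaT_dominated.
  move=> etamu; case: cid => /= h [h1 h2 h3].
  apply: integral_ae_eq => //=.
  + by apply/measurableT_comp => //; exact: measurable_eta_pdf.
  + by move=> E _ mE; rewrite -h3.
Qed.

Definition weight_mass t : R := II (fun u => expR (t * Bstar u)).

Lemma weight_mass_gt0 t : 0 < weight_mass t.
Proof.
have bw := bm_weight t.
have Nt x : -1 <= x <= 1 -> expR (- `|t|) <= expR (t * Bstar x).
  move=> x1; rewrite ler_expR lerNl; apply: le_trans (ler_norm _) _.
  by rewrite normrN normrM ler_piMr// Bstar_norm_le.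
apply: (@lt_le_trans _ _ (II (fun=> expR (- `|t|)))).
  by rewrite II_cst mulr_gt0 ?expR_gt0.
apply: le_Rintegral => //; [exact: (bm_integrable (bm_cst _))|exact: bm_integrable].
Qed.

Lemma probability_bounded_integrable (d : measure_display) (T : measurableType d)
    (P : probability T R) (h : T -> R) (M : R) :
  measurable_fun setT h -> (forall y : T, `|h y| <= M) ->
  P.-integrable setT (EFin \o h).
Proof.
move=> mh hM; apply: measurable_bounded_integrable => //.
  by rewrite (le_lt_trans (probability_le1 _ _))// ltry.
exists M; split; first exact: num_real.
by move=> N MN y _ /=; exact: le_trans (hM y) (ltW MN).
Qed.

Lemma Rintegral_eta t g : measurable_fun setT g ->
  (exists M : R, forall x, `|g x| <= M) ->
  \int[@Defs.eta R t]_x g x =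
  (weight_mass t)^-1 * II (fun x => g x * expR (t * Bstar x)).
Proof.
move=> mg [M gM].
have ig := probability_bounded_integrable (@Defs.eta R t : probability R R) mg gM.
have mg' : measurable_fun setT (g : measurableTypeR R -> R) by exact: mg.
have ig' := probability_bounded_integrable (etaT t) mg' gM.
have bg : bm g.
  by split; [exact: measurable_funTS|exists M => x _].
have -> : \int[@Defs.eta R t]_x g x = \int[etaT t]_x g x.
  congr fine; rewrite (@integral_distribution _ _ _ _ _ _ toR (EFin \o g))//.
  exact/measurable_EFinP.
rewrite /Rintegral integral_etaT// -bm_intZ; last first.
  by apply: bmM => //; exact: bm_weight.
rewrite /Rintegral [in RHS]integral_mkcond; congr fine.
apply: eq_integral => x _; rewrite patchE /eta_pdf mem_setE in_itv /=.
case: ifP => _; last by rewrite mule0.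
by rewrite -EFinM /weight_mass; congr EFin; ring.
Qed.

End eta_integral.

(** * Borel functions of a complex variable and integration against the circle lift *)

Section circle_lift_integral.
Variable R : realType.
Implicit Types (t x : R).

Lemma complex_dist_lt (z y : R[i]) (e : R) : `|z - y| < e%:C%C ->
  `|complex.Re z - complex.Re y| < e /\ `|complex.Im z - complex.Im y| < e.
Proof.
case: z y => [a b] [c d]; rewrite normc_def ltcR /= => h.
have e0 : 0 < e by apply: le_lt_trans h; exact: sqrtr_ge0.
rewrite -[X in _ < X]ger0_norm ?(ltW e0)// -sqrtr_sqr ltr_sqrt ?exprn_gt0// in h.
have sq (u : R) : u ^+ 2 < e ^+ 2 -> `|u| < e.
  move=> ue; rewrite -(ltr_pXn2r (ltn0Sn 1)) ?nnegrE ?(ltW e0)//.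
  by rewrite real_normK ?num_real.
split; apply: sq; apply: le_lt_trans h.
  by rewrite lerDl sqr_ge0.
by rewrite lerDr sqr_ge0.
Qed.

(** The hypothesis is a Lipschitz condition of constant 1, so preimages of open intervals are open;
    it fits the real and imaginary parts. *)
Lemma measurable_Cborel (f : R[i] -> R) :
  (forall z y (e : R), `|z - y| < e%:C%C -> `|f z - f y| < e) ->
  measurable_fun setT (f : Cborel R -> R).
Proof.
move=> lf; apply: (measurability (@RGenOpens.G R)) => [|_ [_ [a [b ->]] <-]].
  exact: RGenOpens.measurableE.
rewrite setTI; apply: sub_sigma_algebra; rewrite openE => z /=.
rewrite in_itv /= => /andP[az zb]; pose e := Num.min (f z - a) (b - f z).
have e0 : 0 < e by rewrite lt_min !subr_gt0 az.
apply/nbhs_ballP; exists e%:C%C; first by rewrite /= ltcR.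
move=> y; rewrite -ball_normE /= => /lf; rewrite lt_min => /andP[].
rewrite !ltr_norml in_itv /= => /andP[h1 h2] /andP[h3 h4].
by apply/andP; split; lra.
Qed.

(** Componentwise, as in [Cintegral], which integrates the two real components separately. *)
Definition cmeas (f : R[i] -> R[i]) :=
  measurable_fun setT (fun z : Cborel R => complex.Re (f z)) /\
  measurable_fun setT (fun z : Cborel R => complex.Im (f z)).

Lemma cmeas_cst c : cmeas (fun=> c).
Proof. by split; exact: measurable_cst. Qed.

Lemma cmeas_id : cmeas id.
Proof.
by split; apply: measurable_Cborel => z y e /complex_dist_lt[].
Qed.

Lemma cmeasD f g : cmeas f -> cmeas g -> cmeas (fun z => f z + g z).
Proof.
move=> [f1 f2] [g1 g2]; split.
  have := measurable_funD f1 g1; congr (measurable_fun _ _).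
  by apply/funext => z /=; case: (f z) => a b; case: (g z).
have := measurable_funD f2 g2; congr (measurable_fun _ _).
by apply/funext => z /=; case: (f z) => a b; case: (g z).
Qed.

Lemma cmeasM f g : cmeas f -> cmeas g -> cmeas (fun z => f z * g z).
Proof.
move=> [f1 f2] [g1 g2]; split.
  have := measurable_funB (measurable_funM f1 g1) (measurable_funM f2 g2).
  congr (measurable_fun _ _).
  by apply/funext => z /=; case: (f z) => a b; case: (g z).
have := measurable_funD (measurable_funM f1 g2) (measurable_funM f2 g1).
congr (measurable_fun _ _).
by apply/funext => z /=; case: (f z) => a b; case: (g z).
Qed.

Lemma cmeas_conj f : cmeas f -> cmeas (fun z => (f z)^* )%C.
Proof.
move=> [f1 f2]; split.
  by move: f1; congr (measurable_fun _ _); apply/funext => z /=; case: (f z).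
have : measurable_fun setT (fun z : Cborel R => - complex.Im (f z)).
  exact: measurableT_comp.
by congr (measurable_fun _ _); apply/funext => z /=; case: (f z).
Qed.

Lemma cmeas_horner (P : {poly R[i]}) : cmeas (fun z => P.[z]).
Proof.
elim/poly_ind: P => [|P c IH].
  by under eq_fun do rewrite horner0; exact: cmeas_cst.
under eq_fun do rewrite hornerMXaddC.
apply: cmeasD; last exact: cmeas_cst.
by apply: cmeasM => //; exact: cmeas_id.
Qed.

Lemma Rintegral_circle_lift t (h : Cborel R -> R) (g : R -> R) :
  measurable_fun setT h -> (exists M : R, forall x, `|g x| <= M) ->
  (forall x, h (circle_map x) = g x) ->
  \int[circle_lift (@Defs.eta R t)]_z h z =
  (weight_mass t)^-1 * II (fun x => g x * expR (t * Bstar x)).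
Proof.
move=> mh [M gM] hg.
have hgE : h \o (@circle_map R) = g by apply/funext => x /=; rewrite hg.
have mg : measurable_fun setT g.
  by rewrite -hgE; apply: measurableT_comp => //; exact: measurable_circle_map.
rewrite -Rintegral_eta//; last by exists M.
congr fine; rewrite /circle_lift integral_distribution//.
- by apply: eq_integral => x _ /=; rewrite hg.
- exact/measurable_EFinP.
have -> : (fun z => (h z)%:E) \o (@circle_map R) = EFin \o g.
  by apply/funext => x /=; rewrite hg.
exact: (probability_bounded_integrable _ mg gM).
Qed.

End circle_lift_integral.

(** * Verblunsky coefficients of the circle lift in terms of moments *)

Section verblunsky.
Variable R : realType.
Variable t : R.
Notation mut := (circle_lift (@Defs.eta R t)).
Notation d := (@moment R t).
Implicit Types (x : R) (p q : nat -> R) (P Q : {poly R[i]}) (z : R[i]).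

Lemma cos_sum_bound p j x : `|cos_sum p j x| <= \sum_(k < j.+1) `|p k|.
Proof.
apply: le_trans (ler_norm_sum _ _ _) _; apply: ler_sum => k _.
by rewrite normrM ler_piMr// cos_max.
Qed.

Lemma sin_sum_bound p j x : `|sin_sum p j x| <= \sum_(k < j.+1) `|p k|.
Proof.
apply: le_trans (ler_norm_sum _ _ _) _; apply: ler_sum => k _.
by rewrite normrM ler_piMr// sin_max.
Qed.

Lemma II_sin_sum p j q m :
  II (fun x => (sin_sum p j x * cos_sum q m x - cos_sum p j x * sin_sum q m x) *
               expR (t * Bstar x)) = 0.
Proof.
have bws l : bm (fun x => sin (angle l x) * expR (t * Bstar x)).
  by apply: bmM; [exact: bm_sin_angle|exact: bm_weight].
under eq_Rintegral do rewrite sin_sum_cos_sum mulr_suml.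
rewrite bm_int_sum; last first.
  move=> l; apply: bmM; last exact: bm_weight.
  apply: bmM; first exact: bm_cst.
  by apply: bm_sum => k; apply: bmM; [exact: bm_cst|exact: bm_sin_angle].
apply: big1 => l _; under eq_Rintegral do rewrite -mulrA mulr_suml.
rewrite bm_intZ; last first.
  apply: bm_sum => k; apply: bmM; last exact: bm_weight.
  by apply: bmM; [exact: bm_cst|exact: bm_sin_angle].
rewrite bm_int_sum; last first.
  move=> k; apply: bmM; last exact: bm_weight.
  by apply: bmM; [exact: bm_cst|exact: bm_sin_angle].
rewrite big1 ?mulr0// => k _; under eq_Rintegral do rewrite -mulrA.
by rewrite bm_intZ// II_sin_angle mulr0.
Qed.

(** [P] and [Q] are asked to agree with real-coefficient polynomials on the circle only, since the
    recurrence in [is_verblunsky] excludes [z = 0]. The imaginary part vanishes by conjugation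
    symmetry, and [weight_mass] restores the normalisation left out of [moment]. *)
Lemma Cintegral_cpoly P Q p j q m :
  (forall x, P.[circle_map x] = (cpoly p j).[circle_map x]) ->
  (forall x, Q.[circle_map x] = (cpoly q m).[circle_map x]) ->
  Cintegral mut (fun z => P.[z] * (Q.[z])^*) =
  ((weight_mass t)^-1 * \sum_(l < m.+1) q l * pairing d p j l)%:C%C.
Proof.
move=> Pp Qq.
pose f x := cos_sum p j x * cos_sum q m x + sin_sum p j x * sin_sum q m x.
pose g x := sin_sum p j x * cos_sum q m x - cos_sum p j x * sin_sum q m x.
have fg x : P.[circle_map x] * (Q.[circle_map x])^* = (f x +i* g x)%C.
  rewrite Pp Qq !horner_cpoly_circle; apply/eqP; rewrite eq_complex /=.
  by apply/andP; split; apply/eqP; rewrite /f /g; ring.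
have [mR mI] : cmeas (fun z => P.[z] * (Q.[z])^*).
  by apply: cmeasM; [|apply: cmeas_conj]; exact: cmeas_horner.
pose M := \sum_(k < j.+1) `|p k|; pose N := \sum_(k < m.+1) `|q k|.
have MN a b : `|a| <= M -> `|b| <= N -> `|a * b| <= M * N.
  by move=> aM bN; rewrite normrM ler_pM.
have fM : exists M : R, forall x, `|f x| <= M.
  exists (M * N + M * N) => x; apply: le_trans (ler_normD _ _) _.
  by apply: lerD; apply: MN; (exact: cos_sum_bound || exact: sin_sum_bound).
have gM : exists M : R, forall x, `|g x| <= M.
  exists (M * N + M * N) => x; apply: le_trans (ler_normB _ _) _.
  by apply: lerD; apply: MN; (exact: cos_sum_bound || exact: sin_sum_bound).
rewrite /Cintegral (Rintegral_circle_lift t mR fM); last by move=> x; rewrite fg.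
rewrite (Rintegral_circle_lift t mI gM); last by move=> x; rewrite fg.
by rewrite II_sin_sum mulr0 pairing_moment.
Qed.

Notation a := (schur d).
Let dE := @momentN R t.
Let nd := @moment_nondegenerate R t.

Lemma pairing_sym p j q m :
  \sum_(l < m.+1) q l * pairing d p j l = \sum_(k < j.+1) p k * pairing d q m k.
Proof.
rewrite /pairing; under eq_bigr do rewrite mulr_sumr.
rewrite exchange_big /=; apply: eq_bigr => k _; rewrite mulr_sumr.
by apply: eq_bigr => l _; rewrite mulrCA -dE opprB.
Qed.

Lemma reversed_cpoly p j z : z != 0 ->
  reversed j (cpoly p j) z = \sum_(k < j.+1) (p (j - k)%N)%:C%C * z ^+ k.
Proof.
move=> z0; rewrite /reversed horner_cpoly rmorph_sum /= mulr_sumr.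
rewrite (reindex_inj rev_ord_inj) /=; apply: eq_bigr => k _.
rewrite subSS rmorphM rmorphXn fmorphV /=.
have zK : ((z^*)^* : R[i]) = z by exact: conjcK.
rewrite zK.
have -> : ((p (j - k)%N)%:C%C : R[i])^* = (p (j - k)%N)%:C%C by exact: conjc_real.
have kj : (k <= j)%N by rewrite -ltnS.
rewrite mulrCA; congr (_ * _); rewrite -{1}(subnK kj) exprD exprVn mulrAC.
by rewrite mulfV ?expf_neq0// mul1r.
Qed.

Lemma horner_cpoly_step b j z : z != 0 ->
  (cpoly (phi b j.+1) j.+1).[z] = z * (cpoly (phi b j) j).[z] -
    (b j)%:C%C * reversed j (cpoly (phi b j) j) z.
Proof.
move=> z0; rewrite reversed_cpoly// !horner_cpoly /= /szego_step.
have -> : \sum_(k < j.+2) (((if nat_of_ord k is k'.+1 then phi b j k' else 0) -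
      (if (k <= j)%N then b j * phi b j (j - k)%N else 0))%:C)%C * z ^+ k =
    \sum_(k < j.+2) ((if nat_of_ord k is k'.+1 then phi b j k' else 0)%:C)%C * z ^+ k -
    \sum_(k < j.+2) ((if (k <= j)%N then b j * phi b j (j - k)%N else 0)%:C)%C * z ^+ k.
  by rewrite -sumrB; apply: eq_bigr => k _; rewrite rmorphB /= mulrBl.
congr (_ - _).
  rewrite big_ord_recl mul0r add0r mulr_sumr; apply: eq_bigr => k _.
  by rewrite /= exprS mulrCA.
rewrite big_ord_recr /= ltnn mul0r addr0 mulr_sumr; apply: eq_bigr => k _.
by rewrite -ltnS ltn_ord rmorphM /= mulrA.
Qed.

Lemma circle_map_neq0 x : (circle_map x : R[i]) != 0.
Proof.
apply/eqP => /(congr1 (fun z : R[i] => complex.Re z ^+ 2 + complex.Im z ^+ 2)).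
rewrite /circle_map /= cos2Dsin2 expr0n /= addr0 => /eqP.
by rewrite oner_eq0.
Qed.

(* Only the orthogonality of [Phi (j+1)] to the constant [Phi 0] is used. *)
Lemma verblunsky_unique b : is_verblunsky mut b -> forall j, b j = a j.
Proof.
move=> [Phi [Psize Pmonic Porth] Prec].
suff main j : (forall i, (i < j)%N -> b i = a i) /\
    (forall z, z != 0 -> (Phi j).[z] = (cpoly (phi b j) j).[z]).
  by move=> j; have [+ _] := main j.+1; apply.
elim: j => [|j [IHb IHP]].
  split => // z _; have := Psize 0%N => /eqP/size_poly1P[c c0 Pc].
  have := Pmonic 0%N; rewrite Pc monicE lead_coefC => /eqP ->.
  by rewrite hornerC horner_cpoly big_ord_recl big_ord0 /= expr0 mulr1 addr0.
have step z : z != 0 -> (Phi j.+1).[z] = (cpoly (phi b j.+1) j.+1).[z].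
  move=> z0; rewrite Prec// IHP// horner_cpoly_step// /reversed IHP//.
  by rewrite invr_eq0 conjC_eq0.
split => // i; rewrite ltnS leq_eqVlt => /predU1P[->|]; last exact: IHb.
have Q0 x : (Phi 0%N).[circle_map x] = (cpoly (phi b 0) 0).[circle_map x].
  have := Psize 0%N => /eqP/size_poly1P[c c0 Pc].
  have := Pmonic 0%N; rewrite Pc monicE lead_coefC => /eqP ->.
  by rewrite hornerC horner_cpoly big_ord_recl big_ord0 /= expr0 mulr1 addr0.
have := Porth j.+1 0%N erefl.
rewrite (@Cintegral_cpoly _ _ (phi b j.+1) j.+1 (phi b 0) 0)//; last first.
  by move=> x; rewrite step// circle_map_neq0.
move=> /eqP; rewrite eq_complex /= eqxx andbT mulf_eq0 invr_eq0.
rewrite (gt_eqF (weight_mass_gt0 t)) /= big_ord_recl big_ord0 addr0 /= mul1r.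
rewrite pairing_step// (eq_phi IHb) sub0r subr0 schur_pairing; last first.
  exact: (pairing_lead_neq0 dE nd).
rewrite -mulrBl mulf_eq0 (negbTE (pairing_lead_neq0 dE nd j)) orbF subr_eq0.
by move=> /eqP.
Qed.

Lemma verblunsky_exists : is_verblunsky mut a.
Proof.
exists (fun j => cpoly (phi a j) j); last by move=> j z; exact: horner_cpoly_step.
have lead j : ((cpoly (phi a j) j))`_j = 1 by rewrite coef_poly ltnSn phi_lead.
have sz j : size (cpoly (phi a j) j) = j.+1.
  by apply: size_poly_eq; rewrite /= phi_lead oner_neq0.
split => //.
- by move=> j; rewrite monicE lead_coefE sz lead.
- move=> j k jk; rewrite (@Cintegral_cpoly _ _ (phi a j) j (phi a k) k)//.
  suff -> : \sum_(l < k.+1) phi a k l * pairing d (phi a j) j l = 0 by rewrite mulr0.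
  have [kj|jk'|/eqP] := ltngtP k j; last by rewrite eq_sym (negbTE jk).
    apply: big1 => l _; rewrite (szego_orthogonal dE nd) ?mulr0//.
    exact: leq_trans (ltn_ord l) kj.
  rewrite pairing_sym; apply: big1 => l _.
  rewrite (szego_orthogonal dE nd) ?mulr0//.
  exact: leq_trans (ltn_ord l) jk'.
Qed.

(** [get] returns an unspecified witness: [verblunsky_exists] guarantees that it satisfies the
    recurrence, and uniqueness then identifies it. *)
Lemma alphaE j : Defs.alpha j t = a j.
Proof.
rewrite /Defs.alpha /verblunsky; apply: verblunsky_unique.
apply: (@getPex _ [set b | is_verblunsky mut b]).
by exists a; exact: verblunsky_exists.
Qed.

End verblunsky.

(** * Legendre polynomials and the derivative at t = 0 *)

Section legendre.
Variable R : realType.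
Implicit Types (x y th : R) (n : nat).

Let hornE := (hornerM, hornerD, hornerN, hornerC, hornerX).

Let derE := (derivM, derivB, derivC, derivX).

(** Two consecutive polynomials are carried so that the three-term recurrence becomes structural. *)
Fixpoint legendre_pair n : {poly R} * {poly R} :=
  if n is n'.+1 then
    let: (p, q) := legendre_pair n' in
    (q, (n'.+2%:R^-1)%:P * ((2 * n'%:R + 3)%:P * 'X * q - (n'.+1%:R)%:P * p))
  else (1, 'X).

Definition legendre n : {poly R} := (legendre_pair n).1.
Notation P n x := (legendre n).[x].
Notation dP n x := (deriv (legendre n)).[x].

Lemma legendreS n : legendre n.+1 = (legendre_pair n).2.
Proof. by rewrite /legendre /=; case: (legendre_pair n). Qed.

Lemma legendreSS n : legendre n.+2 =
  (n.+2%:R^-1)%:P * ((2 * n%:R + 3)%:P * 'X * legendre n.+1 - (n.+1%:R)%:P * legendre n).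
Proof. by rewrite legendreS /= legendreS /legendre; case: (legendre_pair n). Qed.

Lemma legendre0 : legendre 0 = 1. Proof. by []. Qed.
Lemma legendre1 : legendre 1 = 'X. Proof. by []. Qed.

Lemma legendre_rec n x :
  (n%:R + 2) * P n.+2 x = (2 * n%:R + 3) * x * P n.+1 x - (n%:R + 1) * P n x.
Proof.
rewrite legendreSS !hornE -[n.+2%:R]natr1 -[n.+1%:R]natr1; field.
by have := ler0n R n; lra.
Qed.

Lemma dlegendre_rec n x : (n%:R + 2) * dP n.+2 x =
  (2 * n%:R + 3) * (P n.+1 x + x * dP n.+1 x) - (n%:R + 1) * dP n x.
Proof.
rewrite legendreSS !derE !hornE -[n.+2%:R]natr1 -[n.+1%:R]natr1; field.
by have := ler0n R n; lra.
Qed.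

(** The two classical derivative relations support each other in the induction, together with the
    recurrence and its derivative. The differential equation and the recursion on the circle both
    follow from them. *)
Lemma dlegendreS n x : dP n.+1 x = x * dP n x + (n%:R + 1) * P n x /\
  x * dP n.+1 x - dP n x = (n%:R + 1) * P n.+1 x.
Proof.
elim: n => [|n [IH1 IH2]].
  by rewrite legendre0 legendre1 derivC derivX !hornE; split; ring.
have n2 : n%:R + 2 != 0 :> R by rewrite -natrD pnatr_eq0 addn2.
have E1 : (n%:R + 2) * dP n.+2 x = (n%:R + 2) * (x * dP n.+1 x + (n%:R + 2) * P n.+1 x).
  by rewrite dlegendre_rec; move: IH1 IH2; nra.
have {}E1 := mulfI n2 E1.
rewrite -[n.+1%:R]natr1; split; first by rewrite E1; ring.
have := legendre_rec n x; rewrite E1.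
have -> : dP n.+1 x = x * dP n x + (n%:R + 1) * P n x by [].
have -> : P n.+2 x = (n%:R + 2)^-1 * ((n%:R + 2) * P n.+2 x) by rewrite mulKf.
by rewrite legendre_rec; move: IH1 IH2; nra.
Qed.

Lemma legendre_der_l n x :
  (n%:R + 1) * P n.+1 x = (n%:R + 1) * x * P n x - (1 - x ^+ 2) * dP n x.
Proof. by have [h1 h2] := dlegendreS n x; rewrite -h2 h1; ring. Qed.

Lemma legendre_der_r n x :
  (1 - x ^+ 2) * dP n.+1 x = (n%:R + 1) * (P n x - x * P n.+1 x).
Proof. by have [h1 h2] := dlegendreS n x; rewrite mulrBr (mulrCA _ x) -h2 h1; ring. Qed.

Lemma der_legendre n x : hasder (fun y => P n y) x (dP n x).
Proof. by apply: der_eq; [der|rewrite mulr1]. Qed.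

Lemma legendre_ode n x :
  hasder (fun y => (1 - y ^+ 2) * dP n y) x (- (n%:R * (n%:R + 1)) * P n x).
Proof.
case: n => [|n].
  have -> : (fun y : R => (1 - y ^+ 2) * dP 0 y) = fun=> 0.
    by apply/funext => y; rewrite legendre0 derivC horner0 mulr0.
  by apply: der_eq; [exact: derC|rewrite mul0r oppr0 mul0r].
have -> : (fun y : R => (1 - y ^+ 2) * dP n.+1 y) =
    fun y => (n%:R + 1) * (P n y - y * P n.+1 y).
  by apply/funext => y; rewrite legendre_der_r.
apply: der_eq.
  apply: derM; [exact: derC|apply: derD; [exact: (der_legendre n x)|]].
  by apply: derN; apply: derM; [exact: derI|exact: (der_legendre n.+1 x)].
have [h1 h2] := dlegendreS n x; rewrite -[n.+1%:R]natr1.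
have -> : dP n x = x * dP n.+1 x - (n%:R + 1) * P n.+1 x by rewrite -h2; ring.
by ring.
Qed.

Lemma der_legendre_flux n x :
  hasder (fun y => (1 - y ^+ 2) * P n y * dP n y) x
    ((1 - x ^+ 2) * dP n x ^+ 2 - n%:R * (n%:R + 1) * P n x ^+ 2).
Proof.
have -> : (fun y => (1 - y ^+ 2) * P n y * dP n y) =
    fun y => P n y * ((1 - y ^+ 2) * dP n y).
  by apply/funext => y; ring.
apply: der_eq; first by apply: derM; [exact: (der_legendre n x)|exact: (legendre_ode n x)].
cbv beta; ring.
Qed.

(* The Verblunsky coefficients at [t = 0]; see [schur_moment0]. *)
Definition bschur n : R := - (2 * n%:R + 3)^-1.

(** The product of the factors [1 + bschur k] for [k < n], which accumulate in [SsumS]. *)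
Fixpoint cnorm n : R :=
  if n is n'.+1 then cnorm n' * ((2 * n'%:R + 2) / (2 * n'%:R + 3)) else 1.

Lemma cnorm_gt0 n : 0 < cnorm n.
Proof.
elim: n => [|n IH] //=; rewrite mulr_gt0// divr_gt0//;
by have : 0 <= n%:R :> R by []; lra.
Qed.

(* Real and imaginary parts of [z^(-n/2) Phi_n(z)] at [z = e^(2 i th)]. *)
Definition Csum (a : nat -> R) n th := \sum_(k < n.+1) phi a n k * cos ((2 * k%:R - n%:R) * th).
Definition Ssum (a : nat -> R) n th := \sum_(k < n.+1) phi a n k * sin ((2 * k%:R - n%:R) * th).

(** After multiplication by [z^(-n/2)] the reversed polynomial is the complex conjugate of the
    polynomial. With [w] equal to [e^(i th)] times the old value, the new value is [w] minus [a n]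
    times its conjugate: the real part is scaled by [1 - a n], the imaginary part by [1 + a n]. *)
Lemma CsumS a n th :
  Csum a n.+1 th = (1 - a n) * (cos th * Csum a n th - sin th * Ssum a n th).
Proof.
have E : cos th * Csum a n th - sin th * Ssum a n th =
    \sum_(k < n.+1) phi a n k * cos ((2 * k%:R - n%:R) * th + th).
  rewrite /Csum /Ssum !mulr_sumr -sumrB; apply: eq_bigr => k _.
  by rewrite cosD; ring.
rewrite mulrBl mul1r {1 2}E {1}/Csum /= /szego_step.
under eq_bigr do rewrite mulrBl.
rewrite sumrB big_ord_recl mul0r add0r; congr (_ - _).
  apply: eq_bigr => k _; rewrite /= /bump /= add1n; congr (_ * cos _).
  by rewrite -[n.+1%:R]natr1 -[k.+1%:R]natr1; ring.
rewrite big_ord_recr /= ltnn mul0r addr0 mulr_sumr.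
rewrite (reindex_inj rev_ord_inj) /=; apply: eq_bigr => k _.
have kn : (k <= n)%N by rewrite -ltnS.
rewrite subSS leq_subr subKn// -mulrA; congr (_ * (_ * _)).
rewrite -cosN; congr cos; rewrite natrB// -[n.+1%:R]natr1; ring.
Qed.

Lemma SsumS a n th :
  Ssum a n.+1 th = (1 + a n) * (cos th * Ssum a n th + sin th * Csum a n th).
Proof.
have E : cos th * Ssum a n th + sin th * Csum a n th =
    \sum_(k < n.+1) phi a n k * sin ((2 * k%:R - n%:R) * th + th).
  rewrite /Csum /Ssum !mulr_sumr -big_split; apply: eq_bigr => k _ /=.
  by rewrite sinD; ring.
rewrite mulrDl mul1r {1 2}E {1}/Ssum /= /szego_step.
under eq_bigr do rewrite mulrBl.
rewrite sumrB big_ord_recl mul0r add0r; congr (_ + _).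
  apply: eq_bigr => k _; rewrite /= /bump /= add1n; congr (_ * sin _).
  by rewrite -[n.+1%:R]natr1 -[k.+1%:R]natr1; ring.
rewrite big_ord_recr /= ltnn mul0r addr0 mulr_sumr -sumrN.
rewrite (reindex_inj rev_ord_inj) /=; apply: eq_bigr => k _.
have kn : (k <= n)%N by rewrite -ltnS.
rewrite subSS leq_subr subKn// -mulrA -mulrN -mulrN; congr (_ * (_ * _)).
rewrite -sinN; congr sin; rewrite natrB// -[n.+1%:R]natr1; ring.
Qed.

(** At [x = cos th] the recursion for the real part becomes [legendre_der_l], and that for the
    imaginary part the first relation of [dlegendreS]. *)
Lemma Csum_Ssum_legendre n th :
  Csum bschur n th = cnorm n * ((n%:R + 1) * P n (cos th)) /\
  Ssum bschur n th = cnorm n * (sin th * dP n (cos th)).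
Proof.
elim: n => [|n [IH1 IH2]].
  rewrite /Csum /Ssum !big_ord_recl !big_ord0 /= mulr0 subr0 mul0r cos0 sin0.
  by rewrite legendre0 derivC hornerC horner0; split; ring.
have n3 : 2 * n%:R + 3 != 0 :> R by rewrite gt_eqF//; have : 0 <= n%:R :> R by []; lra.
rewrite CsumS SsumS IH1 IH2 /= /bschur -[n.+1%:R]natr1; split.
  have h := legendre_der_l n (cos th).
  transitivity (cnorm n * ((2 * n%:R + 4) / (2 * n%:R + 3)) *
      ((n%:R + 1) * P n.+1 (cos th))); last by field.
  by rewrite h -sin2cos2; field.
have [h1 h2] := dlegendreS n (cos th).
by rewrite h1; field.
Qed.

End legendre.

(** * The derivative at t = 0 as an integral of Legendre polynomials *)

Section at_zero.
Variable R : realType.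
Implicit Types (x y : R) (n m j k l : nat).
Notation d := (@moment R 0).
Notation b := (@bschur R).
Notation P n x := (legendre R n).[x].
Notation dP n x := (deriv (legendre R n)).[x].

Lemma moment0E (l : int) : d l = II (fun x => cos (angle l x)).
Proof. by apply: eq_Rintegral => x _; rewrite mul0r expR0 mulr1. Qed.

Lemma pairing_moment0 (p : nat -> R) j (l : int) :
  pairing d p j l = II (fun x => \sum_(k < j.+1) p k * cos (angle (k%:Z - l) x)).
Proof.
rewrite bm_int_sum; last first.
  by move=> k; apply: bmM; [exact: bm_cst|exact: bm_cos_angle].
by apply: eq_bigr => k _; rewrite moment0E bm_intZ//; exact: bm_cos_angle.
Qed.

Lemma cos_angle_Csum (a : nat -> R) n (c : R) x :
  \sum_(k < n.+1) phi a n k * cos ((2 * k%:R - n%:R) * acos x + c) =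
  cos c * Csum a n (acos x) - sin c * Ssum a n (acos x).
Proof.
rewrite /Csum /Ssum !mulr_sumr -sumrB; apply: eq_bigr => k _.
by rewrite cosD; ring.
Qed.

Lemma cos_acos x : -1 <= x <= 1 -> cos (acos x) = x.
Proof. by move=> x1; rewrite acosK// in_itv. Qed.

(** By the Legendre equation the integrand has the primitive [F], whose factor [1 - x^2] vanishes at
    both endpoints. *)
Lemma bschur_orthogonal n : pairing d (phi b n.+1) n.+1 0 = 0.
Proof.
pose N : R := n.+1%:R; have N0 : N != 0 by rewrite pnatr_eq0.
pose f x := cnorm R n.+1 * ((N + 1) * P n.+1 x * cos (N * acos x) -
  sin (N * acos x) * (sx x * dP n.+1 x)).
pose F x := (- cnorm R n.+1 / N) * (cos (N * acos x) * ((1 - x ^+ 2) * dP n.+1 x)).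
rewrite pairing_moment0.
transitivity (II f).
  apply: eq_Rintegral => x; rewrite inE /= in_itv /= => x1.
  have [h1 h2] := Csum_Ssum_legendre n.+1 (acos x).
  transitivity (cos (N * acos x) * Csum b n.+1 (acos x) -
      sin (N * acos x) * Ssum b n.+1 (acos x)); last first.
    by rewrite h1 h2 sin_acos// cos_acos// -/(sx x) /f /N; ring.
  rewrite -cos_angle_Csum; apply: eq_bigr => k _; congr (_ * cos _).
  by rewrite /angle subr0 /N; ring.
have cosA : {within `[-1, 1], continuous (fun x => cos (N * acos x))}.
  move=> x; apply: continuous_comp; last exact: continuous_cos.
  by apply: cvgM; [exact: cvg_cst|exact: within_continuous_acos].
have sinA : {within `[-1, 1], continuous (fun x => sin (N * acos x))}.
  move=> x; apply: continuous_comp; last exact: continuous_sin.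
  by apply: cvgM; [exact: cvg_cst|exact: within_continuous_acos].
have horA (p : {poly R}) : {within `[-1, 1], continuous (fun x => p.[x])}.
  by apply: continuous_subspaceT => x; exact: continuous_horner.
have sA : {within `[-1, 1], continuous (@sx R)}.
  by apply: continuous_subspaceT => x; exact: continuous_sx.
have cf : {within `[-1, 1], continuous f}.
  move=> x; apply: cvgM; first exact: cvg_cst.
  apply: cvgB; apply: cvgM; [|exact: cosA|exact: sinA|].
    by apply: cvgM; [exact: cvg_cst|exact: horA].
  by apply: cvgM; [exact: sA|exact: horA].
rewrite (@FTC2_integrable R f F).
- by rewrite /F sqrrN expr1n subrr !mul0r !mulr0 subrr.
- by lra.
- exact: bm_integrable (bm_continuous cf).
- move=> x; apply: cvgM; first exact: cvg_cst.
  apply: cvgM; first exact: cosA.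
  apply: cvgM; last exact: horA.
  have : {within `[-1, 1], continuous (fun x : R => 1 - x ^+ 2)}.
    by apply: continuous_subspaceT => y; apply: der_continuous; der.
  exact.
- move=> x; rewrite in_itv /= => x1.
  have := cf; rewrite continuous_within_itvP; last lra.
  by move=> [+ _ _]; apply; rewrite in_itv.
- move=> x; rewrite in_itv /= => x1; have s0 : sx x != 0 by rewrite gt_eqF ?sx_gt0.
  have dA : hasder (fun x => N * acos x) x (- N / sx x).
    apply: der_eq.
      by apply: derM; [exact: derC|apply: (der_acos x1); exact: derI].
    by rewrite -/(sx x); field.
  apply: der_eq.
    apply: derM; first exact: derC.
    by apply: derM; [exact: (der_cos dA)|exact: (legendre_ode n.+1 x)].
  have x1' : -1 <= x <= 1 by case/andP: x1 => *; rewrite !ltW.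
  rewrite /f -(sxE2 x1') -/N; field.
  by rewrite s0 /=; have := ler0n R n; lra.
Qed.

Lemma bschur_sq n : 1 - b n ^+ 2 = (2 * n%:R + 2) * (2 * n%:R + 4) / (2 * n%:R + 3) ^+ 2.
Proof.
have n0 := ler0n R n; rewrite /bschur; field.
by rewrite gt_eqF//; lra.
Qed.

(** Orthogonality of [Phi_(n+1)] to 1 determines the coefficient of index [n] once the earlier ones
    agree, and [bschur_orthogonal] provides it for [b]. *)
Lemma schur_moment0 n : schur d n = b n.
Proof.
elim/ltn_ind: n => n IH.
have := bschur_orthogonal n.
rewrite pairing_step; last exact: momentN.
rewrite -(eq_phi IH) sub0r subr0 schur_pairing; last first.
  exact: (pairing_lead_neq0 (@momentN R 0) (@moment_nondegenerate R 0)).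
rewrite -mulrBl => /eqP; rewrite mulf_eq0 subr_eq0.
rewrite (negbTE (pairing_lead_neq0 (@momentN R 0) (@moment_nondegenerate R 0) n)) orbF.
by move=> /eqP.
Qed.

Lemma phi_schur0 n : phi (schur d) n = phi b n.
Proof. by apply: eq_phi => i _; exact: schur_moment0. Qed.

(** Each step multiplies the squared norm by [1 - b n ^+ 2]; the initial 2 is the length of the
    interval, the moments being unnormalised. *)
Lemma pairing_lead0 n : pairing d (phi b n) n n = 2 * cnorm R n ^+ 2 * (n%:R + 1).
Proof.
elim: n => [|n IH].
  rewrite pairing0; last exact: momentN.
  transitivity (II (fun=> 1 : R)); last by rewrite II_cst /=; ring.
  by rewrite moment0E; apply: eq_Rintegral => x _; rewrite /angle mulr0 mul0r cos0.
rewrite pairing_step; last exact: momentN.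
rewrite (_ : n%:Z - n.+1%:Z = -1); last lia.
rewrite (_ : n.+1%:Z - 1 = n%:Z); last lia.
have := @schur_pairing _ d n; rewrite phi_schur0 schur_moment0 => ->; last first.
  by have := pairing_lead_neq0 (@momentN R 0) (@moment_nondegenerate R 0) n; rewrite phi_schur0.
rewrite mulrA -expr2 -{1}[pairing _ _ _ _]mul1r -mulrBl bschur_sq IH /=.
have n0 := ler0n R n; rewrite -[n.+1%:R]natr1; field.
by rewrite gt_eqF//; lra.
Qed.

Definition legendre_kernel n x : R :=
  n%:R * (n%:R + 1) * P n x ^+ 2 - (1 - x ^+ 2) * dP n x ^+ 2.

Lemma bm_legendre_kernel n : bm (legendre_kernel n).
Proof.
apply: bmB; apply: bmM.
- exact: bm_cst.
- by apply: bmX; exact: bm_horner.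
- by apply: bmB; [exact: bm_cst|apply: bmX; exact: bm_id].
- by apply: bmX; exact: bm_horner.
Qed.

(** Reversal removes the conjugation: the double sum is the real part of the product of
    [Csum + i Ssum] at [m + 1] and [e^(i th)] times [Csum + i Ssum] at [m]. By [CsumS] and [SsumS]
    the second factor has the components of the first divided by [1 - b m] and [1 + b m], which
    leaves a difference of two squares. *)
Lemma double_sum_legendre m x : -1 <= x <= 1 ->
  \sum_(l < m.+1) \sum_(k < m.+2)
    phi b m (m - l)%N * (phi b m.+1 k * cos (angle (k%:Z - l%:Z) x)) =
  cnorm R m.+1 ^+ 2 * ((2 * m.+1%:R + 1) / (2 * m.+1%:R)) * legendre_kernel m.+1 x.
Proof.
move=> x1; set th := acos x.
have E : \sum_(l < m.+1) \sum_(k < m.+2)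
    phi b m (m - l)%N * (phi b m.+1 k * cos (angle (k%:Z - l%:Z) x)) =
    Csum b m.+1 th * (cos th * Csum b m th - sin th * Ssum b m th) -
    Ssum b m.+1 th * (cos th * Ssum b m th + sin th * Csum b m th).
  transitivity (\sum_(l < m.+1) phi b m l *
     (cos ((2 * l%:R - m%:R) * th + th) * Csum b m.+1 th -
      sin ((2 * l%:R - m%:R) * th + th) * Ssum b m.+1 th)).
    rewrite (reindex_inj rev_ord_inj) /=; apply: eq_bigr => l _.
    have lm : (l <= m)%N by rewrite -ltnS.
    rewrite subSS subKn// -mulr_sumr -cos_angle_Csum; congr (_ * _).
    apply: eq_bigr => k _; congr (_ * cos _).
    rewrite /angle intrD mulrNz -!pmulrn natrB// -[m.+1%:R]natr1 -/th; ring.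
  transitivity (
    (\sum_(l < m.+1) phi b m l * cos ((2 * l%:R - m%:R) * th + th)) * Csum b m.+1 th -
    (\sum_(l < m.+1) phi b m l * sin ((2 * l%:R - m%:R) * th + th)) * Ssum b m.+1 th).
    by rewrite !mulr_suml -sumrB; apply: eq_bigr => l _; ring.
  have -> : \sum_(l < m.+1) phi b m l * cos ((2 * l%:R - m%:R) * th + th) =
      cos th * Csum b m th - sin th * Ssum b m th by exact: cos_angle_Csum.
  have -> : \sum_(l < m.+1) phi b m l * sin ((2 * l%:R - m%:R) * th + th) =
      cos th * Ssum b m th + sin th * Csum b m th.
    rewrite /Csum /Ssum !mulr_sumr -big_split /=; apply: eq_bigr => k _.
    by rewrite sinD; ring.
  by ring.
rewrite E.
have m0 := ler0n R m.
have C := CsumS b m th; have S := SsumS b m th.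
have b1 : 1 - b m = (2 * m%:R + 4) / (2 * m%:R + 3).
  by rewrite /bschur; field; rewrite gt_eqF//; lra.
have b2 : 1 + b m = (2 * m%:R + 2) / (2 * m%:R + 3).
  by rewrite /bschur; field; rewrite gt_eqF//; lra.
have -> : cos th * Csum b m th - sin th * Ssum b m th =
    (2 * m%:R + 3) / (2 * m%:R + 4) * Csum b m.+1 th.
  by rewrite C b1; field; rewrite !gt_eqF//; lra.
have -> : cos th * Ssum b m th + sin th * Csum b m th =
    (2 * m%:R + 3) / (2 * m%:R + 2) * Ssum b m.+1 th.
  by rewrite S b2; field; rewrite !gt_eqF//; lra.
have [-> ->] := Csum_Ssum_legendre m.+1 th.
rewrite /th sin_acos// cos_acos// -/(sx x) /legendre_kernel -(sxE2 x1) -[m.+1%:R]natr1.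
by field; rewrite !gt_eqF//; lra.
Qed.

Lemma schur_derE m :
  schur_der (@moment R) (fun l : int => II (fun x => cos (angle l x) * Bstar x)) m =
  (2 * m.+1%:R + 1)^-1 * II (fun x => legendre_kernel m.+1 x * Bstar x).
Proof.
have bcB (l : int) : bm (fun x => cos (angle l x) * Bstar x).
  by apply: bmM; [exact: bm_cos_angle|exact: bm_Bstar].
have bK : bm (fun x => legendre_kernel m.+1 x * Bstar x).
  by apply: bmM; [exact: bm_legendre_kernel|exact: bm_Bstar].
rewrite /schur_der !phi_schur0 pairing_lead0.
transitivity (II (fun x => (cnorm R m.+1 ^+ 2 * ((2 * m.+1%:R + 1) / (2 * m.+1%:R))) *
    (legendre_kernel m.+1 x * Bstar x)) / (2 * cnorm R m ^+ 2 * (m%:R + 1))).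
  congr (_ / _).
  transitivity (II (fun x => \sum_(l < m.+1) \sum_(k < m.+2)
      phi b m (m - l)%N * (phi b m.+1 k * (cos (angle (k%:Z - l%:Z) x) * Bstar x)))).
    rewrite bm_int_sum; last first.
      move=> l; apply: bm_sum => k; apply: bmM; first exact: bm_cst.
      by apply: bmM; [exact: bm_cst|exact: bcB].
    apply: eq_bigr => l _; rewrite bm_int_sum; last first.
      move=> k; apply: bmM; first exact: bm_cst.
      by apply: bmM; [exact: bm_cst|exact: bcB].
    apply: eq_bigr => k _; rewrite bm_intZ; last first.
      by apply: bmM; [exact: bm_cst|exact: bcB].
    by rewrite bm_intZ.
  apply: eq_Rintegral => x; rewrite inE /= in_itv /= => x1.
  rewrite mulrA -double_sum_legendre// mulr_suml; apply: eq_bigr => l _.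
  by rewrite mulr_suml; apply: eq_bigr => k _ /=; ring.
rewrite bm_intZ//; have c0 := cnorm_gt0 R m; have m0 := ler0n R m.
rewrite /= -[m.+1%:R]natr1; field.
by rewrite !gt_eqF//; lra.
Qed.

Lemma alpha_derivative m : derivable (@Defs.alpha R m) 0 1 /\
  derive1 (@Defs.alpha R m) 0 =
  (2 * m.+1%:R + 1)^-1 * II (fun x => legendre_kernel m.+1 x * Bstar x).
Proof.
have C := @cvg_schur_der R (@moment R) _ (@momentN R) (@moment_nondegenerate R)
  (@moment_cvg R) (@moment_der R) m.
rewrite schur_derE in C.
have E : (fun h => h^-1 *: (Defs.alpha m h - Defs.alpha m 0)) @ (0 : R)^' -->
    (2 * m.+1%:R + 1)^-1 * II (fun x => legendre_kernel m.+1 x * Bstar x).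
  by under eq_fun do rewrite !alphaE; exact: C.
split.
  apply/cvg_ex; exists ((2 * m.+1%:R + 1)^-1 * II (fun x => legendre_kernel m.+1 x * Bstar x)).
  apply: cvg_trans E; apply: near_eq_cvg; near=> h.
  by rewrite /= addr0 [h *: 1]mulr1.
rewrite /derive1; apply: cvg_lim; first exact: Rhausdorff.
by apply: cvg_trans E; apply: near_eq_cvg; near=> h; rewrite /= addr0.
Unshelve. all: by end_near. Qed.

End at_zero.

(** * Integration by parts *)

Section jstar.
Variable R : realType.
Implicit Types (x y a : R).

Lemma cvg_dnbhs_neq (T : Type) (F : set_system T) (f : T -> R) (l : R) : Filter F ->
  f x @[x --> F] --> l -> (\forall x \near F, f x != l) -> f x @[x --> F] --> l^'.
Proof.
move=> FF fl fn P Pl; rewrite /= nbhs_filterE /fmap.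
by apply: filterS2 (fl _ Pl) fn => x; exact.
Qed.

Lemma continuous_dnbhs (f : R -> R) x : {for x, continuous f} ->
  f y @[y --> x^'] --> f x.
Proof. exact: cvg_within_filter. Qed.

Lemma cvg_sin_div : sin x / x @[x --> 0^'] --> (1 : R).
Proof.
have := hasder_cvg (@is_derive_sin R 0); rewrite cos0 sin0.
by under eq_fun do rewrite addr0 subr0 mulrC.
Qed.

Lemma cvg_cos_sub1_div : (cos x - 1) / x @[x --> 0^'] --> (0 : R).
Proof.
have := hasder_cvg (@is_derive_cos R 0); rewrite cos0 sin0 oppr0.
by under eq_fun do rewrite addr0 mulrC.
Qed.

Let pos_itv x : x \in `]0, 1[ -> x != 0.
Proof. by rewrite in_itv /= => /andP[x0 _]; rewrite gt_eqF. Qed.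

Let cvg_at0 (f : R -> R) (l : R) : hasder f 0 l -> f 0 = 0 -> f x @[x --> 0^'+] --> (0 : R).
Proof.
by move=> df f0; rewrite -[X in _ --> X]f0; apply: cvg_at_right_filter; exact: der_continuous df.
Qed.

(** Two applications of l'Hopital's rule on the right; the quotient is even, which gives the left
    side. *)
Lemma cvg_sin_sub_div : (sin x - x) / x ^+ 3 @[x --> 0^'] --> (- (1 / 6) : R).
Proof.
have lt01 : (0 : R) < 1 by lra.
have d1 (x : R) : x \in `]0, 1[ -> hasder (fun x => sin x - x) x (cos x - 1).
  by move=> _; apply: der_eq; [der|rewrite /=; ring].
have d2 (x : R) : x \in `]0, 1[ -> hasder (fun x => x ^+ 3) x (3 * x ^+ 2).
  by move=> _; apply: der_eq; [der|rewrite /=; ring].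
have d3 (x : R) : x \in `]0, 1[ -> hasder (fun x => cos x - 1) x (- sin x).
  by move=> _; apply: der_eq; [der|rewrite /=; ring].
have d4 (x : R) : x \in `]0, 1[ -> hasder (fun x => 3 * x ^+ 2) x (6 * x).
  by move=> _; apply: der_eq; [der|rewrite /=; ring].
have right0 : (sin x - x) / x ^+ 3 @[x --> 0^'+] --> (- (1 / 6) : R).
  apply: (lhopital_at_right lt01 d1 d2).
  - apply: (@cvg_at0 _ _ _); last by rewrite sin0 subrr.
    by der.
  - by apply: (@cvg_at0 _ _ _); [der|rewrite expr0n].
  - by move=> x /pos_itv x0; rewrite mulf_neq0// ?expf_neq0//; lra.
  apply: (lhopital_at_right lt01 d3 d4).
  - by apply: (@cvg_at0 _ _ _); [der|rewrite cos0 subrr].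
  - by apply: (@cvg_at0 _ _ _); [der|rewrite expr0n mulr0].
  - by move=> x /pos_itv x0; rewrite mulf_neq0//; lra.
  have h := cvg_dnbhs_at_right cvg_sin_div.
  rewrite -[X in _ --> X]mulr1.
  have -> : (fun x : R => - sin x / (6 * x)) = (fun x => - (1 / 6) * (sin x / x)).
    by apply/funext => x; rewrite invfM; ring.
  by apply: cvgM => //; exact: cvg_cst.
apply: (@cvg_at_right_left_dnbhs _ R^o _ _ _ right0).
apply/cvg_at_leftNP; rewrite oppr0; apply: cvg_trans right0.
apply: near_eq_cvg; near=> x.
have x3 : (- x) ^+ 3 = - x ^+ 3 by ring.
by rewrite /= sinN x3 invrN; ring.
Unshelve. all: by end_near. Qed.

Lemma sin_asin x : -1 <= x <= 1 -> sin (asin x) = x.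
Proof. by move=> x1; rewrite asinK// in_itv. Qed.

Lemma cos_asin_sx x : -1 <= x <= 1 -> cos (asin x) = sx x.
Proof. exact: cos_asin. Qed.

Lemma asin0 : asin 0 = 0 :> R.
Proof.
have := @sinK R 0; rewrite sin0; apply; rewrite in_itv /=.
by have := @pi_gt0 R; move=> ?; apply/andP; split; lra.
Qed.

Lemma asin_acos x : -1 <= x <= 1 -> asin x = pi / 2 - acos x.
Proof.
move=> x1; have h1 := acos_ge0 x1; have h2 := acos_lepi x1.
have h : sin (pi / 2 - acos x) = x.
  by rewrite sinB sin_pihalf cos_pihalf mul1r mul0r subr0 cos_acos.
by rewrite -[in LHS]h sinK// in_itv /=; apply/andP; split; lra.
Qed.

Lemma cvg_asin0 : asin x @[x --> (0 : R)^'] --> (0 : R)^'.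
Proof.
apply: cvg_dnbhs_neq.
  rewrite -[X in _ --> X]asin0; apply: continuous_dnbhs.
  by apply: continuous_asin; rewrite ltrN10 ltr01.
near=> x; apply: asin_neq0; last by near: x; exact: nbhs_dnbhs_neq.
rewrite -ler_norml; near: x; apply: dnbhs0_le; exact: ltr01.
Unshelve. all: by end_near. Qed.

(* An antiderivative of [- (Jstar x + 2 / (pi * sx x))]. *)
Definition flux x : R := sx x / asin x - (1 - x ^+ 2) / x.

Lemma flux0 : flux 0 = 0.
Proof. by rewrite /flux asin0 invr0 !mulr0 subrr. Qed.

(** With [x = sin a] the function is [cos a * (1/a - cos a / sin a)]; [G] rewrites this through
    quotients of known limit, so that the two poles cancel. *)
Lemma continuous_flux0 : {for (0 : R), continuous flux}.
Proof.
apply/continuous_withinNx; rewrite flux0.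
pose G a := cos a * ((sin a - a) / a ^+ 3 * a * (sin a / a)^-1 -
  (cos a - 1) / a * (sin a / a)^-1).
have G0 : G a @[a --> 0^'] --> (0 : R).
  have id0 : (fun a : R => a) a @[a --> 0^'] --> (0 : R) by exact: nbhs_dnbhs.
  have s1 : (sin a / a)^-1 @[a --> 0^'] --> (1 : R).
    by rewrite -[X in _ --> X]invr1; apply: cvgV; [exact: oner_neq0|exact: cvg_sin_div].
  have c1 : cos a @[a --> (0 : R)^'] --> (1 : R).
    by rewrite -[X in _ --> X]cos0; apply: continuous_dnbhs; exact: continuous_cos.
  have E : 1 * ((- (1 / 6)) * 0 * 1 - 0 * 1) = 0 :> R by ring.
  rewrite -[X in _ --> X]E.
  apply: cvgM => //; apply: cvgB; last by apply: cvgM => //; exact: cvg_cos_sub1_div.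
  by do 2!apply: cvgM => //; exact: cvg_sin_sub_div.
apply: cvg_trans (cvg_comp _ _ cvg_asin0 G0); apply: near_eq_cvg; near=> x.
have x0 : x != 0 by near: x; exact: nbhs_dnbhs_neq.
have x1 : -1 <= x <= 1.
  by rewrite -ler_norml; near: x; apply: dnbhs0_le; exact: ltr01.
have a0 := asin_neq0 x1 x0.
rewrite /G /= sin_asin// cos_asin_sx// /flux -(sxE2 x1); field.
by rewrite a0 x0.
Unshelve. all: by end_near. Qed.

Lemma JstarE x : -1 < x < 1 -> x != 0 ->
  Jstar x = x / (sx x * asin x) + 1 / asin x ^+ 2 - 1 / x ^+ 2 - 1 - 2 / (pi * sx x).
Proof.
move=> /andP[x1 x2] x0; rewrite /Jstar (negbTE x0) ifF//.
by apply/negbTE; rewrite neq_lt ltr_norml x1 x2.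
Qed.

Lemma near_bounds x : -1 < x < 1 -> \forall y \near x, -1 < y < 1.
Proof.
move=> x1; have : x \in `]-1, 1[ by rewrite in_itv.
move=> /near_in_itvoo; apply: filterS => y; by rewrite in_itv.
Qed.

Lemma der_flux x : -1 < x < 1 -> x != 0 ->
  hasder flux x (- (Jstar x + 2 / (pi * sx x))).
Proof.
move=> x1 x0; have x1' : -1 <= x <= 1 by case/andP: x1 => *; rewrite !ltW.
have a0 := asin_neq0 x1' x0; have s0 : sx x != 0 by rewrite gt_eqF ?sx_gt0.
apply: der_eq.
  apply: derD.
    apply: derM; first exact: (der_sx x1).
    by apply: (derV a0); apply: (der_asin x1); exact: derI.
  apply: derN; apply: derM; first by der.
  by apply: (derV x0); exact: derI.
rewrite JstarE// -/(sx x) -(sxE2 x1') /=.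
have p0 : pi != 0 :> R by rewrite gt_eqF// pi_gt0.
have sE := sxE2 x1'; move: (pi) p0 => q q0.
by field: sE; rewrite a0 x0 s0 q0.
Qed.

Lemma continuous_Jstar_interior x : -1 < x < 1 -> x != 0 -> {for x, continuous Jstar}.
Proof.
move=> x1 x0; have x1' : -1 <= x <= 1 by case/andP: x1 => *; rewrite !ltW.
have a0 := asin_neq0 x1' x0; have s0 : sx x != 0 by rewrite gt_eqF ?sx_gt0.
have p0 : pi != 0 :> R by rewrite gt_eqF// pi_gt0.
have da : hasder asin x (sx x)^-1 by exact: is_derive1_asin.
have ds := der_sx x1.
have [l dl] : exists l, hasder (fun x => x / (sx x * asin x) + 1 / asin x ^+ 2 -
    1 / x ^+ 2 - 1 - 2 / (pi * sx x)) x l.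
  eexists; apply: derD; [apply: derD; [apply: derD; [apply: derD|]|]|].
  - apply: derM; first exact: derI.
    by apply: derV; [rewrite mulf_neq0|apply: derM; [exact: ds|exact: da]].
  - apply: derM; first exact: derC.
    by apply: derV; [rewrite expf_neq0|apply: derX; exact: da].
  - apply: derN; apply: derM; first exact: derC.
    by apply: derV; [rewrite expf_neq0|apply: derX; exact: derI].
  - by apply: derN; exact: derC.
  - apply: derN; apply: derM; first exact: derC.
    by apply: derV; [rewrite mulf_neq0|apply: derM; [exact: derC|exact: ds]].
apply: (@der_continuous _ _ _ l); apply: near_hasder dl; near=> y.
apply: JstarE; near: y; [exact: near_bounds|exact: near_neq0].
Unshelve. all: by end_near. Qed.

(** With [x = sin a] the double poles combine as [1/a^2 - 1/sin(a)^2 = (sin a - a)(sin a + a)/(a sin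
    a)^2], of limit [- 1/3]; the terms [1] and [- 1] cancel in the limit. *)
Lemma continuous_Jstar0 : {for (0 : R), continuous Jstar}.
Proof.
have p0 : pi != 0 :> R by rewrite gt_eqF// pi_gt0.
apply/continuous_withinNx; rewrite {2}/Jstar eqxx.
pose G a := (sin a / a) / cos a +
  (sin a - a) / a ^+ 3 * (sin a / a + 1) * ((sin a / a)^-1 * (sin a / a)^-1) - 1 -
  2 / (pi * cos a).
have G0 : G a @[a --> 0^'] --> (- (1 / 3) - 2 / pi : R).
  have s1 : (sin a / a)^-1 @[a --> 0^'] --> (1 : R).
    by rewrite -[X in _ --> X]invr1; apply: cvgV; [exact: oner_neq0|exact: cvg_sin_div].
  have c1 : cos a @[a --> (0 : R)^'] --> (1 : R).
    by rewrite -[X in _ --> X]cos0; apply: continuous_dnbhs; exact: continuous_cos.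
  have E : 1 / 1 + - (1 / 6) * (1 + 1) * (1 * 1) - 1 - 2 / (pi * 1) =
    - (1 / 3) - 2 / pi :> R by rewrite mulr1; lra.
  rewrite -[X in _ --> X]E.
  apply: cvgB; last first.
    apply: cvgM; first exact: cvg_cst.
    by apply: cvgV; [rewrite mulr1|apply: cvgM => //; exact: cvg_cst].
  apply: cvgB; last exact: cvg_cst.
  apply: cvgD; first by apply: cvgM; [exact: cvg_sin_div|apply: cvgV; [exact: oner_neq0|]].
  apply: cvgM; last by apply: cvgM.
  apply: cvgM; first exact: cvg_sin_sub_div.
  by apply: cvgD; [exact: cvg_sin_div|exact: cvg_cst].
apply: cvg_trans (cvg_comp _ _ cvg_asin0 G0); apply: near_eq_cvg; near=> x.
have x0 : x != 0 by near: x; exact: nbhs_dnbhs_neq.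
have x1 : -1 < x < 1.
  by rewrite -ltr_norml; near: x; apply: dnbhs0_lt; exact: ltr01.
have x1' : -1 <= x <= 1 by case/andP: x1 => *; rewrite !ltW.
have a0 := asin_neq0 x1' x0; have s0 : sx x != 0 by rewrite gt_eqF ?sx_gt0.
rewrite /G /= sin_asin// cos_asin_sx// JstarE//.
move: (pi) p0 => q q0; field; by rewrite a0 x0 s0 q0.
Unshelve. all: by end_near. Qed.

(** With [x = cos th] the two singular terms are [(k th - k 0) / sin th], where [k 0 = 2 / pi]. They
    tend to the derivative of [k] at 0, which is [4 / pi^2]; [1 / asin x ^+ 2] contributes the other
    [4 / pi^2]. *)
Lemma cvg_Jstar1 : Jstar x @[x --> (1 : R)^'-] --> Jstar (1 : R).
Proof.
have p0 : pi != 0 :> R by rewrite gt_eqF// pi_gt0.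
have -> : Jstar 1 = 8 / pi ^+ 2 - 2 :> R.
  by rewrite /Jstar oner_eq0 normr1 eqxx.
pose k (th : R) := cos th / (pi / 2 - th).
have dk : hasder k 0 (4 / pi ^+ 2).
  apply: der_eq.
    apply: derM; first by der.
    by apply: derV; [rewrite subr0 mulf_neq0// invr_eq0; lra|der].
  by move: (pi) p0 => q q0; rewrite sin0 cos0; field; rewrite q0.
have N11 : (-1 : R) < 1 by lra.
have [_ _ c1] := (continuous_within_itvP _ N11).1 (@within_continuous_acos R).
have th0 : acos x @[x --> (1 : R)^'-] --> (0 : R)^'.
  apply: cvg_dnbhs_neq; first by rewrite -[X in _ --> X]acos1.
  near=> x; rewrite gt_eqF// acos_gt0//; apply/andP; split.
    by near: x; apply: nbhs_left_ge; lra.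
  by near: x; exact: nbhs_left_lt.
have h1 := cvg_comp _ _ th0 (hasder_cvg dk).
have s1 : (sin a / a)^-1 @[a --> 0^'] --> (1 : R).
  by rewrite -[X in _ --> X]invr1; apply: cvgV; [exact: oner_neq0|exact: cvg_sin_div].
have h2 := cvg_comp _ _ th0 s1.
have h3 : pi / 2 - acos x @[x --> (1 : R)^'-] --> (pi / 2 - 0 : R).
  by apply: cvgB; [exact: cvg_cst|rewrite -[X in _ --> X]acos1].
have h4 : (fun x : R => x) x @[x --> (1 : R)^'-] --> (1 : R).
  exact: cvg_at_left_filter cvg_id.
have lim : ((acos x)^-1 * (k (acos x + 0) - k 0)) * (sin (acos x) / acos x)^-1 +
    ((pi / 2 - acos x)^-1) ^+ 2 - (x^-1) ^+ 2 - 1 @[x --> (1 : R)^'-] -->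
    (4 / pi ^+ 2 * 1 + ((pi / 2 - 0)^-1) ^+ 2 - (1^-1) ^+ 2 - 1 : R).
  apply: cvgB; last exact: cvg_cst.
  apply: cvgB; last by rewrite !expr2; apply: cvgM; apply: cvgV.
  apply: cvgD; first by apply: cvgM.
  by rewrite !expr2; apply: cvgM; apply: cvgV => //; rewrite subr0 mulf_neq0// invr_eq0; lra.
have <- : 4 / pi ^+ 2 * 1 + ((pi / 2 - 0)^-1) ^+ 2 - (1^-1) ^+ 2 - 1 =
    8 / pi ^+ 2 - 2 :> R by move: (pi) p0 => q q0; field; rewrite q0.
apply: cvg_trans lim; apply: near_eq_cvg; near=> x.
have x0 : 0 < x by near: x; apply: nbhs_left_gt; lra.
have x1 : x < 1 by near: x; exact: nbhs_left_lt.
have xI : -1 < x < 1 by rewrite x1 andbT; lra.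
have xI' : -1 <= x <= 1 by case/andP: xI => *; rewrite !ltW.
have x0' : x != 0 by rewrite gt_eqF.
have a0 := asin_neq0 xI' x0'.
have c0 : acos x != 0 by rewrite gt_eqF// acos_gt0// x1 andbT; lra.
have s0 : sx x != 0 by rewrite gt_eqF ?sx_gt0.
rewrite /k addr0 cos_acos// sin_acos// -/(sx x) cos0 subr0 (JstarE xI x0') -asin_acos//.
have := p0; move: (pi) => q q0; field.
by rewrite a0 c0 s0 q0 x0'.
Unshelve. all: by end_near. Qed.

Lemma JstarN x : -1 <= x <= 1 -> Jstar (- x) = Jstar x.
Proof.
move=> x1; rewrite /Jstar oppr_eq0 normrN asinN// !sqrrN.
by rewrite mulrN invrN mulrNN.
Qed.

Lemma within_continuous_Jstar : {within `[-1, 1], continuous (@Jstar R)}.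
Proof.
apply: within_itvN11.
- move=> x x1; have [->|x0] := eqVneq x 0; first exact: continuous_Jstar0.
  exact: continuous_Jstar_interior.
- apply/cvg_at_rightNP; rewrite opprK JstarN; last by lra.
  apply: cvg_trans cvg_Jstar1; apply: near_eq_cvg; near=> x.
  rewrite /= JstarN//; apply/andP; split.
    by near: x; apply: nbhs_left_ge; lra.
  by near: x; exact: nbhs_left_le.
- exact: cvg_Jstar1.
Unshelve. all: by end_near. Qed.

End jstar.

(** * Reduction to integrals of the squared Legendre polynomials *)

Section flux_by_parts.
Variable R : realType.
Local Notation mu := (@lebesgue_measure R).
Implicit Types (x y : R) (n : nat).
Notation P n x := (legendre R n).[x].
Notation dP n x := (deriv (legendre R n)).[x].

(** The exceptional point serves for [c = 0], where the defining quotients of [Bstar] and [flux]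
    degenerate. *)
Lemma FTC2_integrable_except (f F : R -> R) (a c b : R) : a < c -> c < b ->
  mu.-integrable `[a, b] (EFin \o f) ->
  {within `[a, b], continuous F} ->
  (forall x, a < x < b -> x != c -> {for x, continuous f}) ->
  (forall x, a < x < b -> x != c -> hasder F x (f x)) ->
  \int[mu]_(x in `[a, b]) f x = F b - F a.
Proof.
move=> ac cb fi cF cf dF.
have s1 : `[a, c] `<=` `[a, b].
  by move=> x; rewrite /= !in_itv /= => /andP[-> xc]; rewrite (le_trans xc (ltW cb)).
have s2 : `[c, b] `<=` `[a, b].
  by move=> x; rewrite /= !in_itv /= => /andP[cx ->]; rewrite (le_trans (ltW ac) cx).
have i1 : mu.-integrable `[a, c] (EFin \o f) by apply: integrableS fi.
have i2 : mu.-integrable `[c, b] (EFin \o f) by apply: integrableS fi.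
have i3 : mu.-integrable `]c, b] (EFin \o f).
  by apply: integrableS i2 => // x; rewrite /= !in_itv /= => /andP[/ltW-> ->].
have E1 : \int[mu]_(x in `[a, c]) f x = F c - F a.
  apply: (FTC2_integrable ac i1 (continuous_subspaceW s1 cF)) => x;
    rewrite in_itv /= => /andP[ax xc].
    by apply: cf; [rewrite ax (lt_trans xc cb)|rewrite lt_eqF].
  by apply: dF; [rewrite ax (lt_trans xc cb)|rewrite lt_eqF].
have E2 : \int[mu]_(x in `[c, b]) f x = F b - F c.
  apply: (FTC2_integrable cb i2 (continuous_subspaceW s2 cF)) => x;
    rewrite in_itv /= => /andP[cx xb].
    by apply: cf; [rewrite xb (lt_trans ac cx)|rewrite gt_eqF].
  by apply: dF; [rewrite xb (lt_trans ac cx)|rewrite gt_eqF].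
have := Rintegral_itvB fi; move=> /(_ c).
rewrite !bnd_simp (ltW ac) (ltW cb) => /(_ erefl erefl).
rewrite (Rintegral_itv_obnd_cbnd i3) E1 E2.
by move: (\int[mu]_(x in `[a, b]) f x) => I; lra.
Qed.

Lemma within_continuous_flux : {within `[-1, 1], continuous (@flux R)}.
Proof.
have N11 : (-1 : R) < 1 by lra.
have [_ aN1 a1] := (continuous_within_itvP _ N11).1 (@within_continuous_asin R).
have idr (z : R) : (fun x : R => x) x @[x --> z^'+] --> z.
  exact: cvg_at_right_filter cvg_id.
have idl (z : R) : (fun x : R => x) x @[x --> z^'-] --> z.
  exact: cvg_at_left_filter cvg_id.
apply: within_itvN11.
- move=> x x1; have [->|x0] := eqVneq x 0; first exact: continuous_flux0.
  exact: der_continuous (der_flux x1 x0).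
- apply: cvgB; apply: cvgM.
  + by apply: cvg_at_right_filter; exact: continuous_sx.
  + by apply: cvgV => //; apply: asin_neq0; rewrite ?oppr_eq0 ?oner_neq0// lexx; lra.
  + apply: cvg_at_right_filter; apply: (@der_continuous _ (fun x => 1 - x ^+ 2)); der.
  + by apply: cvgV => //; rewrite oppr_eq0 oner_neq0.
- apply: cvgB; apply: cvgM.
  + by apply: cvg_at_left_filter; exact: continuous_sx.
  + by apply: cvgV => //; apply: asin_neq0; rewrite ?oner_neq0// lexx andbT; lra.
  + apply: cvg_at_left_filter; apply: (@der_continuous _ (fun x => 1 - x ^+ 2)); der.
  + by apply: cvgV => //; rewrite oner_neq0.
Qed.

Lemma bm_Jstar : bm (@Jstar R).
Proof. by apply: bm_continuous; exact: within_continuous_Jstar. Qed.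

(** Both integrations by parts are done at once by the primitive [F]. Since [flux] is [1 - x^2]
    times the derivative of [Bstar], the cross terms in [P n x * dP n x] cancel in the derivative of
    [F], which vanishes at both endpoints. *)
Lemma II_legendre_kernel_Bstar n :
  II (fun x : R => legendre_kernel n x * Bstar x) =
  (II (fun x => Jstar x * P n x ^+ 2) + 2 / pi * II (fun x => P n x ^+ 2 / sx x)) / 2.
Proof.
have N11 : (-1 : R) < 0 by lra.
have p0 := @pi_gt0 R.
have bP2 : bm (fun x => P n x ^+ 2) by apply: bmX; exact: bm_horner.
have bJP : bm (fun x => Jstar x * P n x ^+ 2) by apply: bmM => //; exact: bm_Jstar.
have bKB : bm (fun x => legendre_kernel n x * Bstar x).
  by apply: bmM; [exact: bm_legendre_kernel|exact: bm_Bstar].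
pose g x := legendre_kernel n x * Bstar x - 2^-1 * (Jstar x * P n x ^+ 2).
have bg : bm g by apply: bmB => //; apply: bmM => //; exact: bm_cst.
pose h x := pi^-1 * (P n x ^+ 2 / sx x).
have ih : mu.-integrable `[-1, 1] (EFin \o h).
  have -> : h = fun x => pi^-1 * P n x ^+ 2 / sx x by apply/funext => x; rewrite /h mulrA.
  exact: (bm_inv_sx_integrable (bmM (bm_cst pi^-1) bP2)).
pose f x := g x - h x.
have fi : mu.-integrable `[-1, 1] (EFin \o f).
  have -> : EFin \o f = ((EFin \o g) \- (EFin \o h))%E by apply/funext => x; rewrite /= EFinB.
  by apply: integrableB => //; exact: bm_integrable.
pose F x := 2^-1 * (flux x * P n x ^+ 2) - Bstar x * ((1 - x ^+ 2) * P n x * dP n x).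
have cPn (p : {poly R}) : {within `[-1, 1], continuous (fun x => p.[x])}.
  by apply: continuous_subspaceT => x; exact: continuous_horner.
have c1x : {within `[-1, 1], continuous (fun x : R => 1 - x ^+ 2)}.
  by apply: continuous_subspaceT => x; apply: (@der_continuous _ (fun x => 1 - x ^+ 2)); der.
have cF : {within `[-1, 1], continuous F}.
  move=> x; apply: cvgB.
    apply: cvgM; first exact: cvg_cst.
    apply: cvgM; first exact: within_continuous_flux.
    by apply: cvgM; exact: cPn.
  apply: cvgM; first exact: within_continuous_Bstar.
  by apply: cvgM; [apply: cvgM; [exact: c1x|exact: cPn]|exact: cPn].
have I0 : II f = 0.
  rewrite (@FTC2_integrable_except f F (-1) 0 1 N11 ltr01 fi cF).
  - by rewrite /F /flux /sx sqrrN expr1n subrr sqrtr0 !mul0r !subr0 !mul0r !mulr0 !subr0.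
  - move=> x x1 x0.
    have ds := der_sx x1; have s0 : sx x != 0 by rewrite gt_eqF ?sx_gt0.
    have cp (p : {poly R}) : {for x, continuous (fun x => p.[x])}.
      exact: continuous_horner.
    have cP2 : {for x, continuous (fun x => P n x ^+ 2)}.
      by apply: (@der_continuous _ (fun x => P n x ^+ 2)); apply: derX; exact: der_legendre.
    apply: cvgB; first apply: cvgB.
    + apply: cvgM; last exact: der_continuous (der_Bstar x1 x0).
      apply: cvgB; apply: cvgM => //; first exact: cvg_cst.
        by apply: (@der_continuous _ (fun x => 1 - x ^+ 2)); der.
      apply: (@der_continuous _ (fun x => dP n x ^+ 2)); apply: derX.
      by apply: der_horner; exact: derI.
    + apply: cvgM; first exact: cvg_cst.
      by apply: cvgM => //; exact: continuous_Jstar_interior.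
    + apply: cvgM; first exact: cvg_cst.
      by apply: cvgM => //; apply: cvgV => //; exact: continuous_sx.
  - move=> x x1 x0.
    have s0 : sx x != 0 by rewrite gt_eqF ?sx_gt0.
    have x1' : -1 <= x <= 1 by case/andP: x1 => *; rewrite !ltW.
    have a0 := asin_neq0 x1' x0.
    apply: der_eq.
      apply: derD.
        apply: derM; first exact: derC.
        apply: derM; first exact: (der_flux x1 x0).
        by apply: derX; exact: (der_legendre n x).
      apply: derN; apply: derM; first exact: (der_Bstar x1 x0).
      exact: (der_legendre_flux n x).
    rewrite /f /g /h /legendre_kernel /flux -(sxE2 x1') /=.
    have {}p0 : pi != 0 :> R by rewrite gt_eqF.
    move: (pi) p0 (Jstar x) (Bstar x) => q q0 J B; field.
    by rewrite a0 x0 s0 q0.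
have E : II f = II (fun x => legendre_kernel n x * Bstar x) -
    2^-1 * II (fun x => Jstar x * P n x ^+ 2) - pi^-1 * II (fun x => P n x ^+ 2 / sx x).
  rewrite -(bm_intZ 2^-1 bJP) -bm_intB//; last by apply: bmM => //; exact: bm_cst.
  rewrite -RintegralZl//; last exact: bm_inv_sx_integrable.
  by rewrite -RintegralB//; exact: bm_integrable.
move: E; rewrite I0 => /esym/eqP.
rewrite subr_eq0 subr_eq => /eqP ->.
move: (II (fun x => Jstar x * P n x ^+ 2)) (II (fun x => P n x ^+ 2 / sx x)) => X Y.
have {}p0 : pi != 0 :> R by rewrite gt_eqF.
by move: (pi) p0 => q q0; field; rewrite q0.
Qed.

End flux_by_parts.

(** * Weak limit of the squares of Legendre polynomials *)

Section weierstrass.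
Variable R : realType.
Implicit Types (x y c : R) (n k : nat).

Lemma uniform_continuity_N11 (f : R -> R) (e : R) : 0 < e ->
  {within `[-1, 1], continuous f} ->
  exists2 r : R, 0 < r & forall x y, -1 <= x <= 1 -> -1 <= y <= 1 ->
    `|x - y| < r -> `|f x - f y| <= e.
Proof.
move=> e0 cf; have e2 : 0 < e / 2 by lra.
have cov : near_covering_within (`[-1, 1]%classic : set R).
  by apply/near_covering_withinP/compact_near_coveringP; exact: segment_compact.
have := cov R (0 : R)^'+ (fun r x => forall y, -1 <= y <= 1 -> `|x - y| < r ->
  `|f x - f y| <= e) _.
case=> [x /=|r /= r0 H].
  rewrite in_itv /= => xI.
  have [r r0 fr] : exists2 r, 0 < r & forall y, -1 <= y <= 1 -> `|x - y| < r ->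
      `|f x - f y| <= e / 2.
    have xI' : `[-1, 1]%classic x by rewrite /= in_itv.
    have /subspace_continuousP/(_ x xI') /cvgrPdist_le /(_ _ e2) := cf.
    move=> /nbhs_ballP[r r0 fr]; exists r => // y yI xy.
    by apply: fr => //; rewrite /= in_itv.
  exists (ball x (r / 2), [set s | s < r / 2]).
    split; first by apply: nbhsx_ballx; lra.
    by apply: nbhs_right_lt; lra.
  move=> [x' s] /= [xx' sr] x'I y yI x'y; rewrite in_itv /= in x'I.
  have h1 : `|f x - f x'| <= e / 2.
    by apply: fr => //; rewrite /ball /= in xx'; lra.
  have h2 : `|f x - f y| <= e / 2.
    apply: fr => //; rewrite /ball /= in xx'.
    have := ler_normD (x - x') (x' - y); rewrite subrKA; lra.
  have := ler_normB (f x - f y) (f x - f x').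
  have -> : f x - f y - (f x - f x') = f x' - f y by ring.
  by lra.
have H' := H (r / 2); exists (r / 2); first by lra.
move=> x y xI yI xy; apply: H' => //=.
- by rewrite sub0r normrN gtr0_norm; lra.
- by lra.
Qed.

(* The Bernstein polynomials transported to [-1, 1], by recurrence on the degree. *)
Fixpoint bernstein n k : {poly R} :=
  let Y := (2^-1)%:P * ('X + 1) in
  if n is n'.+1 then
    Y * (if k is k'.+1 then bernstein n' k' else 0) + (1 - Y) * bernstein n' k
  else (k == 0%N)%:R.

Let Y x := (x + 1) / 2.

Lemma bernsteinS n k x : (bernstein n.+1 k).[x] =
  Y x * (if k is k'.+1 then (bernstein n k').[x] else 0) + (1 - Y x) * (bernstein n k).[x].
Proof.
rewrite /= !(hornerM, hornerD, hornerN, hornerC, hornerX) /Y mulrC.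
case: k => [|k]; rewrite ?horner0; ring.
Qed.

Lemma bernstein_out n k : (n < k)%N -> bernstein n k = 0.
Proof.
elim: n k => [|n IH] [|k]//= nk.
by rewrite !IH ?mulr0 ?addr0//; lia.
Qed.

Lemma bernstein_ge0 n k x : -1 <= x <= 1 -> 0 <= (bernstein n k).[x].
Proof.
move=> /andP[x1 x2]; have Y0 : 0 <= Y x by rewrite /Y; lra.
have Y1 : 0 <= 1 - Y x by rewrite /Y; lra.
elim: n k => [|n IH] k.
  by rewrite /= -polyC_natr hornerC ler0n.
rewrite bernsteinS addr_ge0// mulr_ge0//.
by case: k.
Qed.

Lemma bernstein_sum_rec (phi : nat -> R) n x :
  \sum_(k < n.+2) phi k * (bernstein n.+1 k).[x] =
  Y x * \sum_(k < n.+1) phi k.+1 * (bernstein n k).[x] +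
  (1 - Y x) * \sum_(k < n.+1) phi k * (bernstein n k).[x].
Proof.
under eq_bigr do rewrite bernsteinS mulrDr.
rewrite big_split /=; congr (_ + _).
  rewrite big_ord_recl /= !mulr0 add0r mulr_sumr; apply: eq_bigr => k _.
  by rewrite /bump /= add1n; ring.
rewrite big_ord_recr /= bernstein_out// horner0 !mulr0 addr0 mulr_sumr.
by apply: eq_bigr => k _; ring.
Qed.

Lemma bernstein_sum n x : \sum_(k < n.+1) (bernstein n k).[x] = 1.
Proof.
suff : \sum_(k < n.+1) 1 * (bernstein n k).[x] = 1.
  by under eq_bigr do rewrite mul1r.
elim: n => [|n IH].
  by rewrite big_ord_recl big_ord0 /= addr0 mul1r hornerC.
by rewrite (bernstein_sum_rec (fun=> 1)) IH; ring.
Qed.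

(** The second moment of a binomial law of parameter [Y x]. The centre [c] is arbitrary because the
    recursion on the degree shifts it by one. *)
Lemma bernstein_variance n c x :
  \sum_(k < n.+1) (k%:R - c) ^+ 2 * (bernstein n k).[x] =
  n%:R * (Y x * (1 - Y x)) + (n%:R * Y x - c) ^+ 2.
Proof.
elim: n c => [|n IH] c.
  by rewrite big_ord_recl big_ord0 /= addr0 hornerC; ring.
rewrite (bernstein_sum_rec (fun k => (k%:R - c) ^+ 2)) IH.
have -> : \sum_(k < n.+1) (k.+1%:R - c) ^+ 2 * (bernstein n k).[x] =
    \sum_(k < n.+1) (k%:R - (c - 1)) ^+ 2 * (bernstein n k).[x].
  by apply: eq_bigr => k _; rewrite -[k.+1%:R]natr1; congr (_ * _); ring.
by rewrite IH -[n.+1%:R]natr1; ring.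
Qed.

(** Chebyshev's argument: nodes closer than [r] contribute at most [e / 2] by uniform continuity; at
    the others the trivial bound [2 M] is at most [D * (x - t k) ^+ 2], whose mean is controlled by
    the variance. *)
Lemma weierstrass (f : R -> R) (e : R) : 0 < e ->
  {within `[-1, 1], continuous f} ->
  exists p : {poly R}, forall x, -1 <= x <= 1 -> `|f x - p.[x]| <= e.
Proof.
move=> e0 cf; have [_ [M fM]] := bm_continuous cf.
have M0 : 0 <= M by apply: le_trans (fM 0 _) => //; lra.
have [r r0 fr] := uniform_continuity_N11 (ltac:(lra) : 0 < e / 2) cf.
(* Chosen so that the variance contribution [2 M / (r^2 n)] is at most [e / 2]. *)
pose n := (Num.truncn (4 * M / (r ^+ 2 * e))).+1.
have n0 : 0 < n%:R :> R by rewrite ltr0n.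
have nM : 2 * M / (r ^+ 2 * n%:R) <= e / 2.
  have : 4 * M / (r ^+ 2 * e) <= n%:R by apply: ltW; exact: truncnS_gt.
  rewrite ler_pdivrMr ?mulr_gt0 ?exprn_gt0// => h.
  by rewrite ler_pdivrMr ?mulr_gt0 ?exprn_gt0//; lra.
pose t (k : nat) : R := 2 * k%:R / n%:R - 1.
exists (\sum_(k < n.+1) (f (t k))%:P * bernstein n k) => x x1.
have tI (k : 'I_n.+1) : -1 <= t k <= 1.
  have k0 : 0 <= k%:R / n%:R :> R by rewrite divr_ge0.
  have k1 : k%:R / n%:R <= 1 :> R by rewrite ler_pdivrMr// mul1r ler_nat -ltnS.
  by rewrite /t -mulrA; apply/andP; split; lra.
rewrite horner_sum -[f x]mulr1 -(bernstein_sum n x) mulr_sumr -sumrB.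
apply: le_trans (ler_norm_sum _ _ _) _.
pose D := 2 * M / r ^+ 2.
have D0 : 0 <= D by apply: divr_ge0; [exact: mulr_ge0|exact: sqr_ge0].
apply: (@le_trans _ _ (\sum_(k < n.+1) (e / 2 + D * (x - t k) ^+ 2) * (bernstein n k).[x])).
  apply: ler_sum => k _; rewrite hornerM hornerC -mulrBl normrM.
  rewrite [`|_.[x]|]ger0_norm ?bernstein_ge0//; apply: ler_wpM2r; first exact: bernstein_ge0.
  have [xt|xt] := ltP `|x - t k| r.
    apply: le_trans (fr _ _ x1 (tI k) xt) _.
    by rewrite lerDl mulr_ge0 ?sqr_ge0.
  apply: (@le_trans _ _ (2 * M)).
    apply: le_trans (ler_normB _ _) _.
    by have := fM _ x1; have := fM _ (tI k); lra.
  have h : r ^+ 2 <= (x - t k) ^+ 2.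
    rewrite -[leRHS]real_normK ?num_real//.
    by rewrite !expr2 ler_pM// ltW.
  have : D * r ^+ 2 <= D * (x - t k) ^+ 2 by exact: ler_wpM2l.
  rewrite {1}/D divfK ?expf_neq0 ?gt_eqF//; lra.
under eq_bigr do rewrite mulrDl.
rewrite big_split /= -mulr_sumr bernstein_sum mulr1.
have -> : \sum_(k < n.+1) D * (x - t k) ^+ 2 * (bernstein n k).[x] =
    D * (4 / n%:R ^+ 2) * \sum_(k < n.+1) (k%:R - n%:R * Y x) ^+ 2 * (bernstein n k).[x].
  rewrite mulr_sumr; apply: eq_bigr => k _; rewrite /t /Y; field.
  by rewrite gt_eqF.
rewrite bernstein_variance subrr expr0n addr0.
have YY : Y x * (1 - Y x) <= 1 / 4 by rewrite /Y; have := sqr_ge0 x; nra.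
have : D * (4 / n%:R ^+ 2) * (n%:R * (Y x * (1 - Y x))) <=
    D * (4 / n%:R ^+ 2) * (n%:R * (1 / 4)).
  apply: ler_wpM2l; first by rewrite mulr_ge0// divr_ge0// ?sqr_ge0.
  by apply: ler_wpM2l => //; exact: ltW.
have -> : D * (4 / n%:R ^+ 2) * (n%:R * (1 / 4)) = 2 * M / (r ^+ 2 * n%:R).
  by rewrite /D; field; rewrite !gt_eqF.
by lra.
Qed.

End weierstrass.

(** * Convergence of the squared Legendre polynomials to the arcsine law *)

Section legendre_weak_limit.
Variable R : realType.
Local Notation mu := (@lebesgue_measure R).
Implicit Types (x y : R) (n k m : nat) (p q : {poly R}).
Notation P n := (legendre R n).

Definition intp p : R := II (fun x => p.[x]).

Lemma intpD p q : intp (p + q) = intp p + intp q.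
Proof.
rewrite /intp -bm_intD; [|exact: bm_horner|exact: bm_horner].
by apply: eq_Rintegral => x _; rewrite hornerD.
Qed.

Lemma intpZ c p : intp (c%:P * p) = c * intp p.
Proof.
rewrite /intp -bm_intZ; last exact: bm_horner.
by apply: eq_Rintegral => x _; rewrite hornerM hornerC.
Qed.

(** [F] is [1 - x^2] times the Wronskian; by the Legendre equations its derivative is the difference
    [c] of the eigenvalues times the product, and it vanishes at both endpoints. *)
Lemma legendre_orthogonal n m : n != m -> intp (P n * P m) = 0.
Proof.
move=> nm; pose c : R := n%:R * (n%:R + 1) - m%:R * (m%:R + 1).
have c0 : c != 0.
  rewrite /c subr_eq0 !natr1 -!natrM eqr_nat.
  by apply/negP => /eqP h; move/eqP: nm; nia.
apply: (mulfI c0); rewrite mulr0 -intpZ.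
pose F x := (P n).[x] * ((1 - x ^+ 2) * (deriv (P m)).[x]) -
  (P m).[x] * ((1 - x ^+ 2) * (deriv (P n)).[x]).
have dF x : hasder F x (c%:P * (P n * P m)).[x].
  apply: der_eq.
    apply: derD; first by apply: derM; [exact: (der_legendre n x)|exact: (legendre_ode m x)].
    by apply: derN; apply: derM; [exact: (der_legendre m x)|exact: (legendre_ode n x)].
  by rewrite !hornerM hornerC /c; ring.
have N11 : (-1 : R) < 1 by lra.
rewrite /intp (@FTC2_integrable R _ F (-1) 1 N11).
- by rewrite /F sqrrN expr1n subrr !mul0r !mulr0 !subrr.
- exact: bm_integrable (bm_horner _).
- by apply: continuous_subspaceT => x; exact: der_continuous (dF x).
- by move=> x _; exact: continuous_horner.
- by move=> x _; exact: dF.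
Qed.

Lemma mulX_legendre n : (2 * n%:R + 3)%:P * ('X * P n.+1) =
  (n%:R + 2)%:P * P n.+2 + (n%:R + 1)%:P * P n.
Proof.
have n2 : n%:R + 2 != 0 :> R by have := ler0n R n; lra.
rewrite legendreSS -[n.+2%:R]natr1 -[n.+1%:R]natr1 -addrA.
have E : (n%:R + 2)%:P * ((n%:R + (1 + 1))^-1)%:P = 1 :> {poly R}.
  by rewrite -polyCM divff// polyC1.
rewrite [X in _ = X + _]mulrA E mul1r; ring.
Qed.

(** The integral of [x P_n P_(n+1)] is evaluated twice, expanding [x P_(n+1)] in [E1] and [x P_n] in
    [E2]; this links consecutive norms. *)
Lemma legendre_norm n : intp (P n * P n) = 2 / (2 * n%:R + 1).
Proof.
elim: n => [|n IH].
  rewrite legendre0 mulr1 mulr0 add0r divr1 /intp.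
  by under eq_Rintegral do rewrite hornerC; rewrite II_cst mul1r.
have n0 := ler0n R n.
have E1 : (2 * n%:R + 3) * intp ('X * P n.+1 * P n) = (n%:R + 1) * intp (P n * P n).
  rewrite -intpZ mulrA mulX_legendre mulrDl intpD -!mulrA !intpZ.
  by rewrite legendre_orthogonal ?mulr0 ?add0r//; lia.
have E2 : (2 * n%:R + 1) * intp ('X * P n * P n.+1) = (n%:R + 1) * intp (P n.+1 * P n.+1).
  case: n {IH n0 E1} => [|n].
    by rewrite legendre0 legendre1 mulr1 mulr0 !add0r.
  have -> : 2 * n.+1%:R + 1 = 2 * n%:R + 3 :> R by rewrite -[n.+1%:R]natr1; ring.
  rewrite -intpZ mulrA mulX_legendre mulrDl intpD -!mulrA !intpZ.
  rewrite [X in _ + _ * X]legendre_orthogonal ?mulr0 ?addr0; last lia.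
  by rewrite -[n.+1%:R]natr1; congr (_ * _); ring.
have S : intp ('X * P n * P n.+1) = intp ('X * P n.+1 * P n) by congr intp; ring.
have h1 : 2 * n%:R + 3 != 0 :> R by lra.
have h2 : n%:R + 1 != 0 :> R by lra.
have h3 : 2 * n%:R + 1 != 0 :> R by lra.
apply: (mulfI h2); rewrite -E2 S -[n.+1%:R]natr1.
apply: (mulfI h1); rewrite mulrCA E1 IH; field.
by rewrite h3 /=; lra.
Qed.

Lemma cvg_inv2n (b : R) : 1 <= b -> (2 * n%:R + b)^-1 @[n --> \oo] --> (0 : R).
Proof.
move=> b1; apply: (@squeeze_cvgr _ _ _ _ (fun=> 0) (@harmonic R)).
- apply: nearW => n; have n0 := ler0n R n.
  rewrite invr_ge0; apply/andP; split; first by lra.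
  by rewrite /harmonic lef_pV2 ?posrE -?natr1; lra.
- exact: cvg_cst.
- exact: cvg_harmonic.
Qed.

Lemma cvg_ratio (a b : R) : 1 <= b ->
  (n%:R + a) / (2 * n%:R + b) @[n --> \oo] --> (1 / 2 : R).
Proof.
move=> b1.
have -> : (fun n : nat => (n%:R + a) / (2 * n%:R + b)) =
    fun n => 1 / 2 + (a - b / 2) * (2 * n%:R + b)^-1.
  apply/funext => n; have n0 := ler0n R n; field; lra.
rewrite -[X in _ --> X]addr0; apply: cvgD; first exact: cvg_cst.
rewrite -[X in _ --> X](mulr0 (a - b / 2)); apply: cvgM; first exact: cvg_cst.
exact: cvg_inv2n.
Qed.

(** The mean of [x^k T_m] under the arcsine law, with [T_m] the Chebyshev polynomial. *)
Definition arc_moment k m : R := pi^-1 * II (fun x => x ^+ k * cos (m%:R * acos x) / sx x).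

Lemma bm_cos_mul m : bm (fun x => cos (m%:R * acos x)).
Proof. by have := bm_cos (m%:R : R) 0; under eq_fun do rewrite addr0. Qed.

Lemma bm_arc k m : bm (fun x => x ^+ k * cos (m%:R * acos x)).
Proof. by apply: bmM; [apply: bmX; exact: bm_id|exact: bm_cos_mul]. Qed.

Lemma arc_moment0 k : arc_moment k.+1 0 = arc_moment k 1.
Proof.
congr (_ * _); apply: eq_Rintegral => x; rewrite inE /= in_itv /= => x1.
by rewrite mul0r cos0 mul1r cos_acos// mulr1 exprSr.
Qed.

Lemma arc_momentS k m :
  arc_moment k.+1 m.+1 = 1 / 2 * arc_moment k m.+2 + 1 / 2 * arc_moment k m.
Proof.
rewrite /arc_moment !(mulrCA _ pi^-1) -mulrDr; congr (_ * _).
have ib j : mu.-integrable `[-1, 1] (EFin \o (fun x => x ^+ k * cos (j%:R * acos x) / sx x)).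
  exact: bm_inv_sx_integrable (bm_arc k j).
rewrite -!RintegralZl// -RintegralD//; last 2 first.
- under [X in _ \o X]eq_fun do rewrite mulrA.
  exact: bm_inv_sx_integrable (bmM (bm_cst (1 / 2)) (bm_arc k m.+2)).
- under [X in _ \o X]eq_fun do rewrite mulrA.
  exact: bm_inv_sx_integrable (bmM (bm_cst (1 / 2)) (bm_arc k m)).
apply: eq_Rintegral => x; rewrite inE /= in_itv /= => x1.
have -> : m.+2%:R * acos x = m.+1%:R * acos x + acos x.
  by rewrite -[m.+2%:R]natr1; ring.
have -> : m%:R * acos x = m.+1%:R * acos x - acos x.
  by rewrite -[m.+1%:R]natr1; ring.
by rewrite cosD cosB cos_acos// exprSr; move: (sx x)^-1 => v; field.
Qed.

Lemma arc_moment00 : arc_moment 0 0 = 1.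
Proof.
rewrite /arc_moment.
have -> : II (fun x => x ^+ 0 * cos (0%:R * acos x) / sx x) = pi :> R; last first.
  by rewrite mulVf// gt_eqF// pi_gt0.
rewrite -integral_inv_sx; apply: eq_Rintegral => x _.
by rewrite mul0r cos0 expr0 !mul1r.
Qed.

Lemma II_cos_mul_inv_sx m : (0 < m)%N -> II (fun x => cos (m%:R * acos x) / sx x) = 0.
Proof.
move=> m0; have mR : m%:R != 0 :> R by rewrite pnatr_eq0 -lt0n.
pose F x := - m%:R^-1 * sin (m%:R * acos x).
have N11 : (-1 : R) < 1 by lra.
have fi := bm_inv_sx_integrable (bm_cos_mul m).
have cF : {within `[-1, 1], continuous F}.
  move=> x; apply: cvgM; first exact: cvg_cst.
  apply: continuous_comp; last exact: continuous_sin.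
  by apply: cvgM; [exact: cvg_cst|exact: within_continuous_acos].
rewrite (@FTC2_integrable R _ F (-1) 1 N11 fi cF).
- rewrite /F acos1 mulr0 sin0 mulr0 acosN1 sub0r.
  suff -> : sin (m%:R * pi) = 0 :> R by rewrite mulr0 oppr0.
  elim: (m) => [|j IH]; first by rewrite mul0r sin0.
  by rewrite -natr1 mulrDl mul1r sinDpi IH oppr0.
- move=> x; rewrite in_itv /= => x1.
  have s0 : sx x != 0 by rewrite gt_eqF ?sx_gt0.
  apply: cvgM; last by apply: cvgV => //; exact: continuous_sx.
  apply: continuous_comp; last exact: continuous_cos.
  by apply: cvgM; [exact: cvg_cst|exact: continuous_acos].
- move=> x; rewrite in_itv /= => x1.
  have s0 : sx x != 0 by rewrite gt_eqF ?sx_gt0.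
  apply: der_eq.
    apply: derM; first exact: derC.
    apply: der_sin; apply: derM; first exact: derC.
    by apply: (der_acos x1); exact: derI.
  by rewrite -/(sx x) /=; field; rewrite mR s0.
Qed.

Lemma arc_moment0S m : arc_moment 0 m.+1 = 0.
Proof.
rewrite /arc_moment.
have -> : II (fun x => x ^+ 0 * cos (m.+1%:R * acos x) / sx x) = 0 :> R; last first.
  by rewrite mulr0.
rewrite -(@II_cos_mul_inv_sx m.+1)//; apply: eq_Rintegral => x _.
by rewrite expr0 mul1r.
Qed.

(* The factor [n + 1] rather than [n] keeps [leg_momentS0] free of division by [n]. *)
Definition leg_moment k m n : R := (n%:R + 1) * intp ('X^k * P n * P (n + m)%N).

Lemma intp_mulX_legendre n q : intp ((2 * n%:R + 3)%:P * ('X * P n.+1) * q) =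
  (n%:R + 2) * intp (P n.+2 * q) + (n%:R + 1) * intp (P n * q).
Proof. by rewrite mulX_legendre mulrDl intpD -!mulrA !intpZ. Qed.

Lemma leg_momentSS k m n : leg_moment k.+1 m.+1 n =
  (n%:R + (m%:R + 2)) / (2 * n%:R + (2 * m%:R + 3)) * leg_moment k m.+2 n +
  (n%:R + (m%:R + 1)) / (2 * n%:R + (2 * m%:R + 3)) * leg_moment k m n.
Proof.
have n0 := ler0n R n; have m0 := ler0n R m.
have a0 : 2 * n%:R + (2 * m%:R + 3) != 0 :> R by lra.
apply: (mulfI a0); rewrite /leg_moment !addnS.
have -> : (2 * n%:R + (2 * m%:R + 3)) * ((n%:R + 1) *
    intp ('X^(k.+1) * P n * P (n + m).+1)) =
    (n%:R + 1) * intp ((2 * (n + m)%:R + 3)%:P * ('X * P (n + m).+1) * ('X^k * P n)).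
  rewrite -[_%:P * _ * _]mulrA intpZ mulrCA natrD; congr (_ * (_ * intp _)); first ring.
  by rewrite exprS; ring.
rewrite intp_mulX_legendre natrD.
rewrite ![_ * ('X^k * P n)]mulrC !mulrA; field; lra.
Qed.

(** For [m = 0] the lower neighbour [P_n] falls below the first index [n + 1]; exchanging the two
    factors turns it into [leg_moment k 1] at [n], whence the shift. In the limit both terms merge,
    as in [arc_moment0]. *)
Lemma leg_momentS0 k n : leg_moment k.+1 0 n.+1 =
  (n%:R + 2) / (2 * n%:R + 3) * leg_moment k 1 n.+1 +
  (n%:R + 2) / (2 * n%:R + 3) * leg_moment k 1 n.
Proof.
have n0 := ler0n R n.
have a0 : 2 * n%:R + 3 != 0 :> R by lra.
apply: (mulfI a0); rewrite /leg_moment addn0 !addn1 -[n.+1%:R]natr1.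
have -> : (2 * n%:R + 3) * ((n%:R + 1 + 1) *
    intp ('X^(k.+1) * P n.+1 * P n.+1)) =
    (n%:R + 2) * intp ((2 * n%:R + 3)%:P * ('X * P n.+1) * ('X^k * P n.+1)).
  rewrite -[_%:P * _ * _]mulrA intpZ mulrCA; congr (_ * (_ * intp _)); first ring.
  by rewrite exprS; ring.
rewrite intp_mulX_legendre.
have -> : P n.+2 * ('X^k * P n.+1) = 'X^k * (P n.+1 * P n.+2) by ring.
have -> : P n * ('X^k * P n.+1) = 'X^k * (P n * P n.+1) by ring.
rewrite -!mulrA; field; lra.
Qed.

(** The case [m = 0] gives the moments of the squares; general [m] closes the induction on [k],
    because multiplication by [x] moves the second index. *)
Lemma cvg_leg_moment k m : leg_moment k m n @[n --> \oo] --> arc_moment k m.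
Proof.
have m0 := ler0n R m.
elim: k m {m0} => [|k IH] m; have m0 := ler0n R m.
  rewrite /leg_moment; case: m {m0} => [|m].
    rewrite arc_moment00.
    have -> : (fun n : nat => (n%:R + 1) * intp ('X^0 * P n * P (n + 0)%N)) =
        fun n => 2 * ((n%:R + 1) / (2 * n%:R + 1)).
      by apply/funext => n; rewrite expr0 mul1r addn0 legendre_norm; ring.
    have E : 2 * (1 / 2) = 1 :> R by field.
    rewrite -[X in _ --> X]E.
    by apply: cvgM; [exact: cvg_cst|exact: cvg_ratio].
  rewrite arc_moment0S.
  have -> : (fun n : nat => (n%:R + 1) * intp ('X^0 * P n * P (n + m.+1)%N)) = fun=> 0.
    apply/funext => n; rewrite expr0 mul1r legendre_orthogonal ?mulr0//; lia.
  exact: cvg_cst.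
case: m m0 => [|m] m0.
  rewrite arc_moment0 -cvg_shiftS.
  under eq_fun do rewrite leg_momentS0.
  have -> : arc_moment k 1 = 1 / 2 * arc_moment k 1 + 1 / 2 * arc_moment k 1 by field.
  have r : (n%:R + 2) / (2 * n%:R + 3) @[n --> \oo] --> (1 / 2 : R) by apply: cvg_ratio; lra.
  apply: cvgD; apply: cvgM => //.
  by rewrite (cvg_shiftS (leg_moment k 1)).
rewrite arc_momentS; under eq_fun do rewrite leg_momentSS.
have m1 := ler0n R m.
by apply: cvgD; apply: cvgM; try exact: IH; apply: cvg_ratio; lra.
Qed.

Definition legendre_mean n (f : R -> R) : R :=
  (n%:R + 1) * II (fun x => f x * (P n).[x] ^+ 2).

Definition arc_mean (f : R -> R) : R := pi^-1 * II (fun x => f x / sx x).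

Lemma bm_legendre2 n : bm (fun x => (P n).[x] ^+ 2).
Proof. by apply: bmX; exact: bm_horner. Qed.

Lemma legendre_meanD n f g : bm f -> bm g ->
  legendre_mean n (fun x => f x + g x) = legendre_mean n f + legendre_mean n g.
Proof.
move=> bf bg; rewrite /legendre_mean -mulrDr -bm_intD; last 2 first.
- exact: (bmM bf (bm_legendre2 n)).
- exact: (bmM bg (bm_legendre2 n)).
by congr (_ * _); apply: eq_Rintegral => x _; rewrite mulrDl.
Qed.

Lemma legendre_meanZ n c f : bm f ->
  legendre_mean n (fun x => c * f x) = c * legendre_mean n f.
Proof.
move=> bf; rewrite /legendre_mean mulrCA -(bm_intZ c); last first.
  exact: (bmM bf (bm_legendre2 n)).
by congr (_ * _); apply: eq_Rintegral => x _; rewrite mulrA.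
Qed.

Lemma arc_meanD f g : bm f -> bm g ->
  arc_mean (fun x => f x + g x) = arc_mean f + arc_mean g.
Proof.
move=> bf bg; rewrite /arc_mean -mulrDr -RintegralD//; last 2 first.
- exact: bm_inv_sx_integrable.
- exact: bm_inv_sx_integrable.
by congr (_ * _); apply: eq_Rintegral => x _; rewrite mulrDl.
Qed.

Lemma arc_meanZ c f : bm f -> arc_mean (fun x => c * f x) = c * arc_mean f.
Proof.
move=> bf; rewrite /arc_mean mulrCA; congr (_ * _).
rewrite -RintegralZl//; last exact: bm_inv_sx_integrable.
by apply: eq_Rintegral => x _; rewrite mulrA.
Qed.

Lemma arc_mean_le f c : bm f -> (forall x, -1 <= x <= 1 -> `|f x| <= c) ->
  `|arc_mean f| <= c.
Proof.
move=> bf fc; have p0 := pi_gt0 R.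
have pV : 0 <= pi^-1 :> R by rewrite invr_ge0 ltW.
rewrite /arc_mean normrM (ger0_norm pV) ler_pdivrMl//.
apply: le_trans (le_normr_Rintegral _ (bm_inv_sx_integrable bf)) _ => //.
have i1 : mu.-integrable `[-1, 1] (EFin \o (fun x => c / sx x)).
  exact: (bm_inv_sx_integrable (bm_cst c)).
have <- : II (fun x => c / sx x) = pi * c.
  rewrite RintegralZl//; last exact: integrable_inv_sx.
  by rewrite integral_inv_sx mulrC.
apply: le_Rintegral => //.
  by apply: integrable_norm => //; exact: bm_inv_sx_integrable.
move=> x /=; rewrite in_itv /= => x1.
by rewrite normrM [X in _ * X]ger0_norm ?ler_wpM2r ?invr_ge0 ?sx_ge0 ?fc.
Qed.

(** The bound is uniform in [n], since the total mass [(n + 1) * 2 / (2 n + 1)] never exceeds 2;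
    this lets the limit pass from polynomials to continuous functions. *)
Lemma legendre_mean_le n f c : bm f -> (forall x, -1 <= x <= 1 -> `|f x| <= c) ->
  `|legendre_mean n f| <= 2 * c.
Proof.
move=> bf fc; have n0 := ler0n R n.
have c0 : 0 <= c by apply: le_trans (fc 0 _); rewrite ?normr_ge0//; lra.
have bP := bm_legendre2 n.
have bfP : bm (fun x => f x * (P n).[x] ^+ 2) by exact: (bmM bf bP).
have N : II (fun x => (P n).[x] ^+ 2) = 2 / (2 * n%:R + 1).
  by rewrite -legendre_norm; apply: eq_Rintegral => x _; rewrite hornerM.
rewrite /legendre_mean normrM ger0_norm; last lra.
have h : `|II (fun x => f x * (P n).[x] ^+ 2)| <= c * (2 / (2 * n%:R + 1)).
  apply: le_trans (le_normr_Rintegral _ (bm_integrable bfP)) _ => //.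
  rewrite -N -bm_intZ//; apply: le_Rintegral => //.
  - by apply: integrable_norm => //; exact: bm_integrable.
  - exact: bm_integrable (bmM (bm_cst c) bP).
  move=> x /=; rewrite in_itv /= => x1.
  by rewrite normrM [X in _ * X]ger0_norm ?sqr_ge0// ler_wpM2r ?sqr_ge0 ?fc.
have n1 : 0 <= n%:R + 1 :> R by lra.
apply: le_trans (ler_wpM2l n1 h) _.
have -> : (n%:R + 1) * (c * (2 / (2 * n%:R + 1))) =
  2 * c * ((n%:R + 1) / (2 * n%:R + 1)) by ring.
rewrite ler_piMr//; first by lra.
by rewrite ler_pdivrMr; lra.
Qed.

Lemma cvg_legendre_mean_monom k :
  legendre_mean n (fun x => x ^+ k) @[n --> \oo] --> arc_mean (fun x => x ^+ k).
Proof.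
have -> : arc_mean (fun x => x ^+ k) = arc_moment k 0.
  by congr (_ * _); apply: eq_Rintegral => x _; rewrite mul0r cos0 mulr1.
suff -> : (fun n => legendre_mean n (fun x => x ^+ k)) = leg_moment k 0.
  exact: cvg_leg_moment.
apply/funext => n; congr (_ * _); apply: eq_Rintegral => x _.
by rewrite addn0 !hornerM hornerXn expr2 mulrA.
Qed.

Lemma cvg_legendre_mean_poly p :
  legendre_mean n (horner p) @[n --> \oo] --> arc_mean (horner p).
Proof.
pose h (s : nat) x := \sum_(k < s) p`_k * x ^+ k.
have bh s : bm (h s).
  by apply: bm_sum => k; apply: bmM; [exact: bm_cst|apply: bmX; exact: bm_id].
have -> : horner p = h (size p) by apply/funext => x; rewrite horner_coef.
elim: (size p) => [|s IH].
  have -> : h 0 = fun x => 0 * x ^+ 0 by apply/funext => x; rewrite /h big_ord0 mul0r.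
  have b1 : bm (fun x : R => x ^+ 0) by exact: bm_cst.
  rewrite arc_meanZ// mul0r.
  under eq_fun do rewrite legendre_meanZ// mul0r.
  exact: cvg_cst.
have bs : bm (fun x : R => x ^+ s) by apply: bmX; exact: bm_id.
have bps : bm (fun x => p`_s * x ^+ s) by apply: bmM => //; exact: bm_cst.
have -> : h s.+1 = fun x => h s x + p`_s * x ^+ s.
  by apply/funext => x; rewrite /h big_ord_recr.
rewrite arc_meanD// arc_meanZ//.
under eq_fun do rewrite legendre_meanD// legendre_meanZ//.
apply: cvgD; first exact: IH.
by apply: cvgM; [exact: cvg_cst|exact: cvg_legendre_mean_monom].
Qed.

Lemma cvg_legendre_mean (f : R -> R) : {within `[-1, 1], continuous f} ->
  legendre_mean n f @[n --> \oo] --> arc_mean f.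
Proof.
move=> cf; have bf := bm_continuous cf.
apply/cvgrPdist_le => e e0.
(* The polynomial limit costs [e / 4], and the approximation error costs [e / 4] under [arc_mean]
   and [e / 2] under [legendre_mean]. *)
have e4 : 0 < e / 4 by lra.
have [p fp] := weierstrass e4 cf.
have bp : bm (horner p) := bm_horner p.
have bd : bm (fun x => f x - p.[x]) by exact: bmB.
have E x : f x = p.[x] + (f x - p.[x]) by ring.
have /cvgrPdist_le/(_ _ e4) := @cvg_legendre_mean_poly p.
apply: filterS => n hn.
rewrite (funext E) arc_meanD// legendre_meanD//.
have := legendre_mean_le n bd fp; have := arc_mean_le bd fp.
move: hn; rewrite !ler_norml => /andP[? ?] /andP[? ?] /andP[? ?].
by apply/andP; split; lra.
Qed.

End legendre_weak_limit.

(** * Wallis integrals and Landau's constants *)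

Section wallis.
Variable R : realType.
Local Notation mu := (@lebesgue_measure R).
Implicit Types (x y : R) (n k m : nat) (f g : R -> R).

Notation JJ f := (\int[lebesgue_measure]_(x in `[0, pi / 2]) f x).

Let pi2_gt0 : 0 < pi / 2 :> R.
Proof. by have := pi_gt0 R; lra. Qed.

Lemma continuous_quarter_integrable f : {within `[0, pi / 2], continuous f} ->
  mu.-integrable `[0, pi / 2] (EFin \o f).
Proof. by move=> cf; apply: continuous_compact_integrable => //; exact: segment_compact. Qed.

Lemma FTC2_quarter f F : continuous f -> (forall x, hasder F x (f x)) ->
  JJ f = F (pi / 2) - F 0.
Proof.
move=> cf dF; apply: FTC2_integrable => //.
- exact/continuous_quarter_integrable/continuous_subspaceT.
- by apply: continuous_subspaceT => x; exact: der_continuous (dF x).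
- by move=> x _; exact: cf.
Qed.

Lemma continuous_sinX m : continuous (fun x : R => sin x ^+ m).
Proof.
move=> x; apply: (@continuous_comp _ _ _ sin (fun y : R => y ^+ m)).
  exact: continuous_sin.
exact: exprn_continuous.
Qed.

Definition wallis m : R := JJ (fun x => sin x ^+ m).

Lemma integrable_sinX m : mu.-integrable `[0, pi / 2] (EFin \o (fun x => sin x ^+ m)).
Proof.
exact/continuous_quarter_integrable/continuous_subspaceT/continuous_sinX.
Qed.

Lemma quarter_sin_ge0 x : 0 <= x <= pi / 2 -> 0 <= sin x.
Proof. by move=> /andP[h1 h2]; apply: sin_ge0_pi; have := pi_gt0 R; lra. Qed.

Lemma quarter_cos_ge0 x : 0 <= x <= pi / 2 -> 0 <= cos x.
Proof. by move=> /andP[h1 h2]; apply: cos_ge0_pihalf; have := pi_gt0 R; lra. Qed.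

Lemma wallis0 : wallis 0 = pi / 2.
Proof.
rewrite /wallis (@FTC2_quarter _ (fun x => x)) ?subr0//.
- exact: continuous_sinX.
- by move=> x; rewrite expr0; exact: derI.
Qed.

Lemma wallis1 : wallis 1 = 1.
Proof.
rewrite /wallis (@FTC2_quarter _ (fun x => - cos x)).
- by rewrite cos_pihalf cos0 oppr0 sub0r opprK.
- exact: continuous_sinX.
- move=> x; apply: der_eq; first by der.
  by rewrite /= expr1; ring.
Qed.

Lemma wallisSS m : (m%:R + 2) * wallis m.+2 = (m%:R + 1) * wallis m.
Proof.
have E : JJ (fun x => (m%:R + 2) * sin x ^+ m.+2 - (m%:R + 1) * sin x ^+ m) = 0.
  rewrite (@FTC2_quarter _ (fun x => - (cos x * sin x ^+ m.+1))).
  - by rewrite cos_pihalf sin0 expr0n /= mul0r mulr0 subrr.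
  - move=> x; apply: cvgB; apply: cvgM; try exact: cvg_cst; exact: continuous_sinX.
  - move=> x; apply: der_eq; first by der.
    have h : cos x ^+ 2 = 1 - sin x ^+ 2 by have := cos2Dsin2 x; lra.
    rewrite /= mulr1 -[m.+1%:R]natr1.
    transitivity ((m%:R + 1) * (- cos x ^+ 2) * sin x ^+ m + sin x * sin x ^+ m.+1).
      by ring.
    by rewrite h !exprS; ring.
have i1 c k : mu.-integrable `[0, pi / 2] (EFin \o (fun x => c * sin x ^+ k)).
  apply/continuous_quarter_integrable/continuous_subspaceT => x.
  by apply: cvgM; [exact: cvg_cst|exact: continuous_sinX].
move: E; rewrite RintegralB// !RintegralZl//; try exact: integrable_sinX.
by move/eqP; rewrite subr_eq0 => /eqP.
Qed.

Lemma le_wallis m : wallis m.+1 <= wallis m.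
Proof.
apply: le_Rintegral => //; try exact: integrable_sinX.
move=> x /=; rewrite in_itv /= => x1; rewrite exprS.
by rewrite ler_piMl ?exprn_ge0 ?quarter_sin_ge0 ?sin_le1.
Qed.

(* [cbin k] = binomial(2k, k) / 4^k. *)
Fixpoint cbin k : R :=
  if k is k'.+1 then cbin k' * ((2 * k'%:R + 1) / (2 * k'%:R + 2)) else 1.

Lemma cbin_wallis k : cbin k = 2 / pi * wallis (2 * k).
Proof.
have p0 : pi != 0 :> R by rewrite gt_eqF// pi_gt0.
elim: k => [|k IH]; first by rewrite muln0 wallis0 /=; move: (pi) p0 => q q0; field.
have k0 := ler0n R k.
have -> : (2 * k.+1 = (2 * k).+2)%N by lia.
have := wallisSS (2 * k); rewrite /= IH natrM => h.
have -> : wallis (2 * k).+2 = (2 * k%:R + 1) * wallis (2 * k) / (2 * k%:R + 2).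
  by rewrite -h; field; lra.
by ring.
Qed.

Lemma wallis_gt0 m : 0 < wallis m.
Proof.
have h : 0 < wallis m /\ 0 < wallis m.+1; last exact: h.1.
elim: m => [|m [IH1 IH2]]; first by rewrite wallis0 wallis1; split => //; lra.
split => //; have m0 := ler0n R m.
have : 0 < (m%:R + 2) * wallis m.+2 by rewrite wallisSS mulr_gt0//; lra.
by rewrite pmulr_rgt0//; lra.
Qed.

Lemma wallis_mul m : (m%:R + 1) * (wallis m * wallis m.+1) = pi / 2.
Proof.
elim: m => [|m IH]; first by rewrite wallis0 wallis1; lra.
by rewrite -[m.+1%:R]natr1 -IH mulrCA -addrA (wallisSS m); ring.
Qed.

Lemma cbin_mul_wallis k : cbin k * wallis (2 * k).+1 = (2 * k%:R + 1)^-1.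
Proof.
have p0 : pi != 0 :> R by rewrite gt_eqF// pi_gt0.
have k0 := ler0n R k; have n0 : 2 * k%:R + 1 != 0 :> R by lra.
apply: (mulfI n0); rewrite mulfV// cbin_wallis.
have := wallis_mul (2 * k); rewrite natrM => h.
transitivity (2 / pi * ((2 * k%:R + 1) * (wallis (2 * k) * wallis (2 * k).+1))).
  by ring.
by rewrite h; move: (pi) p0 => q q0; field.
Qed.

Lemma cbin_gt0 k : 0 < cbin k.
Proof.
rewrite cbin_wallis mulr_gt0 ?wallis_gt0// divr_gt0//; exact: pi_gt0.
Qed.

(** One factor [cbin k] is a multiple of an even Wallis integral; replacing it by the next odd one,
    which is smaller, makes the product explicit. [cbin2_le] uses the preceding odd one, which is
    larger. *)
Lemma cbin2_ge k : 2 / pi * (2 * k%:R + 1)^-1 <= cbin k ^+ 2.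
Proof.
have p2 : 0 <= 2 / pi :> R by rewrite divr_ge0// pi_ge0.
rewrite -cbin_mul_wallis mulrCA expr2 ler_pM2l ?cbin_gt0//.
by rewrite cbin_wallis ler_wpM2l// le_wallis.
Qed.

Lemma cbin2_le k : k%:R * cbin k ^+ 2 <= pi^-1.
Proof.
have p0 : 0 < pi :> R by exact: pi_gt0.
case: k => [|k]; first by rewrite mul0r invr_ge0 ltW.
have k0 := ler0n R k.
have E : k.+1%:R * (cbin k.+1 * wallis (2 * k).+1) = 1 / 2.
  have := cbin_mul_wallis k; rewrite -[k.+1%:R]natr1 /= => h.
  rewrite mulrAC h; field; lra.
have h2 : cbin k.+1 ^+ 2 <= cbin k.+1 * (2 / pi * wallis (2 * k).+1).
  rewrite expr2 ler_pM2l ?cbin_gt0// cbin_wallis ler_pM2l ?divr_gt0//.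
  have -> : (2 * k.+1 = (2 * k).+2)%N by lia.
  exact: le_wallis.
apply: le_trans (ler_wpM2l (ler0n _ _) h2) _.
have -> : k.+1%:R * (cbin k.+1 * (2 / pi * wallis (2 * k).+1)) =
  2 / pi * (k.+1%:R * (cbin k.+1 * wallis (2 * k).+1)) by ring.
by rewrite E; move: (pi) p0 => q q0; rewrite le_eqVlt; apply/orP; left; apply/eqP; field; lra.
Qed.

(** Landau's constants minus an odd harmonic sum that carries their divergence; what remains
    converges. *)
Definition landau_sum n := \sum_(k < n.+1) (cbin k ^+ 2 - 2 / pi * (2 * k%:R + 1)^-1).

(* Partial sum of the binomial series of [1 / cos x] in powers of [sin x ^+ 2]. *)
Definition sinseries n x := \sum_(k < n.+1) cbin k * sin x ^+ (2 * k).

Lemma continuous_sinseries n : continuous (sinseries n).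
Proof.
elim: n => [|n IH].
  have -> : sinseries 0 = fun=> 1.
    by apply/funext => x; rewrite /sinseries big_ord_recl big_ord0 addr0 mul1r.
  exact: cst_continuous.
have -> : sinseries n.+1 = fun x => sinseries n x + cbin n.+1 * sin x ^+ (2 * n.+1).
  by apply/funext => x; rewrite /sinseries big_ord_recr.
move=> x; apply: cvgD; first exact: IH.
by apply: cvgM; [exact: cvg_cst|exact: continuous_sinX].
Qed.

(** Each summand is [2 / pi * cbin k] times the difference of the Wallis integrals of orders [2 k]
    and [2 k + 1]. As [sinseries] approximates [1 / cos x], the integrand approaches
    [cos x / (1 + sin x)], of integral [ln 2]. *)
Lemma landau_sumE n : landau_sum n = 2 / pi * JJ (fun x => sinseries n x * (1 - sin x)).
Proof.
elim: n => [|n IH].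
  rewrite /landau_sum big_ord_recl big_ord0 addr0.
  have -> : JJ (fun x => sinseries 0 x * (1 - sin x)) = wallis 0 - wallis 1.
    rewrite /wallis -RintegralB//; try exact: integrable_sinX.
    apply: eq_Rintegral => x _.
    by rewrite /sinseries big_ord_recl big_ord0 addr0 !mul1r expr0 expr1.
  have p0 : pi != 0 :> R by rewrite gt_eqF// pi_gt0.
  by rewrite wallis0 wallis1 /=; move: (pi) p0 => q q0; field.
have ci m : continuous (fun x : R => sin x ^+ m * (1 - sin x)).
  move=> x; apply: cvgM; first exact: continuous_sinX.
  by apply: cvgB; [exact: cvg_cst|exact: continuous_sin].
have cs m : continuous (fun x : R => sinseries m x * (1 - sin x)).
  move=> x; apply: cvgM; first exact: continuous_sinseries.
  by apply: cvgB; [exact: cvg_cst|exact: continuous_sin].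
have ii (f : R -> R) : continuous f -> mu.-integrable `[0, pi / 2] (EFin \o f).
  by move=> cf; exact/continuous_quarter_integrable/continuous_subspaceT.
have -> : JJ (fun x => sinseries n.+1 x * (1 - sin x)) =
    JJ (fun x => sinseries n x * (1 - sin x)) +
    cbin n.+1 * (wallis (2 * n.+1) - wallis (2 * n.+1).+1).
  rewrite /wallis -RintegralB//; try exact: integrable_sinX.
  rewrite -RintegralZl//; last first.
    apply: ii => x; apply: cvgB; exact: continuous_sinX.
  rewrite -RintegralD//; last 2 first.
  - exact: ii (cs n).
  - apply: ii => x; apply: cvgM; first exact: cvg_cst.
    by apply: cvgB; exact: continuous_sinX.
  apply: eq_Rintegral => x _.
  by rewrite /sinseries [in LHS]big_ord_recr /= exprS; ring.
rewrite mulrDr -IH /landau_sum [in LHS]big_ord_recr; congr (_ + _).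
transitivity (cbin n.+1 ^+ 2 - 2 / pi * (2 * n.+1%:R + 1)^-1); first by [].
rewrite -cbin_mul_wallis expr2 {2}cbin_wallis; ring.
Qed.

(** The derivative telescopes to a single monomial. Its sign controls the truncation error without
    any convergence theory for the series. *)
Lemma der_sinseries n x : hasder (fun y => 1 - cos y * sinseries n y) x
  ((2 * n%:R + 1) * cbin n * sin x ^+ (2 * n).+1).
Proof.
elim: n => [|n IH].
  have -> : (fun y => 1 - cos y * sinseries 0 y) = fun y => 1 - cos y.
    by apply/funext => y; rewrite /sinseries big_ord_recl big_ord0 addr0 mul1r mulr1.
  by apply: der_eq; [der|rewrite /= expr1; ring].
have -> : (fun y => 1 - cos y * sinseries n.+1 y) =
    fun y => (1 - cos y * sinseries n y) - cos y * (cbin n.+1 * sin y ^+ (2 * n).+2).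
  apply/funext => y; rewrite /sinseries [in LHS]big_ord_recr /=.
  by have -> : (2 * n.+1 = (2 * n).+2)%N by [lia]; ring.
apply: der_eq.
  apply: derD; first exact: IH.
  apply: derN; apply: derM; first by der.
  by apply: derM; [exact: derC|apply: derX; der].
have h : cos x ^+ 2 = 1 - sin x ^+ 2 by have := cos2Dsin2 x; lra.
have n0 := ler0n R n.
have -> : (2 * n.+1 = (2 * n).+2)%N by lia.
have -> : (2 * n).+2%:R = 2 * n%:R + 2 :> R by rewrite -!natr1 natrM; ring.
rewrite /= !mulr1 mulr0 addr0 -[n.+1%:R]natr1.
transitivity ((2 * n%:R + 1) * cbin n * sin x ^+ (2 * n).+1 -
  cbin n * ((2 * n%:R + 1) / (2 * n%:R + 2)) *
   ((2 * n%:R + 2) * sin x ^+ (2 * n).+1 * cos x ^+ 2 - sin x * sin x ^+ (2 * n).+2)).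
  by ring.
by rewrite h !exprS; field; lra.
Qed.

Lemma sinseries_at0 n : sinseries n 0 = 1.
Proof.
rewrite /sinseries big_ord_recl big1 /= ?addr0 ?mul1r ?muln0// => k _.
by rewrite sin0 expr0n mulr0.
Qed.

Lemma sinseries_defect_ge0 n x : 0 <= x <= pi / 2 -> 0 <= 1 - cos x * sinseries n x.
Proof.
move=> /andP[x0 x1].
have <- : 1 - cos 0 * sinseries n 0 = 0 by rewrite cos0 sinseries_at0 mul1r subrr.
have du y := der_sinseries n y.
apply: (ge0_derive_le x0 _ _ (fun y _ => du y)).
  by apply: continuous_subspaceT => y; exact: der_continuous (du y).
move=> y; rewrite in_itv /= => /andP[y0 y1].
have n0 := ler0n R n.
have s0 : 0 <= sin y by apply: quarter_sin_ge0; lra.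
by rewrite !mulr_ge0 ?exprn_ge0 ?(ltW (cbin_gt0 _))//; lra.
Qed.

(** The primitive, defect times [sin x], increases by exactly 1, so the integral is
    [1 - c * wallis (2 * n).+2]. The subtracted term is at least [(2 n + 1) / (2 n + 2)], because
    [c * wallis (2 * n).+1 = 1]. *)
Let defect_integral n : JJ (fun x => (1 - cos x * sinseries n x) * cos x) <= (2 * n%:R + 2)^-1.
Proof.
have n0 := ler0n R n.
pose c := (2 * n%:R + 1) * cbin n.
have cu : continuous (fun x => (1 - cos x * sinseries n x) * cos x).
  move=> x; apply: cvgM; last exact: continuous_cos.
  exact: der_continuous (der_sinseries n x).
have cS : continuous (fun x : R => c * sin x ^+ (2 * n).+2).
  by move=> x; apply: cvgM; [exact: cvg_cst|exact: continuous_sinX].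
have E : JJ (fun x => (1 - cos x * sinseries n x) * cos x + c * sin x ^+ (2 * n).+2) = 1.
  rewrite (@FTC2_quarter _ (fun x => (1 - cos x * sinseries n x) * sin x)).
  - by rewrite sin0 mulr0 subr0 cos_pihalf sin_pihalf mul0r subr0 mulr1.
  - by move=> x; apply: cvgD; [exact: cu|exact: cS].
  - move=> x; apply: der_eq; first by apply: derM; [exact: der_sinseries|der].
    by rewrite /= [in RHS]exprS /c; ring.
have iu : mu.-integrable `[0, pi / 2]
    (EFin \o (fun x => (1 - cos x * sinseries n x) * cos x)).
  exact/continuous_quarter_integrable/continuous_subspaceT.
have iS : mu.-integrable `[0, pi / 2] (EFin \o (fun x => c * sin x ^+ (2 * n).+2)).
  exact/continuous_quarter_integrable/continuous_subspaceT.
move: E; rewrite RintegralD// RintegralZl//; last exact: integrable_sinX.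
rewrite -/(wallis _) => E.
have w : 1 - (2 * n%:R + 2)^-1 <= c * wallis (2 * n).+2.
  have -> : wallis (2 * n).+2 = (2 * n%:R + 1) * wallis (2 * n) / (2 * n%:R + 2).
    have := wallisSS (2 * n); rewrite natrM => <-; field; lra.
  have -> : 1 - (2 * n%:R + 2)^-1 = (2 * n%:R + 1) / (2 * n%:R + 2) * (c * wallis (2 * n).+1).
    by rewrite /c -[_ * cbin n * _]mulrA cbin_mul_wallis; field; lra.
  have -> : c * ((2 * n%:R + 1) * wallis (2 * n) / (2 * n%:R + 2)) =
     (2 * n%:R + 1) / (2 * n%:R + 2) * (c * wallis (2 * n)) by ring.
  apply: ler_wpM2l; first by rewrite divr_ge0//; lra.
  apply: ler_wpM2l; last exact: le_wallis.
  by rewrite mulr_ge0 ?(ltW (cbin_gt0 _))//; lra.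
move: E w; set I := Rintegral _ _ _; set J := c * _; lra.
Qed.

(** The error is the integral of the nonnegative defect [u] against [cos x / (1 + sin x)], which is
    at most [cos x], so [defect_integral] applies. *)
Lemma landau_sum_bounds n :
  2 / pi * (ln 2 - (2 * n%:R + 2)^-1) <= landau_sum n <= 2 / pi * ln 2.
Proof.
have p2 : 0 <= 2 / pi :> R by rewrite divr_ge0// pi_ge0.
pose u x := 1 - cos x * sinseries n x.
have cu : continuous u by move=> x; exact: der_continuous (der_sinseries n x).
pose r x : R := cos x / (1 + sin x).
have s1 x : 0 <= x <= pi / 2 -> 0 < 1 + sin x by move=> /quarter_sin_ge0; lra.
have cr : {within `[0, pi / 2], continuous r}.
  apply: continuous_in_subspaceT => x; rewrite inE /= in_itv /= => x01.
  apply: cvgM; first exact: continuous_cos.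
  apply: cvgV; first by rewrite gt_eqF ?s1.
  by apply: cvgD; [exact: cvg_cst|exact: continuous_sin].
have ir := continuous_quarter_integrable cr.
have dl x : 0 <= x <= pi / 2 -> hasder (fun x => ln (1 + sin x)) x (r x).
  move=> x01; apply: der_eq; first by apply: der_ln; [exact: s1|der].
  by rewrite /r /=; ring.
have Ir : JJ r = ln 2.
  have pp : (0 : R) < pi / 2 by [].
  rewrite (@FTC2_integrable R r (fun x => ln (1 + sin x)) _ _ pp ir).
  - by rewrite sin0 addr0 ln1 subr0 sin_pihalf; congr ln; ring.
  - apply: continuous_in_subspaceT => x; rewrite inE /= in_itv /= => x01.
    exact: der_continuous (dl x x01).
  - move=> x; rewrite in_itv /= => /andP[x0 x1].
    apply: cvgM; first exact: continuous_cos.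
    apply: cvgV; first by rewrite gt_eqF ?s1// !ltW.
    by apply: cvgD; [exact: cvg_cst|exact: continuous_sin].
  - move=> x; rewrite in_itv /= => /andP[x0 x1].
    by apply: dl; rewrite !ltW.
have cur : {within `[0, pi / 2], continuous (fun x => u x * r x)}.
  by move=> x; apply: cvgM; [exact: (continuous_subspaceT cu)|exact: cr].
have iur := continuous_quarter_integrable cur.
have E : JJ (fun x => sinseries n x * (1 - sin x)) = ln 2 - JJ (fun x => u x * r x).
  rewrite -Ir -RintegralB//; apply: eq_Rintegral => x; rewrite inE /= in_itv /= => x01.
  have h : cos x ^+ 2 = 1 - sin x ^+ 2 by have := cos2Dsin2 x; lra.
  have s0 : 1 + sin x != 0 by rewrite gt_eqF ?s1.
  apply: (mulIf s0); rewrite /u /r.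
  transitivity (sinseries n x * (1 - sin x ^+ 2)); first by ring.
  by rewrite -h; field.
have b1 : 0 <= JJ (fun x => u x * r x).
  apply: Rintegral_ge0 => x /=; rewrite in_itv /= => x01.
  rewrite mulr_ge0 ?sinseries_defect_ge0// divr_ge0 ?quarter_cos_ge0//.
have b2 : JJ (fun x => u x * r x) <= (2 * n%:R + 2)^-1.
  apply: le_trans (defect_integral n); apply: le_Rintegral => //.
    apply/continuous_quarter_integrable/continuous_subspaceT => x.
    by apply: cvgM; [exact: cu|exact: continuous_cos].
  move=> x /=; rewrite in_itv /= => x01.
  rewrite ler_wpM2l ?sinseries_defect_ge0// ler_pdivrMr ?s1//.
  by rewrite ler_peMr ?quarter_cos_ge0// lerDl quarter_sin_ge0.
rewrite landau_sumE E; apply/andP; split; apply: ler_wpM2l => //.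
  by rewrite lerB.
by rewrite gerBl.
Qed.

End wallis.

(** * Fourier expansion of the Legendre polynomials and Parseval's identity *)

Section legendre_fourier.
Variable R : realType.
Local Notation mu := (@lebesgue_measure R).
Implicit Types (x y : R) (n k m j : nat).
Notation P n := (legendre R n).
Notation cb := (cbin R).

(* [cbin] shifted by one, so that the index -1 is available with value 0. *)
Definition cbinp k : R := if k is k'.+1 then cb k' else 0.

(** The three-term recurrence read off one Fourier coefficient, with [a + b] the degree of the new
    polynomial. *)
Lemma cbinp_rec a b : (a%:R + b%:R) * (cbinp a.+1 * cbinp b.+1) =
  (2 * (a%:R + b%:R) - 1) / 2 * (cbinp a.+1 * cbinp b + cbinp a * cbinp b.+1) -
  (a%:R + b%:R - 1) * (cbinp a * cbinp b).
Proof.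
case: a b => [|a] [|b] /=; rewrite -?natr1 /=; first by ring.
- have b0 := ler0n R b; rewrite !(mul0r, add0r, mul1r); field; lra.
- have b0 := ler0n R a; rewrite !(mulr0, addr0, mulr1); field; lra.
have a0 := ler0n R a; have b0 := ler0n R b; field; lra.
Qed.

Definition legendre_cos n th : R :=
  \sum_(k < n.+1) cbinp k.+1 * cbinp (n - k).+1 * cos ((n%:R - 2 * k%:R) * th).

Lemma legendre_cosE n th : (P n).[cos th] = legendre_cos n th.
Proof.
suff : (P n).[cos th] = legendre_cos n th /\ (P n.+1).[cos th] = legendre_cos n.+1 th.
  by case.
elim: n => [|n [IH1 IH2]].
  rewrite legendre0 legendre1 hornerC hornerX /legendre_cos !big_ord_recl !big_ord0 /=.
  rewrite /bump /= !addn0.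
  have -> : (0 - 2 * 0) * th = 0 by ring.
  have -> : (1 - 2 * 0) * th = th by ring.
  have -> : (1 - 2 * 1) * th = - th by ring.
  by rewrite cosN cos0; split; field.
split => //.
have n0 := ler0n R n; have n2 : n%:R + 2 != 0 :> R by lra.
apply: (mulfI n2); rewrite legendre_rec IH1 IH2.
(* [E1] and [E2] bring both lower degrees to the frequencies of degree [n + 2]; the added edge terms
   vanish because [cbinp 0 = 0]. *)
pose C k := cos ((n%:R + 2 - 2 * k%:R) * th).
have E1 : legendre_cos n.+1 th * cos th * 2 =
    \sum_(k < n.+3) (cbinp k.+1 * cbinp (n.+2 - k) + cbinp k * cbinp (n.+2 - k).+1) * C k.
  under [RHS]eq_bigr do rewrite mulrDl.
  rewrite big_split /= big_ord_recr /= subnn mulr0 mul0r addr0.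
  rewrite [X in _ + X]big_ord_recl /= !mul0r add0r -big_split /=.
  rewrite /legendre_cos !mulr_suml; apply: eq_bigr => k _.
  have kn : (k <= n.+1)%N by rewrite -ltnS.
  rewrite /bump /= add1n subSS (subSn kn).
  have -> : C k = cos ((n.+1%:R - 2 * k%:R) * th + th).
    by congr cos; rewrite -[n.+1%:R]natr1; ring.
  have -> : C k.+1 = cos ((n.+1%:R - 2 * k%:R) * th - th).
    by congr cos; rewrite -[n.+1%:R]natr1 -[k.+1%:R]natr1; ring.
  by rewrite cosD cosB add0n -[cbinp _.+1]/(cb _); ring.
have E2 : legendre_cos n th =
    \sum_(k < n.+3) (cbinp k * cbinp (n.+2 - k)) * C k.
  rewrite big_ord_recr /= subnn mulr0 mul0r addr0 big_ord_recl /= !mul0r add0r.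
  apply: eq_bigr => k _.
  have kn : (k <= n)%N by rewrite -ltnS.
  rewrite /bump /= add1n subSS subSn//; congr (_ * cos _).
  by rewrite -[k.+1%:R]natr1; ring.
have -> : (2 * n%:R + 3) * cos th * legendre_cos n.+1 th =
    (2 * n%:R + 3) / 2 * (legendre_cos n.+1 th * cos th * 2) by field.
rewrite E1 E2 /legendre_cos !mulr_sumr -sumrB; apply: eq_bigr => k _.
have kn : (k <= n.+2)%N by rewrite -ltnS.
have -> : n.+2%:R = n%:R + 2 :> R by rewrite -!natr1; ring.
rewrite -/(C k) !mulrA -mulrBl; congr (_ * _).
have := cbinp_rec k (n.+2 - k).
have -> : k%:R + (n.+2 - k)%:R = n%:R + 2 :> R.
  by rewrite -natrD subnKC// -!natr1; ring.
by rewrite -!mulrA => ->; field.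
Qed.

Lemma arc_mean_cos j k :
  arc_mean (fun x => cos ((j%:R - k%:R) * acos x)) = (j == k)%:R :> R.
Proof.
wlog jk : j k / (k <= j)%N.
  move=> W; have [|kj] := leqP k j; first exact: W.
  rewrite eq_sym -W ?(ltnW kj)//; congr arc_mean; apply/funext => x.
  by rewrite -cosN; congr cos; ring.
have -> : (fun x : R => cos ((j%:R - k%:R) * acos x)) =
    fun x => x ^+ 0 * cos ((j - k)%:R * acos x).
  by apply/funext => x; rewrite mul1r natrB.
rewrite -[LHS]/(arc_moment R 0 (j - k)).
have [->|jNk] := eqVneq j k; first by rewrite subnn arc_moment00.
have -> : (j - k = (j - k).-1.+1)%N by lia.
by rewrite arc_moment0S.
Qed.

Lemma arc_mean_sum (I : Type) (r : seq I) (F : I -> R -> R) : (forall i, bm (F i)) ->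
  arc_mean (fun x => \sum_(i <- r) F i x) = \sum_(i <- r) arc_mean (F i).
Proof.
move=> bF; elim: r => [|i r IH].
  rewrite big_nil; under [fun=> _]eq_fun do rewrite big_nil -(mul0r 0).
  by rewrite arc_meanZ ?mul0r//; exact: bm_cst.
rewrite big_cons -IH -arc_meanD//; last exact: bm_sum.
by congr arc_mean; apply/funext => x; rewrite big_cons.
Qed.

(** Parseval with opposite frequencies: [n - 2 j] and [n - 2 k] have equal cosines when [k = j] and
    when [j + k = n]. Each case contributes one half, and the symmetry [c (n - j) = c j] adds them
    up. *)
Lemma arc_mean_legendre2 n :
  arc_mean (fun x => (P n).[x] ^+ 2) = \sum_(k < n.+1) (cb k * cb (n - k)) ^+ 2.
Proof.
pose c k := cb k * cb (n - k).
pose f (k : nat) (x : R) := cos ((n%:R - 2 * k%:R) * acos x).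
have bf k : bm (f k).
  by have := bm_cos (n%:R - 2 * k%:R : R) 0; under eq_fun do rewrite addr0.
have bff j k : bm (fun x => f j x * f k x) by exact: bmM (bf j) (bf k).
have bcff j k : bm (fun x => c j * c k * (f j x * f k x)).
  by apply: bmM => //; exact: bm_cst.
have E : arc_mean (fun x => (P n).[x] ^+ 2) =
    arc_mean (fun x => \sum_(j < n.+1) \sum_(k < n.+1) c j * c k * (f j x * f k x)).
  congr (_ * _); apply: eq_Rintegral => x; rewrite inE /= in_itv /= => x1.
  rewrite -{1}(@acosK R x) ?in_itv// legendre_cosE expr2; congr (_ / _).
  rewrite /legendre_cos mulr_suml; apply: eq_bigr => j _.
  by rewrite mulr_sumr; apply: eq_bigr => k _; rewrite /c /f /=; ring.
rewrite E arc_mean_sum; last by move=> j; exact: bm_sum.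
have I (j k : nat) : (j <= n)%N -> (k <= n)%N ->
    arc_mean (fun x => c j * c k * (f j x * f k x)) =
    c j * c k / 2 * ((n == j + k)%N%:R + (k == j)%N%:R).
  move=> jn kn.
  have b1 u v : bm (fun x : R => cos ((u%:R - v%:R) * acos x)).
    by have := bm_cos (u%:R - v%:R : R) 0; under eq_fun do rewrite addr0.
  have -> : (fun x => c j * c k * (f j x * f k x)) = fun x => c j * c k / 2 *
      (cos (((2 * n)%:R - (2 * (j + k))%:R) * acos x) +
       cos (((2 * k)%:R - (2 * j)%:R) * acos x)).
    apply/funext => x; rewrite /f !natrM natrD.
    have -> : (2%:R * n%:R - 2%:R * (j%:R + k%:R)) * acos x =
      (n%:R - 2 * j%:R) * acos x + (n%:R - 2 * k%:R) * acos x by ring.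
    have -> : (2%:R * k%:R - 2%:R * j%:R) * acos x =
      (n%:R - 2 * j%:R) * acos x - (n%:R - 2 * k%:R) * acos x by ring.
    by rewrite cosD cosB; field.
  rewrite arc_meanZ ?arc_meanD ?arc_mean_cos//; last exact: bmD.
  by rewrite !eqn_pmul2l.
transitivity (\sum_(j < n.+1) (c j * c (n - j)%N / 2 + c j * c j / 2)).
  apply: eq_bigr => j _; have jn : (j <= n)%N by rewrite -ltnS.
  rewrite arc_mean_sum; last by move=> k; exact: bcff.
  transitivity (\sum_(k < n.+1) (c j * c k / 2 * (n == j + k)%N%:R +
      c j * c k / 2 * (k == j :> nat)%N%:R)).
    by apply: eq_bigr => k _; rewrite -mulrDr; apply: I => //; rewrite -ltnS.
  rewrite big_split /=; congr (_ + _).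
    have nj : (n - j < n.+1)%N by rewrite ltnS leq_subr.
    rewrite (bigD1 (Ordinal nj))//= subnKC// eqxx mulr1 big1 ?addr0// => k /negP kj.
    case: eqP => [nE|]; last by rewrite mulr0.
    by exfalso; apply: kj; apply/eqP/val_inj => /=; lia.
  rewrite (bigD1 j)//= eqxx mulr1 big1 ?addr0// => k kj.
  have -> : (k == j :> nat) = false by apply/negbTE; exact: kj.
  by rewrite mulr0.
apply: eq_bigr => j _; have jn : (j <= n)%N by rewrite -ltnS.
by rewrite /c subKn//; field.
Qed.

End legendre_fourier.

(** * Harmonic sums and the expansion of Landau's constants *)

Section harmonic_asymptotics.
Variable R : realType.
Implicit Types (n k m j : nat).
Notation cb := (cbin R).

Definition harm n : R := \sum_(1 <= k < n.+1) k%:R^-1.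

Lemma harmS n : harm n.+1 = harm n + n.+1%:R^-1.
Proof. by rewrite /harm big_nat_recr. Qed.

Lemma ln_succ_sub n : 0 <= ln (n.+2%:R : R) - ln n.+1%:R <= n.+1%:R^-1.
Proof.
have n1 : 0 < n.+1%:R :> R by rewrite ltr0n.
have n2 : 0 < n.+2%:R :> R by rewrite ltr0n.
rewrite subr_ge0 ler_ln ?posrE// ler_nat leqnSn /= -ln_div ?posrE//.
have -> : n.+2%:R / n.+1%:R = 1 + n.+1%:R^-1 :> R.
  by rewrite -[n.+2%:R]natr1; field; rewrite gt_eqF.
by apply: le_ln1Dx; apply: lt_trans (ltrN10 _) _; rewrite invr_gt0.
Qed.

Lemma ln_succ_sub_ge n : n.+2%:R^-1 <= ln (n.+2%:R : R) - ln n.+1%:R.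
Proof.
have n1 : 0 < n.+1%:R :> R by rewrite ltr0n.
have n2 : 0 < n.+2%:R :> R by rewrite ltr0n.
rewrite -[X in _ <= X]opprB lerNr -ln_div ?posrE//.
have -> : n.+1%:R / n.+2%:R = 1 + - n.+2%:R^-1 :> R.
  by rewrite -[n.+1%:R]natr1 -[n.+2%:R]natr1 -[n.+1%:R]natr1; field; have := ler0n R n; lra.
by apply: le_ln1Dx; rewrite ltrN2 invf_lt1// ltr1n.
Qed.

(** [euler_gamma] is a [lim], so the content is convergence: from index 1 on the sequence is
    nonincreasing and nonnegative. *)
Lemma cvg_euler_gamma : (harm n - ln n%:R) @[n --> \oo] --> (@euler_gamma R).
Proof.
have : cvgn (fun n => harm n.+1 - ln n.+1%:R).
  apply: nonincreasing_is_cvgn.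
    apply/nonincreasing_seqP => n /=; rewrite [harm n.+2]harmS.
    have := ln_succ_sub_ge n.
    by move: (_^-1) (ln n.+2%:R) (ln n.+1%:R) (harm n.+1) => a b c d; lra.
  exists 0 => _ [n _ <-]; rewrite subr_ge0.
  suff h : ln n.+2%:R <= harm n.+1.
    apply: le_trans h; have /andP[+ _] := ln_succ_sub n; rewrite subr_ge0//.
  elim: n => [|n IH].
    rewrite /harm big_nat1 invr1; have := @le_ln1Dx R 1; rewrite -[1 + 1]/2; apply; lra.
  rewrite [harm n.+2]harmS; have /andP[_] := ln_succ_sub n.+1.
  by rewrite lerBlDl => /le_trans; apply; rewrite lerD2r.
move=> /cvg_ex[l].
rewrite (cvg_shiftS (fun n => harm n - ln n%:R)) => hl.
have : cvgn (fun n => harm n - ln n%:R) by apply/cvg_ex; exists l.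
exact.
Qed.

Lemma odd_harm n : \sum_(k < n.+1) (2 * k%:R + 1)^-1 = harm (2 * n.+1) - harm n.+1 / 2 :> R.
Proof.
elim: n => [|n IH].
  have h0 : harm 0 = 0 by rewrite /harm big_geq.
  have -> : (2 * 1 = 2)%N by [].
  by rewrite big_ord_recl big_ord0 !harmS h0 /=; field.
have -> : (2 * n.+2 = (2 * n.+1).+2)%N by lia.
rewrite big_ord_recr /= IH (harmS (2 * n.+1).+1) (harmS (2 * n.+1)) (harmS n.+1).
have n0 := ler0n R n.
have -> : (2 * n.+1).+2%:R = 2 * n%:R + 4 :> R.
  have -> : ((2 * n.+1).+2 = 2 * n + 4)%N by lia.
  by rewrite natrD natrM.
have -> : (2 * n.+1).+1%:R = 2 * n%:R + 3 :> R.
  have -> : ((2 * n.+1).+1 = 2 * n + 3)%N by lia.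
  by rewrite natrD natrM.
rewrite -[n.+2%:R]natr1 -[n.+1%:R]natr1; field; lra.
Qed.

Lemma cvg_landau_sum : landau_sum R n @[n --> \oo] --> (2 / pi * ln 2 : R).
Proof.
apply: (@squeeze_cvgr _ _ _ _ (fun n => 2 / pi * (ln 2 - (2 * n%:R + 2)^-1)) (fun=> 2 / pi * ln 2)).
- by apply: nearW => n; exact: landau_sum_bounds.
- apply: cvgM; first exact: cvg_cst.
  rewrite -[X in _ --> X]subr0; apply: cvgB; first exact: cvg_cst.
  by apply: cvg_inv2n; lra.
- exact: cvg_cst.
Qed.

Definition cbin2_sum n := \sum_(k < n.+1) cb k ^+ 2.

(** Half of [4 * ln 2] is the limit of [landau_sum]; the other half comes from
    [ln (2 N) = ln 2 + ln N] in the odd harmonic sum. *)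
Lemma cvg_cbin2_sum : cbin2_sum n - ln n.+1%:R / pi @[n --> \oo] -->
  ((euler_gamma + 4 * ln 2) / pi : R).
Proof.
pose g n : R := harm n - ln n%:R.
have p0 : pi != 0 :> R by rewrite gt_eqF// pi_gt0.
have -> : (fun n => cbin2_sum n - ln n.+1%:R / pi) = fun n =>
    landau_sum R n + 2 / pi * (g (2 * n.+1)%N - g n.+1 / 2 + ln 2).
  apply/funext => n.
  have -> : landau_sum R n = cbin2_sum n - 2 / pi * (harm (2 * n.+1) - harm n.+1 / 2).
    by rewrite /landau_sum sumrB -mulr_sumr odd_harm.
  have -> : harm (2 * n.+1) = g (2 * n.+1)%N + (ln 2 + ln n.+1%:R).
    by rewrite /g natrM lnM ?posrE ?ltr0n//; ring.
  have -> : harm n.+1 = g n.+1 + ln n.+1%:R by rewrite /g; ring.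
  by move: (pi) p0 => q q0; field.
have -> : (euler_gamma + 4 * ln 2) / pi =
    2 / pi * ln 2 + 2 / pi * (euler_gamma - euler_gamma / 2 + ln 2) :> R.
  by move: (pi) p0 => q q0; field.
apply: cvgD; first exact: cvg_landau_sum.
apply: cvgM; first exact: cvg_cst.
apply: cvgD; last exact: cvg_cst.
apply: cvgB; last first.
  apply: cvgM; last exact: cvg_cst.
  by rewrite (cvg_shiftS g); exact: cvg_euler_gamma.
have h : (2 * n.+1)%N @[n --> \oo] --> \oo.
  move=> A [N _ NA]; exists N => // m /= Nm; apply: NA => /=; lia.
apply: (@cvg_comp _ _ _ (fun n => (2 * n.+1)%N) g); [exact: h|exact: cvg_euler_gamma].
Qed.

Lemma cvg_ln_div : ln n.+1%:R / n.+1%:R @[n --> \oo] --> (0 : R).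
Proof.
apply: (@squeeze_cvgr _ _ _ _ (fun=> 0) (fun n => 2 * Num.sqrt (n.+1%:R^-1 : R))).
- apply: nearW => n; have n1 : 0 < n.+1%:R :> R by rewrite ltr0n.
  rewrite divr_ge0 ?ln_ge0 ?ler1n//= ler_pdivrMr// sqrtrV ?(ltW n1)//.
  have s0 : 0 < Num.sqrt (n.+1%:R : R) by rewrite sqrtr_gt0.
  rewrite -{1 3}[n.+1%:R](@sqr_sqrtr R) ?(ltW n1)//.
  move: (Num.sqrt _) s0 => s s0; rewrite lnXn//.
  have -> : 2 * s^-1 * s ^+ 2 = s *+ 2 by rewrite -mulr_natl; field; rewrite gt_eqF.
  by rewrite lerMn2r/=; exact/ltW/ln_sublinear.
- exact: cvg_cst.
- rewrite -[X in _ --> X](mulr0 2); apply: cvgM; first exact: cvg_cst.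
  rewrite -[X in _ --> X](@sqrtr0 R).
  apply: (@cvg_comp _ _ _ (fun n => n.+1%:R^-1 : R) Num.sqrt); first exact: cvg_harmonic.
  exact: sqrt_continuous.
Qed.

Lemma cvg_ln_succ : ln n.+1%:R - ln n%:R @[n --> \oo] --> (0 : R).
Proof.
rewrite -cvg_shiftS.
apply: (@squeeze_cvgr _ _ _ _ (fun=> 0) (@harmonic R)).
- by apply: nearW => n; exact: ln_succ_sub.
- exact: cvg_cst.
- exact: cvg_harmonic.
Qed.

Definition cbin2_conv n := \sum_(k < n.+1) (cb k * cb (n - k)) ^+ 2.

(* By the symmetry [k <-> n - k], [n * cbin2_conv n] is twice the sum of
   [k * cbin k ^+ 2 * cbin (n - k) ^+ 2], and [k * cbin k ^+ 2] lies between
   [1 / pi - cbin k ^+ 2 / 2] and [1 / pi]. *)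
Lemma cbin2_conv_bounds n : n%:R * cbin2_conv n <= 2 / pi * cbin2_sum n <=
  (n%:R + 1) * cbin2_conv n.
Proof.
have sum_rev : \sum_(k < n.+1) (n - k)%:R * (cb k * cb (n - k)) ^+ 2 =
    \sum_(k < n.+1) k%:R * (cb k * cb (n - k)) ^+ 2.
  rewrite (reindex_inj rev_ord_inj) /=; apply: eq_bigr => k _.
  have kn : (k <= n)%N by rewrite -ltnS.
  by rewrite subSS subKn// [cb _ * _]mulrC.
have sum_rev2 : \sum_(k < n.+1) cb (n - k) ^+ 2 = cbin2_sum n.
  rewrite (reindex_inj rev_ord_inj) /=; apply: eq_bigr => k _.
  have kn : (k <= n)%N by rewrite -ltnS.
  by rewrite subSS subKn.
have E : n%:R * cbin2_conv n = \sum_(k < n.+1) 2 * k%:R * (cb k * cb (n - k)) ^+ 2.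
  under [RHS]eq_bigr do rewrite -mulrA mulr_natl mulr2n.
  rewrite big_split /= -{1}sum_rev -big_split /= /cbin2_conv mulr_sumr.
  apply: eq_bigr => k _; have kn : (k <= n)%N by rewrite -ltnS.
  by rewrite -mulrDl -natrD subnK.
have p0 : 0 < pi :> R by exact: pi_gt0.
apply/andP; split.
  rewrite E -sum_rev2 mulr_sumr; apply: ler_sum => k _.
  rewrite exprMn mulrA ler_wpM2r ?sqr_ge0// -!mulrA ler_wpM2l//.
  exact: cbin2_le.
rewrite [X in _ <= X]mulrDl E mul1r /cbin2_conv -big_split /= -sum_rev2 mulr_sumr.
apply: ler_sum => k _.
have k0 : 0 < 2 * k%:R + 1 :> R by have := ler0n R k; lra.
have -> : 2 * k%:R * (cb k * cb (n - k)) ^+ 2 + (cb k * cb (n - k)) ^+ 2 =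
    (2 * k%:R + 1) * cb k ^+ 2 * cb (n - k) ^+ 2 by ring.
rewrite ler_wpM2r ?sqr_ge0// [X in _ <= X]mulrC -ler_pdivrMr//.
exact: cbin2_ge.
Qed.

(** The two bounds of [cbin2_conv_bounds] differ by exactly [cbin2_conv n], so this limit makes them
    sharp; the first bound already gives an order of [ln n / n]. *)
Lemma cvg_cbin2_conv0 : cbin2_conv n @[n --> \oo] --> (0 : R).
Proof.
rewrite -cvg_shiftS.
have c0 n : 0 <= cbin2_conv n by apply: sumr_ge0 => k _; exact: sqr_ge0.
have p2 : 0 <= 2 / pi :> R by rewrite divr_ge0// pi_ge0.
apply: (@squeeze_cvgr _ _ _ _ (fun=> 0)
   (fun n => 2 / pi * (cbin2_sum n.+1 / n.+2%:R) * 2)).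
- apply: nearW => n; rewrite c0 /=.
  have /andP[h _] := cbin2_conv_bounds n.+1.
  have n1 : 0 < n.+1%:R :> R by rewrite ltr0n.
  have n2 : 0 < n.+2%:R :> R by rewrite ltr0n.
  rewrite -(ler_pM2l n1); apply: le_trans h _.
  (* The factor 2 of the majorant pays for the denominator [n + 2] in place of [n + 1]. *)
  rewrite (_ : n.+1%:R * _ = 2 / pi * cbin2_sum n.+1 * (n.+1%:R * 2 / n.+2%:R)); last by ring.
  have s0 : 0 <= cbin2_sum n.+1 by apply: sumr_ge0 => k _; exact: sqr_ge0.
  apply: ler_peMr; first by rewrite mulr_ge0.
  rewrite ler_pdivlMr// mul1r -natrM ler_nat; lia.
- exact: cvg_cst.
- have -> : 0 = 2 / pi * ((euler_gamma + 4 * ln 2) / pi * 0 + 0 / pi) * 2 :> R by ring.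
  apply: cvgM; last exact: cvg_cst.
  apply: cvgM; first exact: cvg_cst.
  rewrite (cvg_shiftS (fun n => cbin2_sum n / n.+1%:R)).
  have -> : (fun n => cbin2_sum n / n.+1%:R) = fun n =>
      (cbin2_sum n - ln n.+1%:R / pi) * n.+1%:R^-1 + ln n.+1%:R / n.+1%:R / pi.
    by apply/funext => n; ring.
  apply: cvgD; apply: cvgM; try exact: cvg_cst.
  + exact: cvg_cbin2_sum.
  + exact: cvg_harmonic.
  + exact: cvg_ln_div.
Qed.

Lemma cvg_cbin2_conv : n%:R * cbin2_conv n - 2 / pi ^+ 2 * ln n%:R @[n --> \oo] -->
  (2 / pi ^+ 2 * (euler_gamma + ln 16) : R).
Proof.
have p0 : pi != 0 :> R by rewrite gt_eqF// pi_gt0.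
pose d n := 2 / pi * cbin2_sum n - n%:R * cbin2_conv n.
have cd : d n @[n --> \oo] --> (0 : R).
  apply: (@squeeze_cvgr _ _ _ _ (fun=> 0) cbin2_conv).
  - apply: nearW => n; have := cbin2_conv_bounds n; rewrite mulrDl mul1r /d.
    by move=> /andP[h1 h2]; apply/andP; split; lra.
  - exact: cvg_cst.
  - exact: cvg_cbin2_conv0.
have -> : (fun n : nat => n%:R * cbin2_conv n - 2 / pi ^+ 2 * ln n%:R) = fun n =>
    2 / pi * (cbin2_sum n - ln n.+1%:R / pi) + 2 / pi ^+ 2 * (ln n.+1%:R - ln n%:R) - d n.
  by apply/funext => n; rewrite /d; move: (pi) p0 => q q0; field.
have -> : 2 / pi ^+ 2 * (euler_gamma + ln 16) =
    2 / pi * ((euler_gamma + 4 * ln 2) / pi) + 2 / pi ^+ 2 * 0 - 0 :> R.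
  have -> : ln 16 = 4 * ln 2 :> R.
    by rewrite mulr_natl -lnXn//; congr ln; ring.
  by move: (pi) p0 => q q0; field.
apply: cvgB cd; apply: cvgD; apply: cvgM; try exact: cvg_cst.
- exact: cvg_cbin2_sum.
- exact: cvg_ln_succ.
Qed.

End harmonic_asymptotics.

(** * The asymptotic expansion *)

Section assembly.
Variable R : realType.
Implicit Types n m : nat.

Lemma derive_alphaE n : (0 < n)%N ->
  derive1 (@Defs.alpha R n.-1) 0 = (2 * (2 * n%:R + 1))^-1 *
    ((n%:R + 1)^-1 * legendre_mean n (@Jstar R) + 2 * cbin2_conv R n).
Proof.
case: n => // n _; rewrite (alpha_derivative R n).2 II_legendre_kernel_Bstar.
rewrite /cbin2_conv -arc_mean_legendre2 /arc_mean /legendre_mean.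
have p0 : pi != 0 :> R by rewrite gt_eqF// pi_gt0.
have n0 := ler0n R n.+1.
rewrite mulKf; last lra.
move: (pi) p0 (Rintegral _ _ _) (Rintegral _ _ _) => q q0 a b; field.
by rewrite q0 /=; lra.
Qed.

Lemma cvg_scaled_derive_alpha :
  n%:R ^+ 2 * (derive1 (@Defs.alpha R n.-1) 0
    - (ln n%:R / (pi ^+ 2 * n%:R ^+ 2) + Clin / n%:R ^+ 2)) @[n --> \oo] --> (0 : R).
Proof.
have p0 : pi != 0 :> R by rewrite gt_eqF// pi_gt0.
pose X n := legendre_mean n (@Jstar R).
pose Y n := n%:R * cbin2_conv R n - 2 / pi ^+ 2 * ln n%:R.
pose r n : R := n%:R / (2 * n%:R + 1).
pose s n : R := n%:R / (n%:R + 1).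
have cX : X n @[n --> \oo] --> (arc_mean (@Jstar R)).
  by apply: cvg_legendre_mean; exact: within_continuous_Jstar.
have cY : Y n @[n --> \oo] --> (2 / pi ^+ 2 * (euler_gamma + ln 16) : R).
  exact: cvg_cbin2_conv.
have cr : r n @[n --> \oo] --> (1 / 2 : R).
  have := @cvg_ratio R 0 1 (lexx _).
  by under eq_fun do rewrite addr0.
have cs : s n @[n --> \oo] --> (1 : R).
  have -> : s = fun n => 1 - (harmonic n : R).
    by apply/funext => n; rewrite /s /= -natr1; field; have := ler0n R n; lra.
  rewrite -[X in _ --> X]subr0; apply: cvgB; first exact: cvg_cst.
  exact: cvg_harmonic.
(* The logarithm enters with the factor [2 * r n = 1 - 1 / (2 n + 1)] instead of 1; this is the
   resulting error. *)
have cl : ln n.+1%:R * (2 * n.+1%:R + 1)^-1 @[n --> \oo] --> (0 : R).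
  have -> : (fun n => ln n.+1%:R * (2 * n.+1%:R + 1)^-1) =
    fun n => ln n.+1%:R / n.+1%:R * r n.+1.
    apply/funext => n; rewrite /r -natr1; have n0 := ler0n R n.
    by field; apply/andP; split; lra.
  rewrite -[X in _ --> X](mul0r (1 / 2)); apply: cvgM; first exact: cvg_ln_div.
  by rewrite (cvg_shiftS r).
have E : 1 / 2 * (1 / 2 * 1 * arc_mean (@Jstar R)) +
    1 / 2 * (2 / pi ^+ 2 * (euler_gamma + ln 16)) - (pi ^+ 2)^-1 * 0 - Clin = 0 :> R.
  rewrite /Clin /arc_mean.
  have -> : II (fun x : R => Jstar x / Num.sqrt (1 - x ^+ 2)) = II (fun x => Jstar x / sx x).
    by [].
  by move: (pi) p0 (Rintegral _ _ _) => q q0 a; field.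
pose v n : R := 1 / 2 * (r n.+1 * s n.+1 * X n.+1) + r n.+1 * Y n.+1 -
    (pi ^+ 2)^-1 * (ln n.+1%:R * (2 * n.+1%:R + 1)^-1) - Clin.
have cv : v n @[n --> \oo] --> (0 : R).
  rewrite -[X in _ --> X]E /v.
  apply: cvgB; last exact: cvg_cst.
  apply: cvgB; last by apply: cvgM; [exact: cvg_cst|exact: cl].
  apply: cvgD.
    apply: cvgM; first exact: cvg_cst.
    apply: cvgM; last by rewrite (cvg_shiftS X).
    by apply: cvgM; rewrite ?(cvg_shiftS r) ?(cvg_shiftS s).
  by apply: cvgM; rewrite ?(cvg_shiftS r) ?(cvg_shiftS Y).
(* Passing to [n + 1] makes the divisions by [n] legitimate in the identity of [u] and [v]. *)
rewrite -cvg_shiftS.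
set u := (X in X @ _ --> _).
suff -> : u = v by exact: cv.
apply/funext => n; have := @derive_alphaE n.+1 isT; rewrite /u /= => ->.
rewrite /v /X /Y /r /s.
have n0 : 0 < n.+1%:R :> R by rewrite ltr0n.
move: (pi) p0 n.+1%:R n0 (ln _) (legendre_mean _ _) (cbin2_conv _ _) Clin.
move=> q q0 N N0 l a b c; field.
by rewrite q0 /=; lra.
Qed.

End assembly.

Theorem theorem1p3 (R : realType) :
  (forall n : nat, (0 < n)%N -> derivable (@alpha R n.-1) 0 1) /\
  (fun n : nat => derive1 (@alpha R n.-1) 0
     - (ln n%:R / (pi ^+ 2 * n%:R ^+ 2) + Clin / n%:R ^+ 2))
  =o_\oo (fun n : nat => (n%:R ^+ 2)^-1 : R).
Proof.
split=> [n _|]; first exact: (alpha_derivative R n.-1).1.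
apply/eqoP => e e0; have /cvgrPdist_le/(_ _ e0) := @cvg_scaled_derive_alpha R.
move=> H; near=> n.
have n0 : (0 < n)%N by near: n; exact: nbhs_infty_gt.
have n2 : 0 < n%:R ^+ 2 :> R by rewrite exprn_gt0 ?ltr0n.
have n3 : 0 <= (n%:R ^+ 2)^-1 :> R by rewrite invr_ge0 ltW.
rewrite (ger0_norm n3) ler_pdivlMr// mulrC.
rewrite -{1}(ger0_norm (ltW n2)) -normrM -normrN -sub0r.
by near: n.
Unshelve. all: by end_near. Qed.
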